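(* There is a randomized, random-walk-based cut procedure which, given an undirected graph $G=(V,E)$ with $n$ vertices and $m$ edges and a parameter $\phi$, takes $\mathcal{O}\big((m\log n)/\phi^2\big)$ steps and terminates with one of the following outcomes: (1) it certifies that $G$ has conductance $\Phi(G)\ge\phi$; (2) it finds a cut $(A,\bar A)$ of $G$ (with $\bar A=V\setminus A$) of conductance $\Phi_G(A)=\mathcal{O}(\sqrt{\phi}\log^{3/2} m)$, and moreover one of the following holds: (a) $\operatorname{vol}(A)$ and $\operatorname{vol}(\bar A)$ are both $\Omega(m\sqrt{\phi}/\log^{3/2} m)$; or (b) $\operatorname{vol}(\bar A)=\mathcal{O}(m\sqrt{\phi}/\log^{3/2} m)$ and $A$ is a near $6\phi$-expander in $G$.
   Context: For a vertex $v$, $d_v$ is its degree. For $S\subseteq V$, $\operatorname{vol}(S)=\sum_{v\in S} d_v$ and $\operatorname{border}(S)=|E(S,V\setminus S)|$, where $E(X,Y)$ is the set of edges with one endpoint in $X$ and the other in $Y$. The conductance of a cut $(S,V\setminus S)$ is $\Phi_G(S)=\operatorname{border}(S)/\min(\operatorname{vol}(S),\operatorname{vol}(V\setminus S))$, and $\Phi(G)$ is the minimum conductance over all cuts with both sides nonempty (defined to be $1$ if $|V|=1$). A subset $A\subseteq V$ is a near $\psi$-expander in $G$ if for every $X\subseteq A$ with $\operatorname{vol}(X)\le\operatorname{vol}(A)/2$ one has $|E(X,V\setminus X)|\ge\psi\operatorname{vol}(X)$. *)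

(* Defs.v *)
From HB Require Import structures.
From mathcomp Require Import all_boot all_order all_algebra.
From mathcomp Require Import boolp reals exp.

Set Implicit Arguments.
Unset Strict Implicit.
Unset Printing Implicit Defensive.

Import Order.TTheory GRing.Theory Num.Theory.
Local Open Scope ring_scope.

(* Simple graphs are symmetric irreflexive relations; edges are 2-element
   vertex sets. *)
Section Graph.
Variables (V : finType) (e : rel V).

Definition edges : {set {set V}} :=
  [set f : {set V} | [exists x, exists y, e x y && (f == [set x; y])]].

Definition edges_between (X Y : {set V}) : {set {set V}} :=
  [set f in edges |
    [exists x, exists y, [&& x \in X, y \in Y & f == [set x; y]]]].

Definition degree (v : V) : nat := #|[set u | e v u]|.

Definition vol (S : {set V}) : nat := (\sum_(v in S) degree v)%N.

Definition border (S : {set V}) : nat := #|edges_between S (~: S)|.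

Definition is_cut (S : {set V}) : bool := (S != set0) && (~: S != set0).

(* A cut with a side of volume 0 is crossed by no edge, and 0 / 0 = 0: it has
   conductance 0, like any other cut crossed by no edge. *)
Definition conductance (R : realType) (S : {set V}) : R :=
  (border S)%:R / (minn (vol S) (vol (~: S)))%:R.

(* Every cut has conductance at most 1, so the unit 1 of the iterated minimum
   only matters when there is no cut. *)
Definition graph_conductance (R : realType) : R :=
  \big[Num.min/1]_(S : {set V} | is_cut S) conductance R S.

Definition near_expander (R : realType) (psi : R) (A : {set V}) : Prop :=
  forall X : {set V}, X \subset A ->
    (vol X)%:R <= (vol A)%:R / 2 :> R ->
    psi * (vol X)%:R <= #|edges_between X (~: X)|%:R.

End Graph.

(* The machine model is a randomized real RAM, programmed in a while language.
   A store has integer arrays and real arrays, named by numerals occurring in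
   the program, with computed indices. Integers can be added, subtracted
   (truncated at 0) and compared; reals can be added, subtracted, multiplied,
   divided and compared. There is no integer multiplication and no rounding of
   reals to integers, which at unit cost would be unrealistically powerful. *)
Inductive iexp : Type :=
| IConst of nat
| IGet of nat & iexp
| IAdd of iexp & iexp
| ISub of iexp & iexp.

Inductive rexp : Type :=
| ROfNat of iexp
| RGet of nat & iexp
| RAdd of rexp & rexp
| RSub of rexp & rexp
| RMul of rexp & rexp
| RDiv of rexp & rexp.

Inductive bexp : Type :=
| BILe of iexp & iexp
| BRLe of rexp & rexp
| BNot of bexp
| BAnd of bexp & bexp.

Inductive cmd : Type :=
| CSkip
| CISet of nat & iexp & iexp  (* CISet a i x is a[i] := x *)
| CRSet of nat & iexp & rexp
| CFlip of nat & iexp         (* CFlip a i stores a random bit in a[i] *)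
| CSeq of cmd & cmd
| CIf of bexp & cmd & cmd
| CWhile of bexp & cmd.

Section Semantics.
Variable R : realType.

Record store : Type := Store {
  imem : nat -> nat -> nat;
  rmem : nat -> nat -> R
}.

Definition upd (T : Type) (f : nat -> nat -> T) (a i : nat) (x : T)
    : nat -> nat -> T :=
  fun b j => if (b == a) && (j == i) then x else f b j.

Fixpoint ieval (s : store) (x : iexp) : nat :=
  match x with
  | IConst k => k
  | IGet a i => imem s a (ieval s i)
  | IAdd x1 x2 => (ieval s x1 + ieval s x2)%N
  | ISub x1 x2 => (ieval s x1 - ieval s x2)%N
  end.

Fixpoint reval (s : store) (x : rexp) : R :=
  match x with
  | ROfNat i => (ieval s i)%:R
  | RGet a i => rmem s a (ieval s i)
  | RAdd x1 x2 => reval s x1 + reval s x2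
  | RSub x1 x2 => reval s x1 - reval s x2
  | RMul x1 x2 => reval s x1 * reval s x2
  | RDiv x1 x2 => reval s x1 / reval s x2
  end.

Fixpoint beval (s : store) (b : bexp) : bool :=
  match b with
  | BILe x y => (ieval s x <= ieval s y)%N
  | BRLe x y => reval s x <= reval s y
  | BNot b1 => ~~ beval s b1
  | BAnd b1 b2 => beval s b1 && beval s b2
  end.

(* A configuration is the stack of commands still to be executed, together
   with the store. *)
Definition config : Type := (seq cmd * store)%type.

(* Each step performs one command or one test; the expressions of a fixed
   program have bounded size, so their evaluation only costs a constant factor.
   Each step is given a fresh random bit, which only CFlip looks at. *)
Definition step (bit : bool) (g : config) : config :=
  let: (k, s) := g in
  match k with
  | [::] => ([::], s)
  | CSkip :: k' => (k', s)
  | CISet a i x :: k' =>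
      (k', Store (upd (imem s) a (ieval s i) (ieval s x)) (rmem s))
  | CRSet a i x :: k' =>
      (k', Store (imem s) (upd (rmem s) a (ieval s i) (reval s x)))
  | CFlip a i :: k' =>
      (k', Store (upd (imem s) a (ieval s i) (nat_of_bool bit)) (rmem s))
  | CSeq c1 c2 :: k' => ([:: c1, c2 & k'], s)
  | CIf b c1 c2 :: k' => ((if beval s b then c1 else c2) :: k', s)
  | CWhile b c :: k' =>
      (if beval s b then [:: c, CWhile b c & k'] else k', s)
  end.

Definition run (P : cmd) (s : store) (bits : seq bool) : config :=
  foldl (fun g bit => step bit g) ([:: P], s) bits.

Definition halted (g : config) : bool := nilp g.1.

Definition prob (T : nat) (Q : T.-tuple bool -> Prop) : R :=
  #|[set w : T.-tuple bool | `[< Q w >]]|%:R / #|{: T.-tuple bool}|%:R.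

End Semantics.

Section InputOutput.
Variables (R : realType) (n : nat).

(* Every edge is listed exactly once, in either orientation and in any
   order. *)
Definition edge_list (e : rel 'I_n) (es : seq ('I_n * 'I_n)) : Prop :=
  perm_eq [seq [set p.1; p.2] | p <- es] (enum (edges e)).

(* Integer array 0 holds n and m, integer arrays 1 and 2 hold the endpoints of
   the edges, real array 0 holds phi, and everything else is 0. *)
Definition input (es : seq ('I_n * 'I_n)) (phi : R) : store R :=
  Store
    (fun a i => match a with
       | 0 => nth 0 [:: n; size es] i
       | 1 => nth 0 [seq val p.1 | p <- es] i
       | 2 => nth 0 [seq val p.2 | p <- es] i
       | _ => 0
       end)%N
    (fun a i => if (a == 0%N) && (i == 0%N) then phi else 0).

Inductive outcome : Type :=
| Certified
| Cut of {set 'I_n}.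

(* Cell 0 of integer array 3 tells whether a cut is returned, and integer
   array 4 is then the indicator array of its side A. *)
Definition output (s : store R) : outcome :=
  if imem s 3 0 == 0%N then Certified
  else Cut [set v : 'I_n | imem s 4 v != 0%N].

(* C bounds the O(.) and c the Omega(.) of the cut guarantees. *)
Definition valid_outcome (e : rel 'I_n) (phi C c : R) (o : outcome) : Prop :=
  let m := #|edges e| in
  let log32 := ln m%:R `^ (3 / 2) : R in
  match o with
  | Certified => phi <= graph_conductance e R
  | Cut A =>
      [/\ is_cut A,
          conductance e R A <= C * (Num.sqrt phi * log32)
        & (c * (m%:R * Num.sqrt phi / log32) <= (vol e A)%:R
           /\ c * (m%:R * Num.sqrt phi / log32) <= (vol e (~: A))%:R)
          \/ ((vol e (~: A))%:R <= C * (m%:R * Num.sqrt phi / log32)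
              /\ near_expander e (6 * phi) A)]
  end.

End InputOutput.

(* Main.v *)
Require Import Defs.
From HB Require Import structures.
From mathcomp Require Import all_boot all_order all_algebra.
From mathcomp Require Import boolp reals sequences exp.
From mathcomp Require Import zify ring lra.

Set Implicit Arguments.
Unset Strict Implicit.
Unset Printing Implicit Defensive.

Import Order.TTheory GRing.Theory Num.Theory.
Local Open Scope ring_scope.

(* Proof idea. A set A of vertices, initially everything, only ever shrinks.
   An epoch consists of T ~ 1 / (12 phi) rounds. In round t, independent random
   signs on the half-edges are pushed through the t lazy walk steps performed so
   far in the epoch, on the successive induced graphs G{A_1}, ..., G{A_t}; the
   resulting real numbers u_v are random projections of the walk distributions
   p_v. They are centered, the upper level sets at T geometric thresholds are
   tested, and the last one of conductance at most sqrt kap, kap ~ log^3 m / T,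
   is removed from A; then the walk makes one more step on what is left.
   By a discrete Cheeger inequality the removed part and the energy of u on the
   rest together carry a fraction ~ kap of the variance of u. A tail bound for
   random signs lifts this to the p_v at the price of a factor log^2 m: the
   expected potential sum_v d_v |p_v - mean|^2 drops by a factor
   1 - Omega(log m / T) per round, hence to 1 / poly(m) in an epoch. At that
   point the walk from any X in A of at most half the volume has lost a constant
   fraction of its mass, which crossed the boundary of X in T steps, so
   border(X) >= vol(X) / (2 T) >= 6 phi vol(X).
   Removal stops (A is frozen) as soon as the removed volume is balanced. An
   unfrozen A fails to be a near expander after one epoch with probability at
   most 1/2, and near expansion is inherited by subsets, so O(d log n) epochs
   leave a failure probability n^-d. If log^3 m = Omega(T) every cut has the
   required conductance, and a greedy balanced one is returned. *)

(** * Lazy walks on induced subgraphs *)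

(** Two dependencies shape the argument. The current set depends on the earlier signs, so every
    round needs fresh ones and recomputes the projection from its start; a round costs O(m T), an
    epoch O(m T^2), and this is the origin of m / phi^2. Within a round, the removed set depends on
    the very signs over which squares are averaged, so the second moment of a projection cannot be
    evaluated on that set. Instead, each squared projection is bounded, for every sign pattern, by
    k^2 times its mean plus an excess; the excess is summed over all of A and all its edges,
    whatever is removed, and its mean is exponentially small in k. Taking k of order log m costs
    log^2 m, and the potential still has to drop by a factor 1 - Omega(log m / T) per round, which
    makes kap proportional to log^3 m. When phi is tiny, kap alone could not dominate the excess;
    the integrality of borders then guarantees a gain of order 1 / m^2. The machine has no square
    root, rounding or integer product, so thresholds and tests are stated on squares, and T, the
    logarithms and the number of bits are found by counting. *)

Section HalfEdges.
Variables (R : realType) (V : eqType) (es : seq (V * V)).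
Implicit Types (A B : V -> bool) (x f g : V -> R).

(** A vertex occurs here as often as its degree. Plain sums over this list are thus degree-weighted
    sums, counts are volumes, and isolated vertices are absent. *)
Definition half_edges : seq V := unzip1 es ++ unzip2 es.
Definition deg (v : V) : nat := count_mem v half_edges.
Definition vsum A f : R := \sum_(v <- half_edges | A v) f v.
Definition all_v (v : V) : bool := true.

Lemma size_half_edges : size half_edges = (size es).*2.
Proof. by rewrite size_cat !size_map addnn. Qed.

Lemma mem_half_edges p : p \in es -> (p.1 \in half_edges) && (p.2 \in half_edges).
Proof. by move=> pe; rewrite !mem_cat !map_f ?orbT. Qed.

Lemma vsumE A f : vsum A f =
  \sum_(p <- es) ((A p.1)%:R * f p.1 + (A p.2)%:R * f p.2).
Proof.
rewrite /vsum big_cat /= !big_map !(big_mkcond (fun p => A _)) /= -big_split /=.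
by apply: eq_bigr => p _; do 2!case: (A _); rewrite ?mul1r ?mul0r.
Qed.

Lemma vsum_mkcond A f : vsum A f = \sum_(v <- half_edges) (A v)%:R * f v.
Proof.
by rewrite /vsum big_mkcond; apply: eq_bigr => v _; case: (A v); rewrite ?mul1r ?mul0r.
Qed.

Lemma eq_vsum A B f g : {in half_edges, A =1 B} ->
  {in half_edges, forall v, A v -> f v = g v} -> vsum A f = vsum B g.
Proof.
move=> AB fg; rewrite !vsum_mkcond; apply: eq_big_seq => v vh.
by rewrite -(AB v vh); case Av: (A v); rewrite ?mul0r ?mul1r ?fg.
Qed.

Lemma ler_vsum A f g : {in half_edges, forall v, A v -> f v <= g v} ->
  vsum A f <= vsum A g.
Proof.
move=> fg; rewrite !vsum_mkcond big_seq [X in _ <= X]big_seq.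
apply: ler_sum => v vh; have := fg v vh.
by case: (A v); rewrite ?mul0r ?mul1r // => /(_ isT).
Qed.

Lemma vsum_ge0 A f : {in half_edges, forall v, A v -> 0 <= f v} -> 0 <= vsum A f.
Proof.
move=> f0; have -> : 0 = vsum A (fun=> 0) by rewrite /vsum big1.
exact: ler_vsum.
Qed.

Lemma vsum_subset A B f : {in half_edges, forall v, A v -> B v} ->
  {in half_edges, forall v, B v -> 0 <= f v} -> vsum A f <= vsum B f.
Proof.
move=> AB f0; rewrite !vsum_mkcond big_seq [X in _ <= X]big_seq.
apply: ler_sum => v vh; have := AB v vh; have := f0 v vh.
case: (A v) => [h /(_ isT) Bv|]; first by rewrite Bv.
by case: (B v) => [/(_ isT)|]; rewrite ?mul0r ?mul1r.
Qed.

Lemma vsumD A f g : vsum A (fun v => f v + g v) = vsum A f + vsum A g.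
Proof. by rewrite /vsum big_split. Qed.

Lemma vsumZ A c f : vsum A (fun v => c * f v) = c * vsum A f.
Proof. by rewrite /vsum mulr_sumr. Qed.

Lemma vsum_split A B f : {in half_edges, forall v, B v -> A v} ->
  vsum A f = vsum B f + vsum (fun v => A v && ~~ B v) f.
Proof.
move=> BA; rewrite !vsum_mkcond -big_split; apply: eq_big_seq => v vh /=.
have := BA v vh; case: (B v) => [->|_] //=; rewrite ?andbT ?andbF //; ring.
Qed.

Definition volR A : R := vsum A (fun=> 1).

Lemma volR_ge0 A : 0 <= volR A.
Proof. by apply: vsum_ge0. Qed.

Lemma volR_all : volR all_v = 2 * (size es)%:R.
Proof.
rewrite /volR /vsum big_const_seq count_predT iter_addr_0 size_half_edges.
by rewrite -mul2n natrM.
Qed.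

Lemma volR_natE A : volR A = (count A half_edges)%:R.
Proof. by rewrite /volR /vsum -sum1_count natr_sum. Qed.

Lemma volR_le_all A : volR A <= 2 * (size es)%:R.
Proof. by rewrite -volR_all; apply: vsum_subset. Qed.

Lemma deg_gt0 v : v \in half_edges -> (0 < deg v)%N.
Proof. by rewrite -has_pred1 has_count. Qed.

Lemma sum_pred1_half_edges (F : V -> R) v :
  \sum_(w <- half_edges) (v == w)%:R * F w = (deg v)%:R * F v.
Proof.
rewrite /deg -sum1_count natr_sum mulr_suml [RHS]big_mkcond /=.
by apply: eq_bigr => w _; rewrite eq_sym; case: eqP => [->|]; rewrite ?mul0r.
Qed.

Definition gain x v (p : V * V) : R :=
  (p.1 == v)%:R * (x p.2 - x p.1) + (p.2 == v)%:R * (x p.1 - x p.2).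

(* One step of the lazy random walk on the graph induced by A, where edges
   leaving A are turned into loops. *)
Definition mix A x v : R :=
  x v + (\sum_(p <- es | A p.1 && A p.2) gain x v p) / (2 * (deg v)%:R).

Definition energy A x : R :=
  \sum_(p <- es | A p.1 && A p.2) (x p.1 - x p.2) ^+ 2.

Lemma energy_ge0 A x : 0 <= energy A x.
Proof. by apply: sumr_ge0 => p _; exact: sqr_ge0. Qed.

(** Summation by parts. Mass conservation (g = 1), the decay of squares (g = x and g =
    [mix A x - x]) and the bound on the mass crossing a boundary (B = X) are all read off from this
    identity. *)
Lemma vsum_mixB A B x g :
  vsum B (fun v => g v * (mix A x v - x v)) =
  2^-1 * \sum_(p <- es | A p.1 && A p.2)
    ((B p.1)%:R * g p.1 - (B p.2)%:R * g p.2) * (x p.2 - x p.1).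
Proof.
rewrite vsum_mkcond.
under eq_bigr => v _ do rewrite /mix addrC addKr mulr_suml !mulr_sumr.
rewrite exchange_big mulr_sumr big_seq_cond [RHS]big_seq_cond.
apply: eq_bigr => p /andP [pe _]; have /andP [h1 h2] := mem_half_edges pe.
pose F (w : V) := (B w)%:R * g w / (2 * (deg w)%:R) * (x p.2 - x p.1).
transitivity (\sum_(v <- half_edges) ((p.1 == v)%:R * F v - (p.2 == v)%:R * F v)).
  apply: eq_bigr => v _; rewrite /gain /F; move: (_^-1) => i; ring.
rewrite sumrB !sum_pred1_half_edges /F.
have d1 : (deg p.1)%:R != 0 :> R by rewrite pnatr_eq0 -lt0n deg_gt0.
have d2 : (deg p.2)%:R != 0 :> R by rewrite pnatr_eq0 -lt0n deg_gt0.
by field; rewrite d1 d2.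
Qed.

Lemma vsum_mix A B x : {in half_edges, forall v, A v -> B v} ->
  vsum B (mix A x) = vsum B x.
Proof.
move=> AB; apply/eqP; rewrite -subr_eq0 -mulN1r -vsumZ -vsumD.
have /eqP := vsum_mixB A B x (fun=> 1).
rewrite big_seq_cond big1 => [|p /andP [/mem_half_edges /andP [h1 h2] /andP [A1 A2]]].
  by rewrite mulr0 => /eqP <-; apply/eqP/eq_vsum => // v _ _; ring.
by rewrite (AB _ h1 A1) (AB _ h2 A2) !mulr1 subrr mul0r.
Qed.

Lemma energy_le_vsum A x :
  \sum_(p <- es | A p.1 && A p.2) (x p.1 ^+ 2 + x p.2 ^+ 2)
  <= vsum A (fun v => x v ^+ 2).
Proof.
rewrite vsumE big_mkcond /=; apply: ler_sum => p _.
have := sqr_ge0 (x p.1); have := sqr_ge0 (x p.2).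
by case: (A p.1); case: (A p.2); rewrite /= ?mul1r ?mul0r; lra.
Qed.

Lemma energy_le A x : energy A x <= 2 * vsum A (fun v => x v ^+ 2).
Proof.
apply: le_trans (_ : 2 * (\sum_(p <- es | A p.1 && A p.2) (x p.1 ^+ 2 + x p.2 ^+ 2)) <= _).
  rewrite mulr_sumr; apply: ler_sum => p _.
  by have := sqr_ge0 (x p.1 + x p.2); nra.
by rewrite ler_pM2l // energy_le_vsum.
Qed.

(** With D the change made by one step and E the energy, the inner product of x and D is - E / 2
    and, thanks to laziness, the square norm of D is at most E / 2. Expanding the square of x + D
    leaves - E + E / 2. *)
Lemma vsum_mix_sqr A x :
  vsum A (fun v => mix A x v ^+ 2) <= vsum A (fun v => x v ^+ 2) - 2^-1 * energy A x.
Proof.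
pose D v := mix A x v - x v.
have xD : vsum A (fun v => x v * D v) = - 2^-1 * energy A x.
  rewrite vsum_mixB mulNr -mulrN; congr (_ * _); rewrite /energy -sumrN.
  by apply: eq_bigr => p /andP [-> ->]; rewrite !mul1r; ring.
have DD : vsum A (fun v => D v ^+ 2) <= 2^-1 * energy A x.
  have -> : vsum A (fun v => D v ^+ 2) = vsum A (fun v => D v * (mix A x v - x v)).
    by apply: eq_vsum => // v _ _; rewrite expr2.
  rewrite vsum_mixB.
  set S := \sum_(p <- es | _) _.
  (* The square norm of D is S / 2, so this bound contains the quantity to be estimated and absorbs
     it: half of it moves to the left-hand side. *)
  suff : S <= vsum A (fun v => D v ^+ 2) + 2^-1 * energy A x.
    have -> : vsum A (fun v => D v ^+ 2) = 2^-1 * S.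
      by rewrite /S -vsum_mixB; apply: eq_vsum => // v _ _; rewrite expr2.
    by rewrite -/S; lra.
  apply: le_trans (lerD (energy_le_vsum _ _) (lexx _)).
  rewrite /energy mulr_sumr -big_split; apply: ler_sum => p /andP [-> ->] /=.
  rewrite !mul1r.
  have := sqr_ge0 (D p.1 + D p.2); have := sqr_ge0 (D p.1 - D p.2 + x p.1 - x p.2).
  by nra.
have -> : vsum A (fun v => mix A x v ^+ 2) =
    vsum A (fun v => x v ^+ 2) + 2 * vsum A (fun v => x v * D v) + vsum A (fun v => D v ^+ 2).
  by rewrite -vsumZ -!vsumD; apply: eq_vsum => // v _ _; rewrite /D; ring.
by rewrite xD; lra.
Qed.

Lemma mixD A f g v : mix A (fun w => f w + g w) v = mix A f v + mix A g v.
Proof.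
rewrite /mix; have -> : \sum_(p <- es | A p.1 && A p.2) gain (fun w => f w + g w) v p =
  \sum_(p <- es | A p.1 && A p.2) gain f v p + \sum_(p <- es | A p.1 && A p.2) gain g v p.
  by rewrite -big_split; apply: eq_bigr => p _; rewrite /gain /=; ring.
by ring.
Qed.

Lemma mixZ A c f v : mix A (fun w => c * f w) v = c * mix A f v.
Proof.
rewrite /mix; have -> : \sum_(p <- es | A p.1 && A p.2) gain (fun w => c * f w) v p =
  c * \sum_(p <- es | A p.1 && A p.2) gain f v p.
  by rewrite mulr_sumr; apply: eq_bigr => p _; rewrite /gain; ring.
by ring.
Qed.

Lemma mix_const A c v : mix A (fun=> c) v = c.
Proof. by rewrite /mix big1 ?mul0r ?addr0 // => p _; rewrite /gain; ring. Qed.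

Lemma mix_ge0 A f : {in half_edges, forall v, 0 <= f v} ->
  {in half_edges, forall v, 0 <= mix A f v}.
Proof.
move=> f0 v vh; rewrite /mix.
have d0 : 0 < (deg v)%:R :> R by rewrite ltr0n deg_gt0.
(* Each half-edge at v takes away at most [f v]; after the division by twice the degree, v loses at
   most half of its value. *)
suff h : - ((deg v)%:R * f v) <= \sum_(p <- es | A p.1 && A p.2) gain f v p.
  have : - ((deg v)%:R * f v) / (2 * (deg v)%:R) <=
     (\sum_(p <- es | A p.1 && A p.2) gain f v p) / (2 * (deg v)%:R).
    by rewrite ler_pM2r // invr_gt0 mulr_gt0.
  have -> : - ((deg v)%:R * f v) / (2 * (deg v)%:R) = - f v / 2.
    by field; rewrite lt0r_neq0.
  by have := f0 v vh; lra.
rewrite -sum_pred1_half_edges.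
have -> : \sum_(w <- half_edges) (v == w)%:R * f w = vsum all_v (fun w => (v == w)%:R * f w).
  by [].
rewrite vsumE -sumrN [X in _ <= X]big_mkcond [X in X <= _]big_seq [X in _ <= X]big_seq.
apply: ler_sum => p /mem_half_edges /andP [h1 h2].
have := f0 _ h1; have := f0 _ h2; rewrite /gain /all_v !mul1r !(eq_sym v).
by case: (A p.1 && A p.2); case: eqP => _; case: eqP => _; rewrite ?mul1r ?mul0r; lra.
Qed.

Definition walk x (As : seq (V -> bool)) : V -> R := foldl (fun y A => mix A y) x As.

Lemma walk_rcons x As A : walk x (rcons As A) = mix A (walk x As).
Proof. by rewrite /walk -cats1 foldl_cat. Qed.

Lemma walkD f g As v : walk (fun w => f w + g w) As v = walk f As v + walk g As v.
Proof.
elim/last_ind: As v => [//|As A IH] v; rewrite !walk_rcons -mixD.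
by congr (mix A _ v); apply: functional_extensionality_dep => w; exact: IH.
Qed.

Lemma walkZ c f As v : walk (fun w => c * f w) As v = c * walk f As v.
Proof.
elim/last_ind: As v => [//|As A IH] v; rewrite !walk_rcons -mixZ.
by congr (mix A _ v); apply: functional_extensionality_dep => w; exact: IH.
Qed.

Lemma walk_const c As v : walk (fun=> c) As v = c.
Proof.
elim/last_ind: As v => [//|As A IH] v; rewrite !walk_rcons -[RHS](mix_const A c v).
by congr (mix A _ v); apply: functional_extensionality_dep => w; exact: IH.
Qed.

Lemma walk_sum (I : eqType) (r : seq I) (c : I -> R) (F : I -> V -> R) As v :
  walk (fun w => \sum_(i <- r) c i * F i w) As v = \sum_(i <- r) c i * walk (F i) As v.
Proof.
elim: r => [|i r IH].
  rewrite big_nil -[RHS](walk_const 0 As v); congr (walk _ As v).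
  by apply: functional_extensionality_dep => w; rewrite big_nil.
rewrite big_cons -IH -walkZ -walkD; congr (walk _ As v).
by apply: functional_extensionality_dep => w; rewrite big_cons.
Qed.

Lemma walk_ge0 f As : {in half_edges, forall v, 0 <= f v} ->
  {in half_edges, forall v, 0 <= walk f As v}.
Proof.
by elim/last_ind: As => [//|As A IH] f0; rewrite walk_rcons; apply: mix_ge0; apply: IH.
Qed.

(** Positivity applied to 1 - f, since the walk is linear and fixes constants. *)
Lemma walk_le1 f As : {in half_edges, forall v, f v <= 1} ->
  {in half_edges, forall v, walk f As v <= 1}.
Proof.
move=> f1 v vh.
have := @walk_ge0 (fun v => 1 + (-1) * f v) As _ v vh.
rewrite walkD walkZ walk_const => h; rewrite -subr_ge0 -mulN1r; apply: h => w wh.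
by have := f1 w wh; lra.
Qed.

Lemma vsum_walk f As : vsum all_v (walk f As) = vsum all_v f.
Proof.
by elim/last_ind: As => [//|As A IH]; rewrite walk_rcons vsum_mix.
Qed.

Definition boundary (X : V -> bool) : nat := count (fun p => X p.1 (+) X p.2) es.

(* Each step of the walk moves at most half a unit across each boundary edge. *)
Lemma vsum_walk_ge f As X : {in half_edges, forall v, 0 <= f v <= 1} ->
  vsum X f - 2^-1 * (size As)%:R * (boundary X)%:R <= vsum X (walk f As).
Proof.
move=> f01; elim/last_ind: As => [|As A IH]; first by rewrite mulr0 mul0r subr0.
rewrite walk_rcons size_rcons.
have -> : vsum X (mix A (walk f As)) =
  vsum X (walk f As) + vsum X (fun v => 1 * (mix A (walk f As) v - walk f As v)).
  by rewrite -vsumD; apply: eq_vsum => // v _ _; ring.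
rewrite vsum_mixB; set x := walk f As in IH *.
suff : - (boundary X)%:R <= \sum_(p <- es | A p.1 && A p.2)
     ((X p.1)%:R * 1 - (X p.2)%:R * 1) * (x p.2 - x p.1).
  by move: IH; rewrite -[(size As).+1%:R]natr1; lra.
rewrite /boundary -sum1_count natr_sum -sumrN big_mkcond [X in _ <= X]big_mkcond.
rewrite big_seq [X in _ <= X]big_seq; apply: ler_sum => p /mem_half_edges /andP [h1 h2].
have x0 := @walk_ge0 f As (fun v vh => proj1 (andP (f01 v vh))).
have x1 := @walk_le1 f As (fun v vh => proj2 (andP (f01 v vh))).
have := x0 _ h1; have := x0 _ h2; have := x1 _ h1; have := x1 _ h2.
rewrite -/x; case: (A p.1 && A p.2); case: (X p.1); case: (X p.2) => /=; nra.
Qed.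

End HalfEdges.

(** * The potential of the walk distributions *)

Section Potential.
Variables (R : realType) (V : eqType) (es : seq (V * V)) (x0 : V).
Implicit Types (A B X : V -> bool) (f : V -> R) (As : seq (V -> bool)).

Local Notation hs := (half_edges es).
Local Notation vsum := (vsum es).
Local Notation volR := (volR R es).
Local Notation walk := (walk es).

Definition mean A f : R := vsum A f / volR A.

(** Parallel axis identity. It lets the old mean be kept when A shrinks: recentring at the new mean
    only lowers the sum of squares. *)
Lemma vsum_meanB A f c : 0 < volR A ->
  vsum A (fun v => (f v - c) ^+ 2) =
  vsum A (fun v => (f v - mean A f) ^+ 2) + volR A * (mean A f - c) ^+ 2.
Proof.
move=> A0; set mu := mean A f.
have E : vsum A f = mu * volR A by rewrite /mu /mean divfK ?gt_eqF.
have -> : vsum A (fun v => (f v - c) ^+ 2) = vsum A (fun v => (f v - mu) ^+ 2 +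
    (2 * (mu - c) * f v + ((mu - c) ^+ 2 - 2 * (mu - c) * mu) * 1)).
  by apply: eq_vsum => // v _ _; ring.
by rewrite !vsumD !vsumZ E -/(volR A); ring.
Qed.

(* The walk distributions are indexed by half-edges h rather than by vertices:
   coord As h v is the h-th coordinate of p_v. *)
Definition start (h : nat) (v : V) : R := (nth x0 hs h == v)%:R / (deg es v)%:R.

Definition coord As h : V -> R := walk (start h) As.

Definition coord_dev As A h (v : V) : R := coord As h v - mean A (coord As h).

Definition potential As A : R :=
  \sum_(h < size hs) vsum A (fun v => coord_dev As A h v ^+ 2).

Lemma potential_ge0 As A : 0 <= potential As A.
Proof. by apply: sumr_ge0 => h _; apply: vsum_ge0 => v _ _; exact: sqr_ge0. Qed.

(** The two sources of decrease: the terms of the removed vertices disappear, and the walk step on B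
    dissipates half of the energy there. *)
Lemma potential_step As A B : {in hs, forall v, B v -> A v} ->
  0 < volR A -> 0 < volR B ->
  potential (rcons As B) B <= potential As A -
    \sum_(h < size hs) (vsum (fun v => A v && ~~ B v) (fun v => coord_dev As A h v ^+ 2)
                        + 2^-1 * energy es B (coord As h)).
Proof.
move=> BA A0 B0; rewrite /potential -sumrB; apply: ler_sum => h _.
rewrite (vsum_split _ BA).
set x := coord As h; set c := mean A x.
have := vsum_meanB (coord (rcons As B) h) c B0.
have := vsum_mix_sqr es B (fun v => x v + (- c)).
have -> : energy es B (fun v => x v + - c) = energy es B x.
  by apply: eq_bigr => p _; congr (_ ^+ 2); ring.
have -> : vsum B (fun v => mix es B (fun v => x v + - c) v ^+ 2) =
    vsum B (fun v => (coord (rcons As B) h v - c) ^+ 2).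
  by apply: eq_vsum => // v _ _; rewrite mixD mix_const /coord walk_rcons.
have := mulr_ge0 (ltW B0) (sqr_ge0 (mean B (coord (rcons As B) h) - c)).
rewrite /coord_dev -/x -/c; move: (vsum _ _) (vsum _ _) (vsum _ _) (vsum _ _).
by move=> a1 a2 a3 a4; lra.
Qed.

Lemma sum_half_edges (F : V -> R) :
  \sum_(h < size hs) F (nth x0 hs h) = \sum_(v <- hs) F v.
Proof. by rewrite [RHS](big_nth x0) big_mkord. Qed.

(** A starting coordinate has square norm 1 / deg, at most 1, and there are 2 m of them. *)
Lemma potential_nil A : 0 < volR A -> potential [::] A <= 2 * (size es)%:R.
Proof.
move=> A0; have -> : 2 * (size es)%:R = \sum_(h < size hs) 1 :> R.
  by rewrite sumr_const card_ord size_half_edges -mul2n natrM.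
apply: ler_sum => h _.
have := vsum_meanB (start h) 0 A0.
have := mulr_ge0 (ltW A0) (sqr_ge0 (mean A (start h) - 0)).
rewrite /coord_dev /coord /=.
suff : vsum A (fun v => (start h v - 0) ^+ 2) <= 1.
  by move: (vsum _ _) (vsum _ _) => a1 a2; lra.
apply: le_trans (_ : vsum (@all_v V) (fun v => (start h v - 0) ^+ 2) <= _).
  by apply: vsum_subset => // v _ _; exact: sqr_ge0.
rewrite /vsum.
have hin : nth x0 hs h \in hs by rewrite mem_nth.
have -> : \sum_(v <- hs | all_v v) (start h v - 0) ^+ 2 =
    \sum_(w <- hs) (nth x0 hs h == w)%:R * (deg es w)%:R^-2 :> R.
  apply: eq_bigr => v _; rewrite subr0 /start expr_div_n.
  by case: eqP; rewrite ?expr1n ?expr0n.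
rewrite sum_pred1_half_edges.
have d1 : 1 <= (deg es (nth x0 hs h))%:R :> R by rewrite ler1n deg_gt0.
have d0 : 0 < (deg es (nth x0 hs h))%:R :> R by apply: lt_le_trans d1.
rewrite expr2 invfM mulrA divff ?gt_eqF // mul1r.
by rewrite invf_le1.
Qed.

(** The starting coordinates of the half-edges in X add up to the indicator of X, so by linearity
    the walk from X is a sum of coordinates. *)
Lemma sum_start X v : v \in hs ->
  \sum_(h < size hs) (X (nth x0 hs h))%:R * start h v = (X v)%:R.
Proof.
move=> vh.
rewrite (sum_half_edges (fun w => (X w)%:R * ((w == v)%:R / (deg es v)%:R))).
under eq_bigr => w _ do rewrite eq_sym mulrCA.
rewrite sum_pred1_half_edges mulrCA divff ?mulr1 //.
by rewrite pnatr_eq0 -lt0n deg_gt0.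
Qed.

(* Once the walk from X is mixed in A, at least a constant fraction of the mass
   of X has left X, and it has crossed the boundary of X in size As steps. *)
Lemma expansion_of_potential As A X :
  {in hs, forall v, X v -> A v} -> 0 < volR A -> 2 * volR X <= volR A ->
  potential As A * (16 * (size hs)%:R) <= 1 ->
  volR X <= 2 * (size As)%:R * (boundary es X)%:R.
Proof.
move=> XA A0 XA2 pot.
pose f : V -> R := fun v => \sum_(h < size hs) (X (nth x0 hs h))%:R * start h v.
have fX : {in hs, forall v, f v = (X v)%:R} by move=> v; exact: sum_start.
have fE v : walk f As v = \sum_(h < size hs) (X (nth x0 hs h))%:R * coord As h v.
  by rewrite /f walk_sum.
have f01 : {in hs, forall v, 0 <= f v <= 1}.
  by move=> v vh; rewrite fX //; case: (X v); rewrite /= ?lexx ?ler01.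
have N0 : 0 < (size hs)%:R :> R.
  rewrite ltr0n lt0n; apply: contraL A0 => /eqP/size0nil E.
  by rewrite /volR /vsum E big_nil ltxx.
pose mu := mean A (walk f As).
have muE : mu = \sum_(h < size hs) (X (nth x0 hs h))%:R * mean A (coord As h).
  rewrite /mu /mean; under [RHS]eq_bigr => h _ do rewrite mulrA -vsumZ.
  rewrite -mulr_suml; congr (_ / _); rewrite /vsum exchange_big /=.
  by apply: eq_bigr => v _; rewrite fE.
have mu2 : mu <= 2^-1.
  rewrite /mu /mean ler_pdivrMr //.
  have h1 : vsum A (walk f As) <= vsum (@all_v V) (walk f As).
    apply: vsum_subset => // v vh _; apply: walk_ge0 v vh => v vh.
    by case/andP: (f01 v vh).
  have h2 : vsum (@all_v V) (walk f As) = volR X.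
    rewrite vsum_walk /volR [RHS]vsum_mkcond.
    by apply: eq_big_seq => v vh; rewrite fX // mulr1.
  by rewrite mulrC; move: h1 XA2; rewrite h2; move: (vsum _ _) => a; lra.
(* Each deviation a satisfies a <= 2 N a^2 + 1 / (8 N). Summed over the N coordinates, the squares
   contribute at most 2 N / (16 N) = 1/8 by the bound on the potential, and the constants contribute
   1/8. *)
have close v : v \in hs -> A v -> walk f As v <= mu + 4^-1.
  move=> vh Av; rewrite -lerBlDl fE muE -sumrB.
  set N := (size hs)%:R in N0 pot.
  apply: le_trans (_ : \sum_(h < size hs) (2 * N * coord_dev As A h v ^+ 2 + (8 * N)^-1) <= _).
    apply: ler_sum => h _; rewrite -mulrBr -/(coord_dev As A h v).
    set a := coord_dev As A h v.
    have NN : N * N^-1 = 1 by rewrite divff ?gt_eqF.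
    have Ni : 0 < N^-1 by rewrite invr_gt0.
    have := mulr_ge0 (ltW Ni) (sqr_ge0 (4 * N * a - 1)).
    have -> : (8 * N)^-1 = 8^-1 * N^-1 by rewrite invfM.
    have -> : N^-1 * (4 * N * a - 1) ^+ 2 =
       16 * (N * N^-1) * N * a ^+2 - 8 * (N * N^-1) * a + N^-1 by ring.
    have := mulr_ge0 (ltW N0) (sqr_ge0 a).
    rewrite NN; case: (X _); rewrite ?mul0r ?mul1r; first by nra.
    by move: Ni; nra.
  rewrite big_split /= sumr_const card_ord -mulr_sumr -[_ *+ size _]mulr_natr -/N.
  have -> : (8 * N)^-1 * N = 8^-1 by field; rewrite gt_eqF.
  have : \sum_(h < size hs) coord_dev As A h v ^+ 2 <= potential As A.
    apply: ler_sum => h _; rewrite /vsum (big_rem v) //= Av.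
    by rewrite lerDl sumr_ge0 // => w _; exact: sqr_ge0.
  set s := \sum_(h < _) _; move=> sp.
  have : s * (16 * N) <= 1 by apply: le_trans pot; rewrite ler_pM2r // mulr_gt0.
  by lra.
(* At most 3/4 of the mass of X is still in X. Comparison with [vsum_walk_ge] gives vol X / 4 <=
   |As| / 2 * boundary. *)
have up : vsum X (walk f As) <= (mu + 4^-1) * volR X.
  rewrite /volR -vsumZ; apply: ler_vsum => v vh Xv.
  by rewrite mulr1; apply: close => //; exact: XA.
have lo := vsum_walk_ge As X f01.
have eX : vsum X f = volR X by apply: eq_vsum => // v vh Xv; rewrite fX // Xv.
have : (mu + 4^-1) * volR X <= 3 / 4 * volR X.
  by apply: ler_wpM2r; [exact: volR_ge0|move: mu2; lra].
by move: up lo; rewrite eX; move: (vsum _ _) (_ * volR X) => a b; lra.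
Qed.

End Potential.

(** * Random signs *)

Section Average.
Variable R : realType.
Implicit Types (F G : seq bool -> R) (z : nat -> R).

(** Expectation over n fair bits, by conditioning on the first one: statements on signs become
    inductions, and independence of successive blocks is [avg_cat]. *)
Fixpoint avg n F : R :=
  if n is n'.+1 then
    (avg n' (fun w => F (true :: w)) + avg n' (fun w => F (false :: w))) / 2
  else F [::].

Lemma le_avg n F G : (forall w, size w = n -> F w <= G w) -> avg n F <= avg n G.
Proof.
elim: n F G => [|n IH] F G FG /=; first exact: FG.
by rewrite ler_pM2r ?invr_gt0 // lerD // IH // => w sw; apply: FG; rewrite /= sw.
Qed.

Lemma eq_avg n F G : (forall w, size w = n -> F w = G w) -> avg n F = avg n G.
Proof.
by move=> FG; apply/eqP; rewrite eq_le; apply/andP; split; apply: le_avg => w /FG ->.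
Qed.

Lemma avgD n F G : avg n (fun w => F w + G w) = avg n F + avg n G.
Proof. by elim: n F G => [//|n IH] F G /=; rewrite !IH; lra. Qed.

Lemma avgZ n c F : avg n (fun w => c * F w) = c * avg n F.
Proof. by elim: n F => [//|n IH] F /=; rewrite !IH; lra. Qed.

Lemma avg_const n c : avg n (fun=> c) = c.
Proof. by elim: n => [//|n IH] /=; rewrite !IH; lra. Qed.

Lemma avg_sum (I : Type) (r : seq I) (P : pred I) n (F : I -> seq bool -> R) :
  avg n (fun w => \sum_(i <- r | P i) F i w) = \sum_(i <- r | P i) avg n (F i).
Proof.
elim: r => [|i r IH]; first by rewrite big_nil -[RHS](avg_const n); apply: eq_avg => w _; rewrite big_nil.
rewrite big_cons -IH; case Pi: (P i).
  by rewrite -avgD; apply: eq_avg => w _; rewrite big_cons Pi.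
by apply: eq_avg => w _; rewrite big_cons Pi.
Qed.

Lemma avg_cat k n F : avg (k + n) F = avg k (fun w => avg n (fun w' => F (w ++ w'))).
Proof. by elim: k F => [//|k IH] F; rewrite addSn /= !IH. Qed.

Lemma avg_negb n F : avg n (fun w => F (map negb w)) = avg n F.
Proof.
elim: n F => [//|n IH] F /=.
by rewrite (IH (fun w => F (false :: w))) (IH (fun w => F (true :: w))) addrC.
Qed.

Definition sign_of (b : bool) : R := if b then 1 else -1.

Definition lin z (w : seq bool) : R :=
  \sum_(0 <= h < size w) z h * sign_of (nth false w h).

Lemma lin_cons z b w : lin z (b :: w) = z 0%N * sign_of b + lin (fun h => z h.+1) w.
Proof. by rewrite /lin /= big_nat_recl. Qed.

Lemma linD z1 z2 w : lin (fun h => z1 h + z2 h) w = lin z1 w + lin z2 w.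
Proof. by rewrite /lin -big_split; apply: eq_bigr => h _; rewrite mulrDl. Qed.

Lemma linZ c z w : lin (fun h => c * z h) w = c * lin z w.
Proof. by rewrite /lin mulr_sumr; apply: eq_bigr => h _; rewrite mulrA. Qed.

Lemma lin_negb z w : lin z (map negb w) = - lin z w.
Proof.
elim: w z => [|b w IH] z; first by rewrite /lin !big_geq // oppr0.
by rewrite /= !lin_cons IH; case: b; rewrite /sign_of /=; ring.
Qed.

Definition sqnorm n z : R := \sum_(0 <= h < n) z h ^+ 2.

Lemma sqnormS n z : sqnorm n.+1 z = z 0%N ^+ 2 + sqnorm n (fun h => z h.+1).
Proof. by rewrite /sqnorm big_nat_recl. Qed.

Lemma sqnorm_ge0 n z : 0 <= sqnorm n z.
Proof. by apply: sumr_ge0 => h _; exact: sqr_ge0. Qed.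

(** Signs are independent and centred, so cross terms vanish. The shift c stands for the signs
    already revealed and makes the induction go through. *)
Lemma avg_linD_sqr n c z : avg n (fun w => (c + lin z w) ^+ 2) = c ^+ 2 + sqnorm n z.
Proof.
elim: n c z => [|n IH] c z /=; first by rewrite /lin /sqnorm !big_geq // !addr0.
under eq_avg => w _ do rewrite lin_cons addrA.
under [in X in (_ + X) / _ = _]eq_avg => w _ do rewrite lin_cons addrA.
by rewrite !IH sqnormS /sign_of; lra.
Qed.

Lemma avg_lin_sqr n z : avg n (fun w => lin z w ^+ 2) = sqnorm n z.
Proof.
have := avg_linD_sqr n 0 z; rewrite expr0n add0r => <-.
by apply: eq_avg => w _; rewrite add0r.
Qed.

Lemma cosh_le (x : R) : (expR x + expR (- x)) / 2 <= expR (2 * x ^+ 2).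
Proof.
wlog x0 : x / 0 <= x.
  move=> H; case: (leP 0 x) => [/H //|x0].
  by have := H (- x); rewrite opprK sqrrN addrC; apply; rewrite oppr_ge0 ltW.
case: (leP x 2^-1) => x2.
  (* From exp(y) <= 1 / (1 - y), which is at most 1 + y + 2 y^2 exactly because y <= 1/2. *)
  have le_inv (y : R) : `|y| <= 2^-1 -> expR y <= 1 + y + 2 * y ^+ 2.
    move=> y2; have {y2} /andP [y1 y2] : - 2^-1 <= y <= 2^-1 by rewrite -ler_norml.
    have h : 1 - y <= expR (- y) by have := expR_ge1Dx (- y); lra.
    have e0 : 0 < expR y := expR_gt0 y.
    have : expR y * (1 - y) <= 1.
      by rewrite -[X in _ <= X](expRxMexpNx_1 y) ler_pM2l.
    by nra.
  have h1 := @le_inv x _; have h2 := @le_inv (- x) _.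
  have h3 := expR_ge1Dx (2 * x ^+ 2).
  have n1 : `|x| <= 2^-1 by rewrite ger0_norm.
  have n2 : `|- x| <= 2^-1 by rewrite normrN.
  by move: (h1 n1) (h2 n2); rewrite sqrrN; lra.
(* For x > 1/2 the mean is at most exp(x), and x <= 2 x^2. *)
apply: le_trans (_ : expR x <= _).
  have : expR (- x) <= expR x by rewrite ler_expR; lra.
  by lra.
by rewrite ler_expR; nra.
Qed.

Lemma avg_expR_lin n c z :
  avg n (fun w => expR (c + lin z w)) <= expR (c + 2 * sqnorm n z).
Proof.
elim: n c z => [|n IH] c z /=; first by rewrite /lin /sqnorm !big_geq // mulr0.
under eq_avg => w _ do rewrite lin_cons addrA.
under [in X in (_ + X) / _ <= _]eq_avg => w _ do rewrite lin_cons addrA.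
rewrite /sign_of mulr1 mulrN1.
have := IH (c + z 0%N) (fun h => z h.+1); have := IH (c - z 0%N) (fun h => z h.+1).
rewrite sqnormS; set s := sqnorm _ _; set y := z 0%N.
have -> : c + y + 2 * s = (c + 2 * s) + y by ring.
have -> : c - y + 2 * s = (c + 2 * s) + - y by ring.
have -> : c + 2 * (y ^+ 2 + s) = (c + 2 * s) + 2 * y ^+ 2 by ring.
move: (c + 2 * s) => t.
rewrite !expRD; have := cosh_le y; have := expR_gt0 t.
move: (expR t) (expR (2 * _)) (expR y) (expR (- y)) => a b d e a0 h1.
move: (avg _ _) (avg _ _) => f g hf hg.
have : a * ((d + e) / 2) <= a * b by rewrite ler_pM2l.
by lra.
Qed.

(** The part of a squared projection beyond k^2 times its mean. The bound it yields holds for every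
    sign pattern, so it may be summed over a set chosen after seeing the signs. *)
Definition excess k n z w : R := Num.max 0 (lin z w ^+ 2 - k ^+ 2 * sqnorm n z).

Lemma excess_ge0 k n z w : 0 <= excess k n z w.
Proof. by rewrite /excess le_max lexx. Qed.

Lemma lin_sqr_le_excess k n z w : lin z w ^+ 2 <= k ^+ 2 * sqnorm n z + excess k n z w.
Proof. by rewrite -lerBlDl /excess le_max lexx orbT. Qed.

(** The exponential moment is used at parameter 1 only: 16 exp(-k/2) comes from [sqr_tail_le], and
    each of the two exponentials has mean at most exp(2). A bound exponential in k suffices, as k
    will be of order log m. *)
Definition tail (k : R) : R := 32 * expR (2 - k / 2).

(** Beyond k, one half of the exponent of exp(x) pays for x^2 and the other half for the factor
    exp(-k/2). *)
Lemma sqr_tail_le (k x : R) : 0 <= k ->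
  Num.max 0 (x ^+ 2 - k ^+ 2) <= 16 * expR (- (k / 2)) * (expR x + expR (- x)).
Proof.
move=> k0; rewrite ge_max; apply/andP; split.
  by rewrite !mulr_ge0 ?addr_ge0 ?expR_ge0.
wlog x0 : x / 0 <= x.
  move=> H; case: (leP 0 x) => [/H //|x0].
  by have := H (- x); rewrite opprK sqrrN (addrC (expR _)); apply; rewrite oppr_ge0 ltW.
case: (leP x k) => xk.
  apply: (@le_trans _ _ 0); first by rewrite subr_le0 ler_sqr ?nnegrE.
  by rewrite !mulr_ge0 ?addr_ge0 ?expR_ge0.
have h1 : x ^+ 2 <= 16 * expR (x / 2).
  have -> : x / 2 = x / 4 + x / 4 by lra.
  by rewrite expRD; have := expR_ge1Dx (x / 4); nra.
have h2 : expR (x / 2) <= expR (- (k / 2)) * expR x by rewrite -expRD ler_expR; lra.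
have h3 : 0 <= expR (- (k / 2)) * expR (- x) by rewrite mulr_ge0 ?expR_ge0.
have := sqr_ge0 k.
rewrite -mulrA mulrDr; move: (expR (- (k / 2)) * _) (expR (- (k / 2)) * _) h1 h2 h3 => a b; lra.
Qed.

Lemma avg_excess k n z : 0 <= k -> avg n (excess k n z) <= tail k * sqnorm n z.
Proof.
(* Both sides are homogeneous of degree two in z, so z is rescaled to norm 1. In the excluded case
   of norm 0 the excess is the squared projection itself, of mean 0. *)
move=> k0; have := sqnorm_ge0 n z; rewrite le_eqVlt => /orP [/eqP E|N0].
  rewrite -E mulr0 [X in _ <= X]E -(avg_lin_sqr n z); apply: le_avg => w _.
  by rewrite /excess -E mulr0 subr0 ge_max lexx sqr_ge0.
set s := Num.sqrt (sqnorm n z).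
have s0 : 0 < s by rewrite sqrtr_gt0.
have ss : s ^+ 2 = sqnorm n z by rewrite sqr_sqrtr // ltW.
pose y h := s^-1 * z h.
have ly w : lin z w = s * lin y w by rewrite /y linZ mulrA divff ?mul1r ?gt_eqF.
have ny : sqnorm n y = 1.
  rewrite /y /sqnorm; under eq_bigr => h _ do rewrite exprMn.
  by rewrite -mulr_sumr -/(sqnorm n z) -ss exprVn mulVf // expf_neq0 ?gt_eqF.
have e (c : R) w : expR (c * lin y w) = expR (0 + lin (fun h => c * y h) w).
  by rewrite add0r linZ.
apply: le_trans (_ : avg n (fun w => sqnorm n z * (16 * expR (- (k / 2)) *
   (expR (1 * lin y w) + expR (-1 * lin y w)))) <= _).
  apply: le_avg => w _; rewrite /excess ly exprMn ss mul1r mulN1r.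
  have -> : Num.max 0 (sqnorm n z * lin y w ^+ 2 - k ^+ 2 * sqnorm n z) =
      sqnorm n z * Num.max 0 (lin y w ^+ 2 - k ^+ 2).
    by rewrite maxr_pMr ?ltW // mulr0; congr (Num.max _ _); ring.
  by rewrite ler_pM2l // sqr_tail_le.
rewrite avgZ avgZ avgD mulrC ler_pM2r // /tail expRD.
have h (c : R) : c ^+ 2 = 1 -> avg n (fun w => expR (c * lin y w)) <= expR 2.
  move=> c1; under eq_avg => w _ do rewrite e.
  apply: le_trans (avg_expR_lin _ _ _) _; rewrite add0r ler_expR /sqnorm.
  under eq_bigr => i _ do rewrite exprMn.
  by rewrite -mulr_sumr -/(sqnorm n y) ny c1; lra.
have := h 1 (expr1n _ _); have := h (-1) _; rewrite sqrrN expr1n => /(_ erefl).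
have := expR_gt0 (- (k / 2)); move: (avg _ _) (avg _ _) (expR 2) (expR _) => a b c d.
by move=> d0 h1 h2; nra.
Qed.

End Average.

(** * Sweep cuts *)

Section Levels.
Variables (R : realType) (tau : nat -> R) (e : R) (k0 : nat).
Hypotheses (tau_ge0 : forall k, 0 <= tau k) (e_ge0 : 0 <= e) (e_le1 : e <= 1).
Hypothesis tauS : forall k, tau k.+1 = (1 - e) * tau k.

(** A layer-cake sum. By telescoping it is t rounded down to a threshold of index at least [k0],
    minus [tau q], or 0 if no threshold of the range is reached. *)
Definition rounded q (t : R) : R :=
  \sum_(k0 <= k < q) (tau k - tau k.+1) * (tau k <= t)%R%:R.

Let tau_dec k : tau k.+1 <= tau k.
Proof. by rewrite tauS ler_piMl // gerBl. Qed.

Lemma rounded_ge0 q t : 0 <= rounded q t.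
Proof. by apply: sumr_ge0 => k _; rewrite mulr_ge0 ?subr_ge0. Qed.

Lemma rounded_le q t : (k0 <= q)%N -> rounded q t <= Num.max 0 (t - tau q).
Proof.
move=> /subnKC <-; elim: (q - k0)%N => [|n IH].
  by rewrite addn0 /rounded big_geq // le_max lexx.
rewrite addnS /rounded big_nat_recr ?leq_addr //= -/(rounded _ _).
move: (k0 + n)%N IH => k; have := tau_dec k.
case: (leP (tau k) t) => h d.
  rewrite mulr1 max_r ?subr_ge0 // => IH.
  by rewrite le_max; apply/orP; right; lra.
rewrite mulr0 addr0 max_l ?subr_le0 ?(ltW h) // => IH.
by rewrite le_max IH.
Qed.

(** Successive thresholds have ratio 1 - e, so rounding loses at most this factor. The hypothesis on
    [k0] says that t exceeds the top threshold by less than one such step. *)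
Lemma rounded_ge q t : (k0 <= q)%N -> (1 - e) * t <= tau k0 ->
  (1 - e) * t - tau q <= rounded q t.
Proof.
move=> /subnKC <- t0; elim: (q - k0)%N => [|n IH].
  by rewrite addn0 /rounded big_geq // subr_le0.
rewrite addnS /rounded big_nat_recr ?leq_addr //= -/(rounded _ _).
move: (k0 + n)%N IH => k IH.
case: (leP (tau k) t) => h; first by rewrite mulr1; lra.
rewrite mulr0 addr0 tauS -mulrBr; apply: le_trans (rounded_ge0 k t).
by rewrite mulr_ge0_le0 ?subr_le0 ?subr_ge0 ?(ltW h).
Qed.

(** The total weight of the thresholds separating t from s is their distance up to a rounding error
    e t, the price of testing geometrically spaced levels only. *)
Lemma rounded_dist q s t : (k0 <= q)%N -> t <= s -> 0 <= t -> (1 - e) * t <= tau k0 ->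
  \sum_(k0 <= k < q) (tau k - tau k.+1) * ((tau k <= s)%R (+) (tau k <= t)%R)%:R
  <= s - t + e * t.
Proof.
move=> kq ts t0 tk.
have -> : \sum_(k0 <= k < q) (tau k - tau k.+1) * ((tau k <= s)%R (+) (tau k <= t)%R)%:R
  = rounded q s - rounded q t.
  rewrite /rounded -sumrB; apply: eq_bigr => k _; rewrite -mulrBr; congr (_ * _).
  case: (leP (tau k) t) => h; first by rewrite (le_trans h ts) subrr.
  by rewrite subr0; case: (leP (tau k) s).
have := rounded_le s kq; have := rounded_ge kq tk; have := rounded_ge0 q t.
rewrite le_max => h0 h1 /orP [] h2; last by lra.
by have := mulr_ge0 e_ge0 t0; lra.
Qed.

End Levels.

(** * A discrete Cheeger inequality for geometric thresholds *)

Section Cheeger.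
Variables (R : realType) (V : eqType) (es : seq (V * V)).
Implicit Types (A B S X : V -> bool).

Local Notation hs := (half_edges es).
Local Notation vsum := (vsum es).
Local Notation volR := (volR R es).
Local Notation all_v := (@all_v V).

Definition cut_in A X : nat :=
  count (fun p => [&& A p.1, A p.2 & X p.1 (+) X p.2]) es.

(** Coarea argument on the square of y: the expansion of all level sets, weighted by the gaps
    between thresholds, bounds the differences of squares along edges from below, and the energy
    bounds them from above. The constant 9/16 is 1 - 1/8 for rounding, minus the 5/16 lost in
    [up]. *)
Lemma cheeger_levels B (y : V -> R) (tau : nat -> R) (e phi : R) (k0 q : nat) :
  (k0 <= q)%N -> (forall k, 0 < tau k) -> 0 <= e -> e <= phi / 8 -> 0 < phi -> phi <= 1 ->
  (forall k, tau k.+1 = (1 - e) * tau k) ->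
  {in hs, forall v, B v -> 0 <= y v /\ (1 - e) * y v ^+ 2 <= tau k0} ->
  (forall k, (k0 <= k < q)%N ->
     phi * volR (fun v => B v && (tau k <= y v ^+ 2))
     <= (cut_in B (fun v => B v && (tau k <= y v ^+ 2)%R))%:R) ->
  phi ^+ 2 * (9 / 16 * vsum B (fun v => y v ^+ 2) - tau q * volR B)
  <= 2 * energy es B y.
Proof.
move=> kq tau0 e0 e8 p0 p1 tauS By exp.
have e1 : e <= 1 by lra.
set X := vsum B (fun v => y v ^+ 2).
pose rd := rounded tau k0 q.
have tau0' k := ltW (tau0 k).
have w0 k : 0 <= tau k - tau k.+1 by rewrite tauS subr_ge0 ler_piMl // gerBl.
have low : (1 - e) * X - tau q * volR B <= vsum B (fun v => rd (y v ^+ 2)).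
  rewrite -mulNr /X /volR -!vsumZ -vsumD; apply: ler_vsum => v vh Bv.
  rewrite mulr1; have [y0 yk] := By v vh Bv.
  by apply: rounded_ge.
have coarea : phi * vsum B (fun v => rd (y v ^+ 2)) <=
   \sum_(p <- es | B p.1 && B p.2) \sum_(k0 <= k < q) (tau k - tau k.+1) *
      ((tau k <= y p.1 ^+ 2)%R (+) (tau k <= y p.2 ^+ 2)%R)%:R.
  rewrite /vsum /rd /rounded [X in phi * X]exchange_big mulr_sumr [X in _ <= X]exchange_big /=.
  rewrite big_nat [X in _ <= X]big_nat; apply: ler_sum => k kr.
  rewrite -!mulr_sumr mulrCA; apply: ler_wpM2l => //.
  have -> : \sum_(v <- hs | B v) (tau k <= y v ^+ 2)%R%:R =
      volR (fun v => B v && (tau k <= y v ^+ 2)).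
    rewrite /volR vsum_mkcond big_mkcond; apply: eq_bigr => v _.
    by case: (B v); rewrite mulr1.
  apply: le_trans (exp k kr) _; rewrite /cut_in -sum1_count natr_sum.
  rewrite big_mkcond [X in _ <= X]big_mkcond; apply: ler_sum => p _.
  by case: (B p.1); case: (B p.2); case: (tau k <= _); case: (tau k <= _).
(* For b <= a, a^2 - b^2 = (a - b) (a + b) is at most 2 / phi (a - b)^2 + phi / 4 (a^2 + b^2), and
   the rounding error e b^2 is at most phi / 16 (a^2 + b^2). This gives 5/16 = 1/4 + 1/16. *)
have up : \sum_(p <- es | B p.1 && B p.2) \sum_(k0 <= k < q) (tau k - tau k.+1) *
      ((tau k <= y p.1 ^+ 2)%R (+) (tau k <= y p.2 ^+ 2)%R)%:R <=
   2 / phi * energy es B y + 5 / 16 * phi * X.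
  apply: (@le_trans _ _ (2 / phi * energy es B y + 5 / 16 * phi *
    (\sum_(p <- es | B p.1 && B p.2) (y p.1 ^+ 2 + y p.2 ^+ 2)))); last first.
    rewrite lerD2l; apply: ler_wpM2l (energy_le_vsum _ _ _).
    by rewrite !mulr_ge0 ?invr_ge0 // ltW.
  rewrite /energy !mulr_sumr -big_split big_seq_cond [X in _ <= X]big_seq_cond.
  apply: ler_sum => p /andP [/mem_half_edges /andP [h1 h2] /andP [B1 B2]] /=.
  have [y1 k1] := By _ h1 B1; have [y2 k2] := By _ h2 B2.
  move: (y p.1) (y p.2) y1 y2 k1 k2 => a b a0 b0 ka kb.
  wlog ba : a b a0 b0 ka kb / b <= a.
    move=> H; case: (leP b a) => [/H|ab]; first exact.
    have := H b a b0 a0 kb ka (ltW ab).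
    under eq_bigr => k _ do rewrite addbC.
    by rewrite -[(a - b) ^+ 2]sqrrN opprB (addrC (b ^+ 2)).
  have ba2 : b ^+ 2 <= a ^+ 2 by rewrite ler_sqr ?nnegrE.
  apply: le_trans (rounded_dist tau0' e0 e1 tauS kq ba2 (sqr_ge0 b) kb) _.
  have pp : phi * phi^-1 = 1 by rewrite divff ?gt_eqF.
  have ip : 0 < phi^-1 by rewrite invr_gt0.
  have := mulr_ge0 (ltW ip) (sqr_ge0 ((a - b) - phi / 4 * (a + b))).
  have -> : phi^-1 * (a - b - phi / 4 * (a + b)) ^+ 2 =
    phi^-1 * (a - b) ^+ 2 - (phi * phi^-1) * ((a - b) * (a + b) / 2)
    + (phi * phi^-1) * phi / 16 * (a + b) ^+ 2 by field; rewrite gt_eqF.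
  rewrite pp.
  have := mulr_ge0 (ltW p0) (sqr_ge0 (a - b)).
  have := ler_wpM2r (sqr_ge0 b) e8; have := mulr_ge0 (ltW p0) (sqr_ge0 b).
  have : 0 <= phi * (a ^+ 2 - b ^+ 2) by rewrite mulr_ge0 ?(ltW p0) ?subr_ge0.
  by lra.
have := le_trans (ler_wpM2l (ltW p0) low) (le_trans coarea up).
have X0 : 0 <= X by apply: vsum_ge0 => v _ _; exact: sqr_ge0.
move: (volR B) (energy es B y) => w E h.
have := ler_wpM2l (ltW p0) h.
have -> : phi * (2 / phi * E + 5 / 16 * phi * X) = 2 * E + 5 / 16 * phi ^+ 2 * X.
  by field; rewrite gt_eqF.
have : phi ^+ 2 * e * X <= phi ^+ 2 * (1 / 8) * X.
  by rewrite ler_wpM2r // ler_wpM2l ?sqr_ge0 //; lra.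
by lra.
Qed.

(** The threshold applies to the square, which avoids square roots. The condition 0 < y keeps the
    vertices outside the support of y out even for threshold 0. *)
Definition above (y : V -> R) (tau : R) (v : V) : bool := (0 < y v) && (tau <= y v ^+ 2).

Section Sweep.
Variables (kap eps : R) (q : nat) (A : V -> bool) (y : V -> R).

Definition sqsum : R := vsum all_v (fun v => y v ^+ 2).
Definition level (k : nat) : R := sqsum * (1 - eps) ^+ k.

(** The cut inside A is at most sqrt kap times the volume of X, with both sides squared so that the
    program can test it. *)
Definition sparse (X : V -> bool) : bool :=
  (cut_in A X)%:R * (cut_in A X)%:R <= kap * (volR X * volR X).

(** The initial value exceeds every square, so nothing is removed if no level is sparse. Later
    levels overwrite earlier ones, so the largest sparse set wins. *)
Definition best_upto (n : nat) : R :=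
  foldl (fun b k => if sparse (above y (level k)) then level k else b)
    (sqsum + 1) (iota 0 n).

Lemma best_uptoS n : best_upto n.+1 =
  if sparse (above y (level n)) then level n else best_upto n.
Proof. by rewrite /best_upto -addn1 iotaD add0n foldl_cat. Qed.

Definition sweep_set : V -> bool := above y (best_upto q).

Hypotheses (eps_ge0 : 0 <= eps) (eps_le1 : eps <= 1).

Lemma sqsum_ge0 : 0 <= sqsum.
Proof. by apply: vsum_ge0 => v _ _; exact: sqr_ge0. Qed.

Lemma sqr_le_sqsum v : v \in hs -> y v ^+ 2 <= sqsum.
Proof.
move=> vh; rewrite /sqsum /vsum (big_rem v) //= lerDl.
by apply: sumr_ge0 => w _; exact: sqr_ge0.
Qed.

Lemma level_dec i j : (i <= j)%N -> level j <= level i.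
Proof.
move=> /subnKC <-; rewrite /level exprD mulrA ler_piMr //.
  by rewrite mulr_ge0 ?sqsum_ge0 ?exprn_ge0 ?subr_ge0.
by rewrite exprn_ile1 ?subr_ge0 // gerBl.
Qed.

Lemma eq_cut_in (B B' X Y : V -> bool) : {in hs, B =1 B'} -> {in hs, X =1 Y} ->
  cut_in B X = cut_in B' Y.
Proof.
move=> BB' XY; apply: eq_in_count => p /mem_half_edges /andP [h1 h2].
by rewrite !BB' // !XY.
Qed.

Lemma sparse_nil (X : V -> bool) : {in hs, forall v, ~~ X v} -> sparse X.
Proof.
move=> X0; rewrite /sparse (@eq_cut_in _ A _ (fun=> false)) //; last first.
  by move=> v /X0 /negbTE.
have -> : volR X = 0.
  by rewrite /volR vsum_mkcond big_seq big1 // => v /X0 /negbTE ->; rewrite mul0r.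
rewrite (_ : cut_in _ _ = 0%N) ?mulr0 //; apply/eqP; rewrite -leqn0 leqNgt -has_count.
by apply/hasPn => p _; rewrite !andbF.
Qed.

(** Here [k0] is one more than the last sparse index, or 0 if there is none: the levels before [k0]
    lie in the chosen set, the later ones contain it and are not sparse. *)
Lemma sweep_spec n : exists k0, [/\ (k0 <= n)%N,
   sparse (above y (best_upto n)),
   {in hs, forall v, above y (best_upto n) v -> forall k, (k0 <= k)%N -> above y (level k) v},
   {in hs, forall v, forall k, (k < k0)%N -> above y (level k) v -> above y (best_upto n) v}
 & forall k, (k0 <= k < n)%N -> ~~ sparse (above y (level k))].
Proof.
elim: n => [|n [k0 [k0n sp sub sup nsp]]].
  exists 0%N; split=> // [|v vh].
    apply: sparse_nil => v vh; rewrite /above /best_upto /= negb_and -!ltNge.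
    by rewrite (le_lt_trans (sqr_le_sqsum vh)) ?orbT // ltrDl.
  rewrite /above /best_upto /= => /andP [_ h].
  by have := sqr_le_sqsum vh; move: h; lra.
rewrite best_uptoS; case: ifP => spn; last first.
  exists k0; split=> //; first exact: leqW.
  move=> k /andP [k1]; rewrite ltnS leq_eqVlt => /orP [/eqP ->|k2]; first by rewrite spn.
  by apply: nsp; rewrite k1.
exists n.+1; split=> //.
- move=> v vh /andP [y0 h] k nk; rewrite /above y0 /=.
  by apply: le_trans h; apply: level_dec; apply: ltnW.
- move=> v vh k; rewrite ltnS => kn /andP [y0 h]; rewrite /above y0 /=.
  by apply: le_trans h; exact: level_dec.
by move=> k /andP [h1 h2]; move: (leq_trans h2 h1); rewrite ltnn.
Qed.

(* If the last sparse level set is removed, all lower level sets expand in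
   what is left. *)
Lemma sweep_drop (phi : R) :
  {in hs, forall v, 0 <= y v} -> {in hs, forall v, 0 < y v -> A v} ->
  0 < kap -> kap <= 1 -> (0 < size es)%N ->
  eps * 8 <= Num.sqrt kap ->
  (1 - eps) ^+ q * (32 * (size es)%:R) <= 1 ->
  phi = Num.max (Num.sqrt kap) (2 * (size es)%:R)^-1 ->
  phi ^+ 2 / 32 * sqsum <= vsum sweep_set (fun v => y v ^+ 2)
    + 2^-1 * energy es (fun v => A v && ~~ sweep_set v) y.
Proof.
move=> y0 yA kap0 kap1 m0 eps8 epsq phiE.
have m1 : 1 <= (size es)%:R :> R by rewrite ler1n.
have rk0 : 0 < Num.sqrt kap by rewrite sqrtr_gt0.
have rk1 : Num.sqrt kap <= 1 by rewrite -sqrtr1 ler_sqrt.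
have p0 : 0 < phi by rewrite phiE lt_max rk0.
have prk : Num.sqrt kap <= phi by rewrite phiE le_max lexx.
have p1 : phi <= 1.
  by rewrite phiE ge_max rk1 /= invf_le1 ?mulr_gt0 ?(lt_le_trans ltr01) //; lra.
have S0 := energy_ge0 es (fun v => A v && ~~ sweep_set v) y.
have := sqsum_ge0; rewrite le_eqVlt => /orP [/eqP <-|U0].
  rewrite mulr0; apply: addr_ge0; last by rewrite mulr_ge0 ?invr_ge0.
  by apply: vsum_ge0 => v _ _; exact: sqr_ge0.
have [k0 [k0q sp sub sup nsp]] := sweep_spec q; rewrite -/sweep_set in sp sub sup.
set S := sweep_set in S0 sp sub sup *; set B := fun v => A v && ~~ S v.
have SA : {in hs, forall v, S v -> A v} by move=> v vh /andP [/yA -> //].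
have e1 : 0 < 1 - eps by move: eps8 rk1 eps_ge0; lra.
have lev0 k : 0 < level k by rewrite /level mulr_gt0 ?exprn_gt0.
have levS k : level k.+1 = (1 - eps) * level k by rewrite /level exprS; ring.
have abE k : {in hs, forall v, above y (level k) v = (level k <= y v ^+ 2)}.
  move=> v vh; rewrite /above; case: (leP (level k) _); rewrite ?andbF // => h.
  rewrite andbT lt_neqAle y0 // andbT; apply: contraL h => /eqP <-.
  by rewrite expr0n -ltNge.
have UE : sqsum = vsum S (fun v => y v ^+ 2) + vsum B (fun v => y v ^+ 2).
  rewrite /B -vsum_split // /sqsum [RHS]vsum_mkcond; apply: eq_big_seq => v vh.
  case Av: (A v); first by rewrite mul1r.
  rewrite mul0r; have := y0 v vh; rewrite le_eqVlt => /orP [/eqP <-|/(yA v vh)].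
    by rewrite expr0n.
  by rewrite Av.
have := @cheeger_levels B y level eps phi k0 q k0q lev0 eps_ge0 _ p0 p1 levS.
have h1 : eps <= phi / 8 by move: prk; lra.
have h2 : {in hs, forall v, B v -> 0 <= y v /\ (1 - eps) * y v ^+ 2 <= level k0}.
  move=> v vh /andP [Av NS]; split; first exact: y0.
  case: k0 sub sup {k0q nsp} => [|k] sub sup.
    rewrite /level expr0 mulr1; apply: le_trans (sqr_le_sqsum vh).
    by rewrite ler_piMl ?sqr_ge0 // gerBl.
  rewrite levS ler_pM2l // leNgt; apply: contra NS => h; apply: (sup v vh k) => //.
  by rewrite abE // ltW.
(* Let X be the level set minus S. Volumes add up and the cut of the level set is at most the cut of
   S plus that of X in B. As S is sparse and the level set is not, X itself must expand. *)
have h3 k : (k0 <= k < q)%N ->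
     phi * volR (fun v => B v && (level k <= y v ^+ 2))
     <= (cut_in B (fun v => B v && (level k <= y v ^+ 2)%R))%:R.
  move=> kr; have nk := nsp k kr; case/andP: kr => kk0 _.
  set X := fun v => _ && _.
  have XE : {in hs, forall v, X v = above y (level k) v && ~~ S v}.
    move=> v vh; rewrite /X /B -abE //; case: (S v); rewrite ?andbF //= !andbT.
    by case ab: (above _ _ _); rewrite ?andbF // andbT; case/andP: ab => /yA ->.
  have vS : volR (above y (level k)) = volR S + volR X.
    rewrite /volR (@vsum_split _ _ _ (above y (level k)) S).
      by congr (_ + _); apply: eq_vsum => // v vh; rewrite XE.
    by move=> v vh Sv; apply: sub.
  have cS : (cut_in A (above y (level k)) <= cut_in A S + cut_in B X)%N.
    rewrite /cut_in -!sum1_count !(big_mkcond (fun p => [&& _, _ & _])) -big_split /=.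
    rewrite big_seq [X in (_ <= X)%N]big_seq; apply: leq_sum => p /mem_half_edges /andP [i1 i2].
    rewrite /B !XE //; have := sub _ i1; have := sub _ i2.
    case: (A p.1) => //=; case: (A p.2) => //=.
    case: (S p.1); case: (S p.2) => /=; rewrite ?andbT ?andbF /=.
    - by move=> /(_ isT k kk0) -> /(_ isT k kk0) ->.
    - by move=> _ /(_ isT k kk0) ->; case: (above _ _ _).
    - by move=> /(_ isT k kk0) -> _; case: (above _ _ _).
    - by move=> _ _; case: (_ (+) _).
  have {}cS : (cut_in A (above y (level k)))%:R <= (cut_in A S)%:R + (cut_in B X)%:R :> R.
    by rewrite -natrD ler_nat.
  have sqE (Z : V -> bool) : sparse Z = ((cut_in A Z)%:R <= Num.sqrt kap * volR Z).
    rewrite /sparse -expr2 -expr2 -{1}(sqr_sqrtr (ltW kap0)) -exprMn ler_sqr ?nnegrE //.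
    by rewrite mulr_ge0 ?volR_ge0 // ltW.
  move: sp nk; rewrite !sqE -ltNge => sp nk.
  have gap : Num.sqrt kap * volR X < (cut_in B X)%:R.
    by move: nk; rewrite vS mulrDr; lra.
  (* If 1 / (2 m) is the larger value: the cut is positive, hence at least 1, while the volume is at
     most 2 m. *)
  rewrite phiE; case: (leP (Num.sqrt kap) (2 * (size es)%:R)^-1) => _; last exact: ltW.
  have : 0 < (cut_in B X)%:R :> R.
    by apply: le_lt_trans gap; rewrite mulr_ge0 ?volR_ge0 // ltW.
  rewrite ltr0n => c1; apply: le_trans (_ : 1 <= _); last by rewrite ler1n.
  by rewrite mulrC ler_pdivrMr ?mul1r ?volR_le_all // mulr_gt0 // (lt_le_trans ltr01).
move=> /(_ h1 h2 h3).
(* The lowest threshold is small enough for what lies below it to be negligible: 2 m (1 - eps)^q is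
   at most 1/16. *)
have tq : level q * volR B <= sqsum / 16.
  have := volR_le_all R es B; have := volR_ge0 R es B; rewrite /level => v0 v2.
  rewrite -mulrA ler_pM2l //.
  apply: le_trans (ler_wpM2l (exprn_ge0 _ (ltW e1)) v2) _.
  by move: epsq; lra.
have ph0 : 0 < phi ^+ 2 by rewrite exprn_gt0.
have ph1 : phi ^+ 2 <= 1 by rewrite expr_le1 // ltW.
have s0 : 0 <= vsum S (fun v => y v ^+ 2).
  by apply: vsum_ge0 => v _ _; exact: sqr_ge0.
set b := vsum B _ in UE *; set s := vsum S _ in UE s0 *; set E := energy _ _ _ in S0 *.
set l := level q * _ in tq *; set p := phi ^+ 2 in ph0 ph1 *; move=> H.
(* Either B carries half of the square sum and the Cheeger inequality bounds its energy from below,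
   or the removed part S carries half of it. *)
case: (leP (sqsum / 2) b) => hb.
  have h4 : p * (7 / 32 * sqsum) <= p * (9 / 16 * b - l) by rewrite ler_pM2l //; lra.
  have h5 : 0 < p * sqsum by rewrite mulr_gt0.
  by move: H h4 h5 s0; rewrite -/B -/E; lra.
have h4 : p * sqsum <= 1 * sqsum by rewrite ler_pM2r.
by move: h4 UE hb S0; rewrite -/B -/E; lra.
Qed.

End Sweep.
End Cheeger.

(** * One round of the cut procedure *)

Section Center.
Variables (R : realType) (V : eqType) (es : seq (V * V)).
Implicit Types (A : V -> bool) (u : V -> R).

Local Notation hs := (half_edges es).
Local Notation vsum := (vsum es).
Local Notation volR := (volR R es).
Local Notation mean := (mean es).

(** Half of the mean absolute deviation, because positive and negative deviations from the mean
    balance. *)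
Definition spread A u : R :=
  vsum (fun v => A v && (mean A u <= u v)) (fun v => u v - mean A u) / volR A.

(* By Markov's inequality u exceeds this threshold on at most 3/4 of the volume
   of A; unlike a median, it needs no sorting. *)
Definition center A u : R := mean A u + 4 / 3 * spread A u.

Definition part A u v : R := if A v && (center A u <= u v) then u v - center A u else 0.

Lemma spread_ge0 A u : 0 <= spread A u.
Proof.
rewrite /spread mulr_ge0 ?invr_ge0 ?volR_ge0 //.
by apply: vsum_ge0 => v _ /andP [_]; rewrite subr_ge0.
Qed.

Lemma part_ge0 A u v : 0 <= part A u v.
Proof. by rewrite /part; case: ifP => // /andP [_]; rewrite subr_ge0. Qed.

Lemma part_gt0 A u v : 0 < part A u v -> A v && (center A u < u v).
Proof.
rewrite /part; case: ifP => [/andP [-> _]|_]; last by rewrite ltxx.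
by rewrite subr_gt0.
Qed.

(** Consequently every removal leaves at least a quarter of the volume of A. *)
Lemma volR_part A u : 0 < volR A ->
  4 * volR (fun v => 0 < part A u v) <= 3 * volR A.
Proof.
move=> A0; have a0 := spread_ge0 A u.
set P := fun v => _.
pose D := fun v => A v && (mean A u <= u v).
have aE : spread A u * volR A = vsum D (fun v => u v - mean A u).
  by rewrite /spread divfK ?gt_eqF.
have Pu v : P v -> A v /\ 4 / 3 * spread A u < u v - mean A u.
  by move=> /part_gt0 /andP [Av]; rewrite /center => h; split=> //; lra.
have PD v : P v -> D v.
  by move=> /Pu [Av h]; rewrite /D Av /=; move: h a0; lra.
have D0 : {in hs, forall v, D v -> 0 <= u v - mean A u}.
  by move=> v _ /andP [_]; rewrite subr_ge0.
have h1 : 4 / 3 * spread A u * volR P <= spread A u * volR A.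
  rewrite aE /volR -vsumZ; apply: le_trans (_ : vsum P (fun v => u v - mean A u) <= _).
    by apply: ler_vsum => v _ /Pu [_ /ltW]; rewrite mulr1.
  by apply: vsum_subset => // v _ /PD.
(* Markov's inequality says nothing when the spread is 0; then no vertex lies strictly above the
   mean and the set contains no half-edge. *)
move: a0; rewrite le_eqVlt => /orP [/eqP a0|a0]; last first.
  have : spread A u * (4 / 3 * volR P) <= spread A u * volR A by lra.
  by rewrite ler_pM2l //; lra.
case hP: (has P hs); last first.
  suff -> : volR P = 0 by rewrite mulr0 mulr_ge0 // ltW.
  rewrite /volR vsum_mkcond big_seq big1 // => v vh.
  by move/hasPn: hP => /(_ v vh) /negbTE ->; rewrite mul0r.
move/hasP: hP => [v vh Pv]; have [Av] := Pu v Pv.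
have : u v - mean A u <= vsum D (fun v => u v - mean A u).
  rewrite /vsum (big_rem v) //= (PD v Pv) lerDl big_seq_cond.
  apply: sumr_ge0 => w /andP [/mem_rem wh Dw]; exact: D0.
by rewrite -aE -a0; lra.
Qed.

Lemma vsumN A u : vsum A (fun v => - u v) = - vsum A u.
Proof. by rewrite /vsum sumrN. Qed.

Lemma meanN A u : mean A (fun v => - u v) = - mean A u.
Proof. by rewrite /mean vsumN mulNr. Qed.

Lemma vsum_mean0 A u : 0 < volR A -> vsum A (fun v => u v - mean A u) = 0.
Proof.
move=> A0; have -> : vsum A (fun v => u v - mean A u) =
   vsum A (fun v => u v + - mean A u * 1) by apply: eq_vsum => // v _ _; ring.
by rewrite vsumD vsumZ -/(volR A) /mean mulNr divfK ?subrr ?gt_eqF.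
Qed.

Lemma spreadN A u : 0 < volR A -> spread A (fun v => - u v) = spread A u.
Proof.
move=> A0; rewrite /spread meanN; congr (_ / _).
have h := vsum_mean0 u A0; rewrite vsum_mkcond in h.
rewrite vsum_mkcond [RHS]vsum_mkcond.
apply/eqP; rewrite -subr_eq0 -sumrB -oppr_eq0 -sumrN -[X in _ == X]h.
apply/eqP/eq_bigr => v _; case: (A v) => /=; last by ring.
rewrite lerN2; case: (ltgtP (u v) (mean A u)) => h' /=; rewrite ?mul1r ?mul0r; try ring.
by rewrite h'; ring.
Qed.

(** Let a be the spread and r the total excess over 4/3 a on both sides. The absolute deviation has
    mean 2 a and is at most r + 4/3 a, so r has mean at least 2/3 a and its square has mean at least
    4/9 a^2. Hence (r + 4/3 a)^2 <= 2 r^2 + 32/9 a^2 is on average at most 10 r^2. *)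
Lemma part_energy A u : 0 < volR A ->
  vsum A (fun v => (u v - mean A u) ^+ 2) <=
  10 * (sqsum es (part A u) + sqsum es (part A (fun v => - u v))).
Proof.
move=> A0; set a := spread A u; have a0 : 0 <= a := spread_ge0 A u.
have restrict w : sqsum es (part A w) = vsum A (fun v => part A w v ^+ 2).
  rewrite /sqsum !vsum_mkcond; apply: eq_bigr => v _; rewrite mul1r /part.
  by case: (A v); rewrite ?mul1r ?mul0r ?expr0n.
rewrite !restrict -vsumD.
pose r v := part A u v + part A (fun v => - u v) v.
have cN : center A (fun v => - u v) = - mean A u + 4 / 3 * a.
  by rewrite /center meanN spreadN.
have rE v : A v -> part A u v ^+ 2 + part A (fun v => - u v) v ^+ 2 = r v ^+ 2.
  move=> Av; rewrite /r /part Av cN /center -/a /=.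
  case: ifP => h1; case: ifP => h2; rewrite ?addr0 ?add0r ?expr0n ?addr0 ?add0r //=.
  have -> : u v - (mean A u + 4 / 3 * a) = 0 by move: h1 h2 a0; lra.
  by rewrite add0r expr0n /= add0r.
have r_ge v : A v -> `|u v - mean A u| - 4 / 3 * a <= r v.
  move=> Av; rewrite /r /part Av cN /center -/a /=.
  by case: (ler0P (u v - mean A u)) => s; case: (lerP (mean A u + 4 / 3 * a) (u v)) => h1;
    case: (lerP (- mean A u + 4 / 3 * a) (- u v)) => h2;
    move: h1 h2 s a0; lra.
have r0 v : 0 <= r v by rewrite addr_ge0 ?part_ge0.
have absE : vsum A (fun v => `|u v - mean A u|) = 2 * (a * volR A).
  rewrite /a /spread divfK ?gt_eqF //.
  have h := vsum_mean0 u A0; rewrite vsum_mkcond in h; rewrite !vsum_mkcond.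
  rewrite -[RHS]subr0 -[X in _ - X]h mulr_sumr -sumrB; apply: eq_bigr => v _.
  case: (A v) => /=; last by ring.
  by case: ler0P => s; case: (lerP (mean A u) (u v)) => s'; rewrite ?mul1r ?mul0r; move: s s'; lra.
have rsum : 2 / 3 * (a * volR A) <= vsum A r.
  apply: le_trans (_ : vsum A (fun v => `|u v - mean A u| + - (4 / 3 * a) * 1) <= _).
    by rewrite vsumD vsumZ absE -/(volR A); lra.
  by apply: ler_vsum => v _ Av; rewrite mulr1; exact: r_ge.
have rsq : 4 / 3 * a * vsum A r + - (4 / 9 * a ^+ 2) * volR A <= vsum A (fun v => r v ^+ 2).
  rewrite /volR -!vsumZ -vsumD; apply: ler_vsum => v _ _.
  by have := sqr_ge0 (r v - 2 / 3 * a); lra.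
have : vsum A (fun v => (u v - mean A u) ^+ 2) <=
    2 * vsum A (fun v => r v ^+ 2) + 32 / 9 * a ^+ 2 * volR A.
  rewrite /volR -!vsumZ -vsumD; apply: ler_vsum => v _ Av.
  have := r_ge v Av; rewrite -(real_normK (num_real (u v - mean A u))).
  have := normr_ge0 (u v - mean A u); move: `|_| (r0 v) => x r1 x0 h.
  have h2 : x ^+ 2 <= (r v + 4 / 3 * a) ^+ 2.
    have b0 : 0 <= 4 / 3 * a by move: a0; lra.
    by rewrite ler_sqr ?nnegrE //; [rewrite -lerBlDr | rewrite addr_ge0].
  by have := sqr_ge0 (r v - 4 / 3 * a); lra.
have -> : vsum A (fun v => part A u v ^+ 2 + part A (fun v => - u v) v ^+ 2) =
    vsum A (fun v => r v ^+ 2) by apply: eq_vsum => // v _ /rE.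
have := ler_wpM2l a0 rsum.
move: rsq; move: (vsum A r) (vsum A (fun v => r v ^+ 2)) (vsum A _) (volR A) => s1 s2 s3 w.
by lra.
Qed.

End Center.

(** * Expected decrease of the potential in one round *)

Section Round.
Variables (R : realType) (V : eqType) (es : seq (V * V)) (x0 : V).
Variables (kap eps bet : R) (T : nat).
Implicit Types (A : V -> bool) (u : V -> R) (As : seq (V -> bool)) (bits : seq bool).

Local Notation hs := (half_edges es).
Local Notation vsum := (vsum es).
Local Notation volR := (volR R es).
Local Notation mean := (mean es).
Local Notation coord := (coord R es x0).
Local Notation coord_dev := (coord_dev R es x0).
Local Notation potential := (potential R es x0).
Local Notation N := (size hs).
Local Notation m := ((size es)%:R : R).

Definition start_sum bits v : R := lin (fun h => start R es x0 h v) bits.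

Definition proj As bits : V -> R := walk es (start_sum bits) As.

(** The removed volume has reached sqrt bet, again compared through squares. *)
Definition frozen A : bool := bet <= (2 * m - volR A) * (2 * m - volR A).

Definition removed A u : V -> bool := sweep_set es kap eps T A (part es A u).

Definition shrink A u : V -> bool :=
  if frozen A then A else fun v => A v && ~~ removed A u v.

Definition round (st : (V -> bool) * seq (V -> bool)) bits :=
  let A := shrink st.1 (proj st.2 bits) in (A, rcons st.2 A).

Lemma projE As bits v : proj As bits v = lin (fun h => coord As h v) bits.
Proof.
rewrite /proj /start_sum /lin.
under [X in walk _ X _ _]eq_fun => w do under eq_bigr => h _ do rewrite mulrC.
by rewrite walk_sum; apply: eq_bigr => h _; rewrite mulrC.
Qed.

Lemma proj_mean A As bits :
  mean A (proj As bits) = lin (fun h => mean A (coord As h)) bits.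
Proof.
rewrite /mean; have -> : vsum A (proj As bits) = lin (fun h => vsum A (coord As h)) bits.
  rewrite /vsum /lin; under eq_bigr => v _ do rewrite projE /lin.
  by rewrite exchange_big; apply: eq_bigr => h _; rewrite mulr_suml.
by rewrite mulrC -linZ; apply: eq_bigr => h _; rewrite mulrC (mulrC _ (sign_of _ _)) ; congr (_ * _); rewrite mulrC.
Qed.

Lemma proj_dev A As bits v :
  proj As bits v - mean A (proj As bits) = lin (fun h => coord_dev As A h v) bits.
Proof. by rewrite projE proj_mean -mulN1r -linZ -linD; apply: eq_bigr => h _; rewrite mulN1r. Qed.

Lemma proj_negb As bits v : proj As (map negb bits) v = - proj As bits v.
Proof. by rewrite !projE lin_negb. Qed.

Lemma sqnorm_ord (z : nat -> R) n : sqnorm n z = \sum_(h < n) z h ^+ 2.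
Proof. by rewrite /sqnorm big_mkord. Qed.

Lemma potentialE As A : potential As A = vsum A (fun v => sqnorm N (fun h => coord_dev As A h v)).
Proof.
rewrite /potential /vsum exchange_big; apply: eq_bigr => v _.
by rewrite sqnorm_ord.
Qed.

(** The expected variance of the projection is the potential. Negating all signs exchanges u and -
    u, so on average the upper tail alone carries half of the bound of [part_energy], and a round
    need not sweep from below. *)
Lemma avg_part_energy As A : 0 < volR A ->
  potential As A <= 20 * avg N (fun w => sqsum es (part es A (proj As w))).
Proof.
move=> A0.
have -> : potential As A = avg N (fun w => vsum A (fun v => (proj As w v - mean A (proj As w)) ^+ 2)).
  rewrite potentialE avg_sum; apply: eq_bigr => v _.
  by rewrite -avg_lin_sqr; apply: eq_avg => w _; rewrite proj_dev.
apply: le_trans (_ : avg N (fun w => 10 * (sqsum es (part es A (proj As w)) +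
    sqsum es (part es A (proj As (map negb w))))) <= _).
  apply: le_avg => w _; apply: le_trans (part_energy (proj As w) A0) _.
  rewrite le_eqVlt; apply/orP; left; apply/eqP; congr (_ * (_ + sqsum es (part es A _))).
  by apply: functional_extensionality_dep => v; rewrite proj_negb.
rewrite avgZ avgD (avg_negb N (fun w => sqsum es (part es A (proj As w)))).
by move: (avg _ _) => x; lra.
Qed.

Lemma removed_sub A u : {in hs, forall v, removed A u v -> A v}.
Proof. by move=> v _ /andP [/part_gt0 /andP []]. Qed.

Lemma volR_removed A u : 0 < volR A -> 4 * volR (removed A u) <= 3 * volR A.
Proof.
move=> A0; apply: le_trans (volR_part u A0); rewrite ler_pM2l //.
by apply: vsum_subset => // v _ /andP [].
Qed.

Lemma volR_shrink A u : 0 < volR A -> volR A <= 4 * volR (shrink A u).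
Proof.
move=> A0; rewrite /shrink; case: ifP => _; first by have := ltW A0; lra.
have -> : volR A = volR (removed A u) + volR (fun v => A v && ~~ removed A u v).
  exact/vsum_split/removed_sub.
have := volR_removed u A0.
have -> : volR A = volR (removed A u) + volR (fun v => A v && ~~ removed A u v).
  exact/vsum_split/removed_sub.
by lra.
Qed.

Hypotheses (eps_ge0 : 0 <= eps) (kap_gt0 : 0 < kap) (kap_le1 : kap <= 1).
Hypothesis es_gt0 : (0 < size es)%N.
Hypothesis eps_kap : eps * 8 <= Num.sqrt kap.
Hypothesis eps_T : (1 - eps) ^+ T * (32 * m) <= 1.

(* Borders are integers and volumes are at most 2 m: a level set that is not
   sparse expands by at least 1 / (2 m), however small kap is. *)
Definition gap : R := Num.max (Num.sqrt kap) (2 * m)^-1.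

Lemma part_lip A u (a b : V) : A a -> A b ->
  (part es A u a - part es A u b) ^+ 2 <= (u a - u b) ^+ 2.
Proof.
rewrite /part => -> -> /=; have sq := sqr_ge0 (u a - u b).
case: ifP => h1; case: ifP => h2; last by rewrite subr0 expr0n.
- by rewrite le_eqVlt; apply/orP; left; apply/eqP; ring.
- have {}h2 : u b < center es A u by rewrite ltNge h2.
  rewrite subr0 ler_sqr ?nnegrE ?subr_ge0 //; first by lra.
  by move: h1 h2; lra.
- have {}h1 : u a < center es A u by rewrite ltNge h1.
  rewrite sub0r sqrrN -(sqrrN (u a - u b)) ler_sqr ?nnegrE ?subr_ge0 //; first by lra.
  by move: h1 h2; lra.
Qed.

(** The sweep bound, transferred from the truncated [part] to the projection itself: truncation at
    the center is 1-Lipschitz on A, and above the center, which is at least the mean, it does not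
    exceed the deviation from the mean. *)
Lemma round_sweep As A bits S : 0 < volR A -> S = removed A (proj As bits) ->
  gap ^+ 2 / 32 * sqsum es (part es A (proj As bits)) <=
    vsum S (fun v => lin (fun h => coord_dev As A h v) bits ^+ 2)
    + 2^-1 * \sum_(p <- es | (A p.1 && ~~ S p.1) && (A p.2 && ~~ S p.2))
       lin (fun h => coord As h p.1 - coord As h p.2) bits ^+ 2.
Proof.
move=> A0 SE; set u := proj As bits in SE *.
have eps_le1 : eps <= 1.
  have : Num.sqrt kap <= 1 by rewrite -sqrtr1 ler_sqrt.
  by move: eps_kap eps_ge0; lra.
have := @sweep_drop R V es kap eps T A (part es A u) eps_ge0 eps_le1 gap.
move=> /(_ (fun v _ => part_ge0 _ _ _ _)) /(_ (fun v _ h => proj1 (andP (part_gt0 h)))).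
move=> /(_ kap_gt0 kap_le1 es_gt0 eps_kap eps_T erefl) /le_trans; apply.
rewrite -[sweep_set _ _ _ _ _ _]/(removed A u) -SE; apply: lerD.
  apply: ler_vsum => v _; rewrite SE => /andP [/part_gt0 /andP [Av uc] _].
  have := spread_ge0 es A u; move: uc; rewrite -proj_dev -/u /center => uc s0.
  have -> : part es A u v = u v - (mean A u + 4 / 3 * spread es A u).
    by rewrite /part Av /center (ltW uc).
  by rewrite ler_sqr ?nnegrE; lra.
rewrite ler_pM2l ?invr_gt0 //; apply: ler_sum => p /andP [/andP [A1 _] /andP [A2 _]].
apply: le_trans (part_lip _ A1 A2) _.
by rewrite /u !projE -mulN1r -linZ -linD; under [X in _ <= X ^+ 2]eq_bigr => h _ do rewrite -mulN1r.
Qed.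

(** The factor 640 is 32 from the sweep times 20 from [avg_part_energy]. The two tails come from the
    vertices (1) and the edges (1/2 times the 2 of [energy_le]). *)
Lemma round_potential k As A : ~~ frozen A -> 0 < volR A -> 0 < k ->
  avg N (fun w => potential (round (A, As) w).2 (round (A, As) w).1) <=
  (1 - (gap ^+ 2 / 640 - 2 * tail k) / k ^+ 2) * potential As A.
Proof.
move=> nf A0 k0.
pose S w := removed A (proj As w).
pose B w : V -> bool := fun v => A v && ~~ S w v.
have rE w : round (A, As) w = (B w, rcons As (B w)) by rewrite /round /shrink /= (negbTE nf).
have B0 w : 0 < volR (B w).
  by have := volR_shrink (proj As w) A0; rewrite /shrink (negbTE nf) -/(B w); lra.
set P := potential As A.
pose dv v h := coord_dev As A h v.
pose df (p : V * V) h := coord As h p.1 - coord As h p.2.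
(* Summed over all of A and all its edges rather than over the random sets S and B, so that its
   average can be taken term by term. *)
pose X w := vsum A (fun v => excess k N (dv v) w)
   + 2^-1 * \sum_(p <- es | A p.1 && A p.2) excess k N (df p) w.
have k20 : 0 < k ^+ 2 by rewrite exprn_gt0.
have step w : size w = N -> gap ^+ 2 / 32 * sqsum es (part es A (proj As w)) <=
    k ^+ 2 * (P - potential (rcons As (B w)) (B w)) + X w.
  move=> sw; apply: le_trans (round_sweep A0 (erefl (S w))) _.
  have BA : {in hs, forall v, B w v -> A v} by move=> v _ /andP [].
  have := potential_step x0 As BA A0 (B0 w); rewrite -/P => H.
  have {}H : \sum_(h < N) (vsum (fun v => A v && ~~ B w v) (fun v => coord_dev As A h v ^+ 2)
                        + 2^-1 * energy es (B w) (coord As h))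
        <= P - potential (rcons As (B w)) (B w) by lra.
  have := ler_wpM2l (ltW k20) H.
  have -> : \sum_(h < N) (vsum (fun v => A v && ~~ B w v) (fun v => coord_dev As A h v ^+ 2)
                        + 2^-1 * energy es (B w) (coord As h)) =
     vsum (S w) (fun v => sqnorm N (dv v)) + 2^-1 *
     \sum_(p <- es | B w p.1 && B w p.2) sqnorm N (df p).
    rewrite big_split -mulr_sumr /=; congr (_ + _ * _).
      transitivity (\sum_(h < N) vsum (S w) (fun v => coord_dev As A h v ^+ 2)).
        apply: eq_bigr => h _; apply: eq_vsum => // v vh; rewrite /B.
        case Sv: (S w v); first by rewrite (removed_sub vh Sv).
        by case: (A v).
      by rewrite /vsum exchange_big; apply: eq_bigr => v _; rewrite sqnorm_ord.
    by rewrite exchange_big; apply: eq_bigr => p _; rewrite sqnorm_ord.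
  move=> {}H; have XX := lerD H (lexx (X w)); apply: le_trans XX.
  have i1 : vsum (S w) (fun v => lin (dv v) w ^+ 2) <=
      k ^+ 2 * vsum (S w) (fun v => sqnorm N (dv v)) + vsum A (fun v => excess k N (dv v) w).
    apply: le_trans (_ : vsum (S w) (fun v => k ^+ 2 * sqnorm N (dv v) + excess k N (dv v) w) <= _).
      by apply: ler_vsum => v _ _; exact: lin_sqr_le_excess.
    rewrite vsumD vsumZ lerD2l; apply: vsum_subset; first exact: removed_sub.
    by move=> v _ _; exact: excess_ge0.
  have i2 : \sum_(p <- es | B w p.1 && B w p.2) lin (df p) w ^+ 2 <=
      k ^+ 2 * (\sum_(p <- es | B w p.1 && B w p.2) sqnorm N (df p))
      + \sum_(p <- es | A p.1 && A p.2) excess k N (df p) w.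
    rewrite mulr_sumr big_mkcond [X in _ <= X + _]big_mkcond [X in _ <= _ + X]big_mkcond.
    rewrite -big_split /=; apply: ler_sum => p _; rewrite /B.
    have := lin_sqr_le_excess k N (df p) w; have := excess_ge0 k N (df p) w.
    case: (A p.1); case: (A p.2); case: (S w p.1); case: (S w p.2) => //= h1 h2;
      by rewrite ?add0r.
  by rewrite /X; move: i1 i2; rewrite /B; lra.
have avgX : avg N X <= 2 * tail k * P.
  rewrite /X avgD avgZ !avg_sum.
  have i1 : \sum_(v <- hs | A v) avg N (excess k N (dv v)) <= tail k * P.
    rewrite /P potentialE /vsum mulr_sumr; apply: ler_sum => v _.
    by apply: avg_excess; exact: ltW.
  have i2 : \sum_(p <- es | A p.1 && A p.2) avg N (excess k N (df p)) <= tail k * (2 * P).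
    apply: le_trans (_ : tail k * (\sum_(p <- es | A p.1 && A p.2) sqnorm N (df p)) <= _).
      by rewrite mulr_sumr; apply: ler_sum => p _; apply: avg_excess; exact: ltW.
    rewrite ler_wpM2l ?mulr_ge0 ?expR_ge0 //.
    under eq_bigr => p _ do rewrite sqnorm_ord.
    rewrite exchange_big mulr_sumr; apply: ler_sum => h _.
    apply: le_trans (energy_le es A (coord_dev As A h)).
    rewrite le_eqVlt; apply/orP; left; apply/eqP; apply: eq_bigr => p _.
    by rewrite /df /coord_dev; congr (_ ^+ 2); ring.
  by move: i1 i2; lra.
have := avg_part_energy As A0.
have H : avg N (fun w => gap ^+ 2 / 32 * sqsum es (part es A (proj As w))) <=
   avg N (fun w => k ^+ 2 * P + (- k ^+ 2) * potential (rcons As (B w)) (B w) + X w).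
  by apply: le_avg => w sw; have := step w sw; lra.
move: avgX H; rewrite /X !avgD !avgZ !avg_const.
have -> : avg N (fun w => potential (round (A, As) w).2 (round (A, As) w).1) =
   avg N (fun w => potential (rcons As (B w)) (B w)).
  by apply: eq_avg => w _; rewrite rE.
set a := avg _ (fun w => sqsum _ _); set b := avg _ (fun w => potential _ _) => h0 h1 h2.
set c := gap ^+ 2 in h1 *.
have c0 : 0 <= c by exact: sqr_ge0.
have h3 : k ^+ 2 * b <= k ^+ 2 * P - (c / 640 - 2 * tail k) * P.
  by have := ler_wpM2l c0 h2; move: h1 h0; rewrite -/P; lra.
rewrite -(ler_pM2l k20); apply: le_trans h3 _.
rewrite le_eqVlt; apply/orP; left; apply/eqP; field; by rewrite gt_eqF.
Qed.

End Round.

(** * Epochs *)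

Section Epochs.
Variables (R : realType) (V : eqType) (es : seq (V * V)) (x0 : V).
Variables (kap eps bet : R) (T : nat).
Implicit Types (A B X : V -> bool) (As : seq (V -> bool)) (bits w : seq bool).

Local Notation hs := (half_edges es).
Local Notation volR := (volR R es).
Local Notation N := (size hs).
Local Notation m := ((size es)%:R : R).
Local Notation frozen := (frozen es bet).
Local Notation round := (round es x0 kap eps bet T).
Local Notation shrink := (shrink es kap eps bet T).
Local Notation removed := (removed es kap eps T).
Local Notation potential := (potential R es x0).

Fixpoint rounds n (st : (V -> bool) * seq (V -> bool)) bits :=
  if n is n'.+1 then rounds n' (round st (take N bits)) (drop N bits) else st.

Definition epoch A bits : V -> bool := (rounds T (A, [::]) bits).1.

Fixpoint epochs n A bits : V -> bool :=
  if n is n'.+1 then epochs n' (epoch A (take (T * N) bits)) (drop (T * N) bits) else A.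

Lemma shrink_sub A u v : shrink A u v -> A v.
Proof. by rewrite /shrink; case: ifP => // _ /andP []. Qed.

Lemma rounds_sub n st bits v : (rounds n st bits).1 v -> st.1 v.
Proof.
elim: n st bits => [//|n IH] st bits /= /IH /=; exact: shrink_sub.
Qed.

Lemma epoch_sub A bits v : epoch A bits v -> A v.
Proof. exact: rounds_sub. Qed.

Lemma frozen_rounds n st bits : frozen st.1 -> (rounds n st bits).1 = st.1.
Proof.
elim: n st bits => [//|n IH] st bits fr /=.
have E : (round st (take N bits)).1 = st.1 by rewrite /= /shrink fr.
by rewrite IH E.
Qed.

Lemma size_rounds n st bits : size (rounds n st bits).2 = (size st.2 + n)%N.
Proof.
by elim: n st bits => [|n IH] st bits /=; rewrite ?addn0 // IH /= size_rcons addSnnS.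
Qed.

Definition expanding A : Prop :=
  forall X, {in hs, forall v, X v -> A v} -> 2 * volR X <= volR A ->
    volR X <= 2 * T%:R * (boundary es X)%:R.

(** The boundary is taken in the whole graph, so shrinking A only restricts which sets X are
    tested. *)
Lemma expanding_sub A B : {in hs, forall v, B v -> A v} -> expanding A -> expanding B.
Proof.
move=> BA eA X XB X2; apply: eA => [v vh Xv|]; first exact/BA/XB.
by apply: le_trans X2 _; apply: vsum_subset.
Qed.

Definition bad A : bool := ~~ frozen A && ~~ `[< expanding A >].

(** Badness never returns, which allows the failure probability to be halved by each further
    epoch. *)
Lemma bad_epoch A bits : bad (epoch A bits) -> bad A.
Proof.
rewrite /bad; case fr: (frozen A); first by rewrite /epoch frozen_rounds ?fr.
move=> /andP [_ h] /=; apply: contra h => /asboolP h; apply/asboolP.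
by apply: expanding_sub h => v _; exact: epoch_sub.
Qed.

Section Invariant.
Hypotheses (eps_ge0 : 0 <= eps) (eps_le1 : eps <= 1) (kap_gt0 : 0 < kap).
Hypotheses (bet_le : bet <= m ^+ 2).

(** Before freezing, the removed volume is below sqrt bet <= m. *)
Lemma frozenPn A : ~~ frozen A -> m < volR A.
Proof.
rewrite /frozen -ltNge => /lt_le_trans /(_ bet_le) h.
have := volR_le_all R es A => v2; rewrite ltNge; apply: contraL h => h; rewrite -leNgt.
by rewrite -expr2 ler_sqr ?nnegrE //; lra.
Qed.

(** Each removed set is sparse in the set it is taken from, so borders add up to at most sqrt kap
    times the total removed volume. The last removal starts from volume more than m and leaves a
    quarter of it. *)
Definition balanced_inv A : Prop :=
  (boundary es A)%:R <= Num.sqrt kap * (2 * m - volR A) /\ m <= 4 * volR A.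

Lemma balanced_inv_shrink A u : balanced_inv A -> balanced_inv (shrink A u).
Proof.
move=> [bA mA]; rewrite /shrink; case: ifP => // /negbT nf.
have mW := frozenPn nf; have W0 : 0 < volR A by apply: le_lt_trans mW.
set S := removed A u; split; last first.
  by have := volR_shrink kap eps bet T u W0; rewrite /shrink (negbTE nf); lra.
have [k0 [_ sp _ _ _]] := sweep_spec es kap A (part es A u) eps_ge0 eps_le1 T.
have {}sp : sparse es kap A S := sp.
have {}sp : (cut_in es A S)%:R <= Num.sqrt kap * volR S.
  move: sp; rewrite /sparse -!expr2 -{1}(sqr_sqrtr (ltW kap_gt0)) -exprMn.
  by rewrite ler_sqr ?nnegrE // mulr_ge0 ?volR_ge0 // ltW // sqrtr_gt0.
(* An edge leaving what remains either left A already or joins it to S inside A. *)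
have cS : (boundary es (fun v => A v && ~~ S v) <= boundary es A + cut_in es A S)%N.
  rewrite /boundary /cut_in -!sum1_count !(big_mkcond (fun p => _ (+) _)).
  rewrite (big_mkcond (fun p => [&& _, _ & _])) -big_split /=.
  apply: leq_sum => p _.
  by case: (A p.1); case: (A p.2) => //=; case: (S p.1); case: (S p.2).
have vE : volR A = volR S + volR (fun v => A v && ~~ S v).
  by apply: vsum_split; exact: removed_sub.
move: cS; rewrite -(ler_nat R) natrD; move: bA; rewrite vE; lra.
Qed.

Lemma balanced_inv_rounds n st bits :
  balanced_inv st.1 -> balanced_inv (rounds n st bits).1.
Proof.
elim: n st bits => [//|n IH] st bits h /=; apply: IH; exact: balanced_inv_shrink.
Qed.

Lemma balanced_inv_epochs n A bits : balanced_inv A -> balanced_inv (epochs n A bits).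
Proof.
elim: n A bits => [//|n IH] A bits h /=; apply: IH; exact: balanced_inv_rounds.
Qed.

End Invariant.

Section Probability.
Hypotheses (eps_ge0 : 0 <= eps) (kap_gt0 : 0 < kap) (kap_le1 : kap <= 1).
Hypothesis es_gt0 : (0 < size es)%N.
Hypothesis eps_kap : eps * 8 <= Num.sqrt kap.
Hypothesis eps_T : (1 - eps) ^+ T * (32 * m) <= 1.
Hypothesis bet_le : bet <= m ^+ 2.
Variables (k rate : R).
Hypothesis k_gt0 : 0 < k.
Hypothesis rate_le : rate * k ^+ 2 <= gap es kap ^+ 2 / 640 - 2 * tail k.
Hypothesis rate_le1 : rate <= 1.
Hypothesis rate_T : (1 - rate) ^+ T * (128 * m ^+ 2) <= 1.

(* No decrease is needed once A is frozen. *)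
Definition live_potential (st : (V -> bool) * seq (V -> bool)) : R :=
  if frozen st.1 then 0 else potential st.2 st.1.

Lemma live_potential_ge0 st : 0 <= live_potential st.
Proof. by rewrite /live_potential; case: ifP => // _; exact: potential_ge0. Qed.

Lemma avg_live_round st :
  avg N (fun w => live_potential (round st w)) <= (1 - rate) * live_potential st.
Proof.
case: st => A As; rewrite {2}/live_potential; case: ifP => fr.
  rewrite mulr0 -[X in _ <= X](avg_const N); apply: le_avg => w _.
  by rewrite /live_potential /= /shrink fr fr.
have W0 : 0 < volR A by apply: le_lt_trans (frozenPn bet_le (negbT fr)).
have P0 : 0 <= potential As A := potential_ge0 _ _ _ _ _.
have := @round_potential R V es x0 kap eps bet T eps_ge0 kap_gt0 kap_le1 es_gt0 eps_kap eps_T k As A (negbT fr) W0 k_gt0.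
move=> h; apply: (le_trans (le_trans _ h)).
  apply: le_avg => w _; rewrite /live_potential.
  by case: ifP => // _; exact: potential_ge0.
rewrite ler_wpM2r // lerD2l lerN2 ler_pdivlMr // exprn_gt0 //.
Qed.

Lemma avg_live_rounds n st :
  avg (n * N) (fun w => live_potential (rounds n st w)) <= (1 - rate) ^+ n * live_potential st.
Proof.
elim: n st => [|n IH] st; first by rewrite mul0n /= mul1r.
rewrite mulSn avg_cat.
apply: le_trans (_ : avg N (fun w => (1 - rate) ^+ n * live_potential (round st w)) <= _).
  apply: le_avg => w sw; apply: le_trans (IH _).
  by apply: le_avg => w' _ /=; rewrite take_size_cat ?drop_size_cat.
rewrite avgZ exprSr -mulrA ler_wpM2l ?avg_live_round // exprn_ge0 // subr_ge0 //.
Qed.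

(** Markov's inequality. A bad outcome has potential at least 1 / (16 N) = 1 / (32 m) by
    [expansion_of_potential], whereas the expected potential is at most 2 m / (128 m^2). *)
Lemma avg_bad_epoch A : ~~ frozen A ->
  avg (T * N) (fun w => (bad (epoch A w))%:R : R) <= 2^-1.
Proof.
move=> fr; have W0 : 0 < volR A by apply: le_lt_trans (frozenPn bet_le fr).
have m0 : 0 < m by rewrite ltr0n.
have NE : N%:R = 2 * m :> R by rewrite size_half_edges -mul2n natrM.
apply: le_trans (_ : avg (T * N) (fun w => 32 * m * live_potential (rounds T (A, [::]) w)) <= _).
  apply: le_avg => w _; rewrite /bad /epoch.
  set st := rounds _ _ _; have F0 := live_potential_ge0 st.
  rewrite /live_potential; case fst: (frozen st.1); first by rewrite /= mulr0.
  case: asboolP => [_|ne] /=; first by rewrite !mulr_ge0 ?potential_ge0.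
  rewrite leNgt; apply/negP => small; apply: ne => X XA X2.
  have Ts : size st.2 = T by rewrite size_rounds.
  rewrite -[X in 2 * X%:R]Ts; apply: (@expansion_of_potential _ _ _ x0 _ st.1) => //.
    by apply: le_lt_trans (frozenPn bet_le (negbT fst)).
  by rewrite NE; move: small; lra.
rewrite avgZ.
have h1 := avg_live_rounds T (A, [::]).
have h2 : live_potential (A, [::]) <= 2 * m.
  by rewrite /live_potential (negbTE fr); apply: potential_nil.
have h3 : 0 <= (1 - rate) ^+ T by rewrite exprn_ge0 // subr_ge0.
have := ler_wpM2l h3 h2; move: h1; move: (avg _ _) (live_potential _) => a b h1 h4.
have h5 : a <= (1 - rate) ^+ T * (2 * m) by lra.
have := ler_wpM2l (ltW m0) h5; move: rate_T; lra.
Qed.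

Lemma avg_bad_epochs n A :
  avg (n * (T * N)) (fun w => (bad (epochs n A w))%:R : R) <= 2^-1 ^+ n * (bad A)%:R.
Proof.
elim: n A => [|n IH] A; first by rewrite mul0n /= mul1r.
rewrite mulSn avg_cat.
apply: le_trans (_ : avg (T * N) (fun w => 2^-1 ^+ n * (bad (epoch A w))%:R : R) <= _).
  apply: le_avg => w sw; apply: le_trans (IH _).
  by apply: le_avg => w' _ /=; rewrite take_size_cat ?drop_size_cat.
rewrite avgZ exprSr -mulrA ler_wpM2l ?exprn_ge0 ?invr_ge0 //.
case bA: (bad A); first by rewrite mulr1; apply: avg_bad_epoch; case/andP: bA.
rewrite mulr0 -[X in _ <= X](avg_const (T * N)); apply: le_avg => w _.
by case bE: (bad _) => //; rewrite (bad_epoch bE) in bA.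
Qed.

End Probability.
End Epochs.

(** * Timed Hoare triples *)

Section Exec.
Variable R : realType.
Implicit Types (s : store R) (c : cmd) (Q : store R -> Prop).

Definition steps (g : config R) (w : seq bool) : config R :=
  foldl (fun g bit => step bit g) g w.

(** The step count and the final store are the same for all bit strings, so this describes
    deterministic code; the coin flips are treated apart. The continuation K makes executions
    composable. *)
Definition executes c s k s' : Prop :=
  forall K w, size w = k -> steps (c :: K, s) w = (K, s').

Definition runs_to s c k Q : Prop :=
  exists k' s', [/\ (k' <= k)%N, executes c s k' s' & Q s'].

Lemma steps_cat g w1 w2 : steps g (w1 ++ w2) = steps (steps g w1) w2.
Proof. exact: foldl_cat. Qed.

Lemma steps_split (n1 n2 : nat) (w : seq bool) : size w = (n1 + n2)%N ->
  exists w1 w2, [/\ w = w1 ++ w2, size w1 = n1 & size w2 = n2].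
Proof.
move=> sw; exists (take n1 w), (drop n1 w); rewrite cat_take_drop size_drop sw addKn.
by rewrite size_takel ?sw ?leq_addr.
Qed.

Lemma executes1 c s s' :
  (forall bit K, step bit (c :: K, s) = (K, s')) -> executes c s 1 s'.
Proof. by move=> h K [|b [|]] // _; exact: h. Qed.

Lemma executes_prefix (c : cmd) s (K0 : seq cmd) s0 k s' :
  (forall bit K, step bit (c :: K, s) = (K0 ++ K, s0)) ->
  (forall K w, size w = k -> steps (K0 ++ K, s0) w = (K, s')) ->
  executes c s k.+1 s'.
Proof.
move=> h1 h2 K [|b w] // [sw].
by rewrite -[steps _ _]/(steps (step b (c :: K, s)) w) h1 h2.
Qed.

Lemma executes_seq c1 c2 s s1 s2 k1 k2 :
  executes c1 s k1 s1 -> executes c2 s1 k2 s2 ->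
  executes (CSeq c1 c2) s (k1 + k2).+1 s2.
Proof.
move=> h1 h2; apply: (@executes_prefix _ _ [:: c1; c2] s) => // K w /steps_split.
by move=> [w1 [w2 [-> s1' s2']]]; rewrite steps_cat /= h1 // h2.
Qed.

Lemma runs_weaken s c k k' Q Q' : (k <= k')%N -> (forall s', Q s' -> Q' s') ->
  runs_to s c k Q -> runs_to s c k' Q'.
Proof.
move=> cutoff QQ [k1 [s1 [h1 h2 h3]]]; exists k1, s1; split=> //; [exact: leq_trans cutoff | exact: QQ].
Qed.

Lemma runs_post s c k Q Q' : (forall s', Q s' -> Q' s') -> runs_to s c k Q -> runs_to s c k Q'.
Proof. exact: runs_weaken. Qed.

Lemma runs_skip s k Q : (0 < k)%N -> Q s -> runs_to s CSkip k Q.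
Proof. by move=> k0 q; exists 1%N, s; split=> //; exact: executes1. Qed.

Definition iset s a i x : store R := Store (upd (imem s) a i x) (rmem s).
Definition rset s a i x : store R := Store (imem s) (upd (rmem s) a i x).

Lemma runs_iset s a i x Q : Q (iset s a (ieval s i) (ieval s x)) -> runs_to s (CISet a i x) 1 Q.
Proof. by move=> q; exists 1%N; eexists; split; [ | exact: executes1 | exact: q]. Qed.

Lemma runs_rset s a i x Q : Q (rset s a (ieval s i) (reval s x)) -> runs_to s (CRSet a i x) 1 Q.
Proof. by move=> q; exists 1%N; eexists; split; [ | exact: executes1 | exact: q]. Qed.

Lemma runs_seq s c1 c2 k1 k2 Q :
  runs_to s c1 k1 (fun s1 => runs_to s1 c2 k2 Q) -> runs_to s (CSeq c1 c2) (k1 + k2).+1 Q.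
Proof.
move=> [k1' [s1 [h1 e1 [k2' [s2 [h2 e2 q]]]]]].
exists (k1' + k2').+1, s2; split=> //; last exact: executes_seq e1 e2.
by rewrite ltnS leq_add.
Qed.

Lemma runs_if s b c1 c2 k Q :
  (beval s b -> runs_to s c1 k Q) -> (~~ beval s b -> runs_to s c2 k Q) ->
  runs_to s (CIf b c1 c2) k.+1 Q.
Proof.
move=> h1 h2; have [k' [s' [hk e q]]] : runs_to s (if beval s b then c1 else c2) k Q.
  by case: ifP => [|/negbT]; [exact: h1 | exact: h2].
exists k'.+1, s'; split=> //.
by apply: (@executes_prefix _ _ [:: if beval s b then c1 else c2] s).
Qed.

(** The arrays that a command may assign, found syntactically: frame conditions reduce to decidable
    membership and are discharged by computation. *)
Fixpoint imods c : seq nat :=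
  match c with
  | CISet a _ _ | CFlip a _ => [:: a]
  | CSeq c1 c2 | CIf _ c1 c2 => imods c1 ++ imods c2
  | CWhile _ c1 => imods c1
  | _ => [::]
  end.

Fixpoint rmods c : seq nat :=
  match c with
  | CRSet a _ _ => [:: a]
  | CSeq c1 c2 | CIf _ c1 c2 => rmods c1 ++ rmods c2
  | CWhile _ c1 => rmods c1
  | _ => [::]
  end.

Definition same_off (I J : seq nat) s s' : Prop :=
  (forall a, a \notin I -> imem s' a = imem s a) /\
  (forall a, a \notin J -> rmem s' a = rmem s a).

Definition keeps c s s' : Prop := same_off (imods c) (rmods c) s s'.

Lemma same_off_refl I J s : same_off I J s s.
Proof. by []. Qed.

Lemma same_off_trans I J s1 s2 s3 :
  same_off I J s1 s2 -> same_off I J s2 s3 -> same_off I J s1 s3.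
Proof.
move=> [h1 h2] [h3 h4]; split=> a h; first by rewrite h3 // h1.
by rewrite h4 // h2.
Qed.

Lemma same_off_sub I J I' J' s s' : {subset I <= I'} -> {subset J <= J'} ->
  same_off I J s s' -> same_off I' J' s s'.
Proof.
move=> II JJ [h1 h2]; split=> a h.
  by apply: h1; apply: contra h; exact: II.
by apply: h2; apply: contra h; exact: JJ.
Qed.

Lemma same_off_iset I J s a i x : a \in I -> same_off I J s (iset s a i x).
Proof.
move=> aI; split=> // b h; apply: functional_extensionality_dep => j /=.
by rewrite /upd; case: eqP h => [->|//]; rewrite aI.
Qed.

Lemma same_off_rset I J s a i x : a \in J -> same_off I J s (rset s a i x).
Proof.
move=> aI; split=> // b h; apply: functional_extensionality_dep => j /=.
by rewrite /upd; case: eqP h => [->|//]; rewrite aI.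
Qed.

Definition kmods (f : cmd -> seq nat) (K : seq cmd) := flatten (map f K).

Lemma steps_same_off g w :
  same_off (kmods imods g.1) (kmods rmods g.1) g.2 (steps g w).2.
Proof.
elim: w g => [//|b w IH] [K s].
rewrite [steps _ _]/(steps (step b (K, s)) w).
suff [[h1 h2] h3] : ({subset kmods imods (step b (K, s)).1 <= kmods imods K} /\
      {subset kmods rmods (step b (K, s)).1 <= kmods rmods K}) /\
    same_off (kmods imods K) (kmods rmods K) s (step b (K, s)).2.
  by apply: same_off_trans h3 _; apply: same_off_sub (IH _).
case: K => [|c K] //; have sub (x y : seq nat) : {subset y <= x ++ y}.
  by move=> z zy; rewrite mem_cat zy orbT.
case: c => [|a i x|a i x|a i|c1 c2|bb c1 c2|bb c1] //=; rewrite /kmods /=.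
- by split; [split|].
- split; first by split=> //; exact: (sub [:: a]).
  by apply: (@same_off_iset _ _ s a (ieval s i) (ieval s x)); rewrite mem_head.
- split; first by split=> //; exact: (sub [:: a]).
  by apply: (@same_off_rset _ _ s a (ieval s i) (reval s x)); rewrite mem_head.
- split; first by split=> //; exact: (sub [:: a]).
  by apply: (@same_off_iset _ _ s a (ieval s i) (nat_of_bool b)); rewrite mem_head.
- by rewrite -!catA; split; [split|].
- by case: (beval s bb); split=> //; split=> z; rewrite !mem_cat => /orP [] ->; rewrite ?orbT.
- case: (beval s bb) => /=; split; try by [split | split=> z; rewrite ?mem_cat ?orbA ?orbb // => ->; rewrite ?orbT].
Qed.

Lemma executes_keeps c s k s' : executes c s k s' -> keeps c s s'.
Proof.
move=> h; have := steps_same_off ([:: c], s) (nseq k true).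
by rewrite h ?size_nseq // /kmods /= !cats0.
Qed.

Lemma runs_keeps s c k Q : runs_to s c k Q -> runs_to s c k (fun s' => Q s' /\ keeps c s s').
Proof.
move=> [k' [s' [h e q]]]; exists k', s'; split=> //; split=> //; exact: executes_keeps e.
Qed.

Lemma runs_seq_keeps s c1 c2 k1 k2 Q1 Q : runs_to s c1 k1 Q1 ->
  (forall s1, Q1 s1 -> keeps c1 s s1 -> runs_to s1 c2 k2 Q) ->
  runs_to s (CSeq c1 c2) (k1 + k2).+1 Q.
Proof.
move=> /runs_keeps h1 h2; apply: runs_seq; apply: runs_post h1 => s1 [q k].
exact: h2.
Qed.

Lemma runs_while s b c n k (Inv : nat -> store R -> Prop) : Inv 0%N s ->
  (forall i s1, (i < n)%N -> keeps c s s1 -> Inv i s1 ->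
     beval s1 b /\ runs_to s1 c k (Inv i.+1)) ->
  (forall s1, keeps c s s1 -> Inv n s1 -> ~~ beval s1 b) ->
  runs_to s (CWhile b c) (n * k.+1).+1 (Inv n).
Proof.
move=> I0 IS IE.
suff H j s1 : (j <= n)%N -> keeps c s s1 -> Inv (n - j)%N s1 ->
    runs_to s1 (CWhile b c) (j * k.+1).+1 (Inv n).
  by apply: H => //; rewrite ?subnn //; exact: same_off_refl.
elim: j s1 => [|j IH] s1 jn ks.
  rewrite subn0 mul0n => In; exists 1%N, s1; split=> //.
  by apply: executes1 => bit K; rewrite /= (negbTE (IE s1 ks In)).
move=> Ij; have lt : (n - j.+1 < n)%N by lia.
have [bt [k1 [s2 [hk e2 I2]]]] := IS _ s1 lt ks Ij.
have kc := executes_keeps e2.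
have := IH s2 (ltnW jn) (same_off_trans ks kc).
rewrite (_ : (n - j = (n - j.+1).+1)%N); last by lia.
move=> /(_ I2) [k3 [s3 [hk3 e3 q]]]; exists (k1 + k3).+1, s3; split=> //.
  by rewrite mulSn; lia.
apply: (@executes_prefix _ _ [:: c; CWhile b c] s1).
  by move=> bit K /=; rewrite bt.
move=> K w /steps_split [w1 [w2 [-> z1 z2]]].
by rewrite steps_cat /= e2 // e3.
Qed.

End Exec.

Definition iscalar (a : nat) : iexp := IGet a (IConst 0).
Definition rscalar (a : nat) : rexp := RGet a (IConst 0).
Definition rconst (k : nat) : rexp := ROfNat (IConst k).
Definition bilt (x y : iexp) : bexp := BNot (BILe y x).
Definition brlt (x y : rexp) : bexp := BNot (BRLe y x).
Definition btrue : bexp := BILe (IConst 0) (IConst 0).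
Definition iset0 (a : nat) (x : iexp) : cmd := CISet a (IConst 0) x.
Definition rset0 (a : nat) (x : rexp) : cmd := CRSet a (IConst 0) x.
Definition incr (a : nat) (x : iexp) : cmd := iset0 a (IAdd (iscalar a) x).
Definition CFor (i : nat) (bound : iexp) (body : cmd) : cmd :=
  CSeq (iset0 i (IConst 0))
    (CWhile (bilt (iscalar i) bound) (CSeq body (incr i (IConst 1)))).

(** * Rules for counting loops *)

Section Loops.
Variable R : realType.
Implicit Types (s : store R) (c : cmd) (Q : store R -> Prop).

(** An iteration adds a test, a sequencing step and the increment to the body; outside the
    iterations there are a sequencing step, the initialization and the final test. *)
Lemma runs_for s i bound body n k (Inv : nat -> store R -> Prop) :
  i \notin imods body ->
  (forall s1, keeps (CFor i bound body) s s1 -> ieval s1 bound = n) ->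
  Inv 0%N (iset s i 0 0) ->
  (forall j s1, (j < n)%N -> keeps (CFor i bound body) s s1 -> imem s1 i 0 = j ->
     Inv j s1 -> runs_to s1 body k (fun s2 => Inv j.+1 (iset s2 i 0 j.+1))) ->
  runs_to s (CFor i bound body) (n * (k + 3) + 3) (Inv n).
Proof.
move=> ib hb I0 IS.
have si : i \in imods (CFor i bound body) by rewrite /= mem_head.
set s0 := iset s i 0 0.
have k0 : keeps (CFor i bound body) s s0 by apply: same_off_iset.
pose J j s1 := imem s1 i 0 = j /\ Inv j s1.
have W : runs_to s0 (CWhile (bilt (iscalar i) bound) (CSeq body (incr i (IConst 1))))
   (n * (k + 2).+1).+1 (J n).
  apply: runs_while.
  - by split=> //; rewrite /s0 /= /upd !eqxx.
  - move=> j s1 jn ks [ij Ij].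
    have ks1 : keeps (CFor i bound body) s s1.
      apply: same_off_trans k0 _; apply: same_off_sub ks => // z.
      by rewrite /= !inE => ->; rewrite orbT.
    split; first by rewrite /= (hb _ ks1) ij -ltnNge.
    rewrite (_ : (k + 2 = (k + 1).+1)%N); last by lia.
    apply: runs_seq_keeps (IS j s1 jn ks1 ij Ij) _ => s2 I2 k2.
    apply: runs_iset; rewrite /= (k2.1 _ ib) ij addn1.
    by split=> //=; rewrite /upd !eqxx.
  move=> s1 ks [ij _].
  have ks1 : keeps (CFor i bound body) s s1.
    apply: same_off_trans k0 _; apply: same_off_sub ks => // z.
    by rewrite /= !inE => ->; rewrite orbT.
  by rewrite /= (hb _ ks1) ij leqnn.
rewrite (_ : (n * (k + 3) + 3 = (1 + (n * (k + 2).+1).+1).+1)%N); last by lia.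
apply: runs_seq; apply: runs_iset; apply: runs_post W => s' [].
by [].
Qed.

Definition CSumIf (i : nat) (bound : iexp) (x : nat) (b : bexp) (e : rexp) : cmd :=
  CSeq (rset0 x (rconst 0))
    (CFor i bound (CIf b (rset0 x (RAdd (rscalar x) e)) CSkip)).

Lemma runs_sum_if s i bound x b e n (g : pred nat) (F : nat -> R) :
  (forall s1, same_off [:: i] [:: x] s s1 -> ieval s1 bound = n) ->
  (forall j s1, (j < n)%N -> same_off [:: i] [:: x] s s1 -> imem s1 i 0 = j ->
     beval s1 b = g j /\ (g j -> reval s1 e = F j)) ->
  runs_to s (CSumIf i bound x b e) (n * 5 + 5)
    (fun s' => rmem s' x 0 = \sum_(0 <= j < n | g j) F j).
Proof.
move=> hb he.
have E s1 : keeps (CFor i bound (CIf b (rset0 x (RAdd (rscalar x) e)) CSkip))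
    (rset s x 0 0%:R) s1 -> same_off [:: i] [:: x] s s1.
  move=> h; apply: (@same_off_trans _ _ _ _ (rset s x 0 0%:R)).
    by apply: same_off_rset; rewrite mem_head.
  by apply: same_off_sub h => z; rewrite /= !inE ?orbb.
rewrite (_ : (n * 5 + 5 = (1 + (n * (2 + 3) + 3)).+1)%N); last by lia.
apply: runs_seq; apply: runs_rset.
apply: (runs_for (Inv := fun j s' => rmem s' x 0 = \sum_(0 <= l < j | g l) F l)) => //.
- by move=> s1 /E; exact: hb.
- by rewrite /= /upd !eqxx big_geq.
move=> j s1 jn /E ks ij I1; have [hg hF] := he j s1 jn ks ij.
rewrite big_mkcond big_nat_recr //= -big_mkcond.
apply: runs_if; rewrite hg => gj.
  by apply: runs_rset; rewrite /= /upd !eqxx /= I1 hF // gj.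
by apply: runs_skip => //; rewrite /= I1 (negbTE gj) addr0.
Qed.

Definition CMapR (i : nat) (bound : iexp) (a : nat) (w : iexp) (b : bexp) (e : rexp) : cmd :=
  CFor i bound (CIf b (CRSet a w e) CSkip).

(** Indices may repeat, as a vertex is visited once per half-edge. The written value therefore
    depends on the index only and must be computable after earlier writes to the array. *)
Lemma runs_mapR s i bound a w b e n (v : nat -> nat) (g : pred nat) (F : nat -> R) :
  (forall s1, same_off [:: i] [:: a] s s1 -> ieval s1 bound = n) ->
  (forall j s1, (j < n)%N -> same_off [:: i] [:: a] s s1 -> imem s1 i 0 = j ->
     [/\ ieval s1 w = v j, beval s1 b = g (v j) & g (v j) -> reval s1 e = F (v j)]) ->
  runs_to s (CMapR i bound a w b e) (n * 5 + 3)
    (fun s' => forall z, rmem s' a z =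
       if (z \in map v (iota 0 n)) && g z then F z else rmem s a z).
Proof.
move=> hb he.
have E s1 : keeps (CMapR i bound a w b e) s s1 -> same_off [:: i] [:: a] s s1.
  by move=> h; apply: same_off_sub h => z; rewrite /= !inE ?orbb.
rewrite (_ : (n * 5 + 3 = n * (2 + 3) + 3)%N) //.
apply: (runs_for (Inv := fun j s' => forall z, rmem s' a z =
       if (z \in map v (iota 0 j)) && g z then F z else rmem s a z)) => //.
- by move=> s1 /E; exact: hb.
move=> j s1 jn /E ks ij I1; have [hw hg hF] := he j s1 jn ks ij.
have mE z : (z \in map v (iota 0 j.+1)) = (z \in map v (iota 0 j)) || (z == v j).
  by rewrite -addn1 iotaD map_cat mem_cat /= !inE add0n.
apply: runs_if; rewrite hg => gj.
  apply: runs_rset => z; rewrite /= /upd eqxx hw mE /=.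
  by case: eqP => [->|_]; rewrite ?orbT ?orbF ?gj ?hF // I1.
apply: runs_skip => // z; rewrite mE /= I1.
by case: eqP => [->|_]; rewrite ?orbT ?orbF // (negbTE gj) andbF.
Qed.

Definition CMapI (i : nat) (bound : iexp) (a : nat) (w : iexp) (b : bexp) (e : iexp) : cmd :=
  CFor i bound (CIf b (CISet a w e) CSkip).

Lemma runs_mapI s i bound a w b e n (v : nat -> nat) (g : pred nat) (F : nat -> nat) :
  i != a ->
  (forall s1, same_off [:: i; a] [::] s s1 -> ieval s1 bound = n) ->
  (forall j s1, (j < n)%N -> same_off [:: i; a] [::] s s1 -> imem s1 i 0 = j ->
     [/\ ieval s1 w = v j, beval s1 b = g (v j) & g (v j) -> ieval s1 e = F (v j)]) ->
  runs_to s (CMapI i bound a w b e) (n * 5 + 3)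
    (fun s' => forall z, imem s' a z =
       if (z \in map v (iota 0 n)) && g z then F z else imem s a z).
Proof.
move=> ia hb he; have ai : (a == i) = false by rewrite eq_sym; exact: negbTE.
have E s1 : keeps (CMapI i bound a w b e) s s1 -> same_off [:: i; a] [::] s s1.
  move=> h; apply: same_off_sub h => z //=.
  by rewrite !inE; case: (z == i); case: (z == a).
rewrite (_ : (n * 5 + 3 = n * (2 + 3) + 3)%N) //.
apply: (runs_for (Inv := fun j s' => forall z, imem s' a z =
       if (z \in map v (iota 0 j)) && g z then F z else imem s a z)) => //.
- by rewrite /= inE.
- by move=> s1 /E; exact: hb.
- by move=> z; rewrite /= /upd ai.
move=> j s1 jn /E ks ij I1; have [hw hg hF] := he j s1 jn ks ij.
have mE z : (z \in map v (iota 0 j.+1)) = (z \in map v (iota 0 j)) || (z == v j).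
  by rewrite -addn1 iotaD map_cat mem_cat /= !inE add0n.
apply: runs_if; rewrite hg => gj.
  apply: runs_iset => z; rewrite /= /upd ai /= eqxx hw mE /=.
  by case: eqP => [->|_]; rewrite ?orbT ?orbF ?gj ?hF // I1.
apply: runs_skip => // z; rewrite mE /= /upd ai /= I1.
by case: eqP => [->|_]; rewrite ?orbT ?orbF // (negbTE gj) andbF.
Qed.

End Loops.

(** * The program *)

(* Integer arrays: 4 indicator of A, 5 random bits, 6 degrees, 7 number of rounds
   of the current epoch survived by a vertex (so that A_(i+1) = {v | i < 7[v]}),
   10 half-edges, 11 their number, 12 T, 13 log m, 15 number of epochs, 16-18
   number of bits and flip counter, 20-24 loop counters, 25 position in the
   random bits, 26 and 28 counts.
   Real arrays: 1 walk, 2 scratch and centered projection, 3 kap, 4 eps,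
   5 freezing threshold, 6-11 vol A, sum, mean, deviation, center and square sum
   of the projection, 12 last sparse threshold, 13 threshold, 14 its border,
   15 its volume. *)
Definition vertex : iexp := IGet 10 (iscalar 20).
Definition end1 : iexp := IGet 1 (iscalar 20).
Definition end2 : iexp := IGet 2 (iscalar 20).
Definition two_m : iexp := iscalar 11.
Definition num_edges : iexp := IGet 0 (IConst 1).
Definition alive (x : iexp) : bexp := bilt (IConst 0) (IGet 4 x).
Definition bxor (b c : bexp) : bexp := BNot (BAnd (BNot (BAnd b (BNot c))) (BNot (BAnd (BNot b) c))).
Definition rsqr (x : rexp) : rexp := RMul x x.

(** The sign 2 bit - 1 is formed in the reals, because integer subtraction truncates at 0. A vertex
    accumulates one sign per half-edge. *)
Definition start_cmd : cmd :=
  let bit := IGet 5 (IAdd (iscalar 25) (iscalar 20)) in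
  CSeq (CMapR 20 two_m 1 vertex btrue (rconst 0))
  (CSeq (CFor 20 two_m (CRSet 1 vertex (RAdd (RGet 1 vertex)
    (RDiv (RSub (ROfNat (IAdd bit bit)) (rconst 1)) (ROfNat (IGet 6 vertex))))))
  (incr 25 two_m)).

Definition push (x y : iexp) : cmd :=
  CRSet 2 x (RAdd (RGet 2 x)
    (RDiv (RSub (RGet 1 y) (RGet 1 x)) (RMul (rconst 2) (ROfNat (IGet 6 x))))).

(** All edges read the old values in array 1 and accumulate into array 2, which makes the update
    simultaneous. *)
Definition mix_cmd : cmd :=
  CSeq (CMapR 20 two_m 2 vertex btrue (RGet 1 vertex))
  (CSeq (CFor 20 num_edges
    (CIf (BAnd (bilt (iscalar 21) (IGet 7 end1)) (bilt (iscalar 21) (IGet 7 end2)))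
       (CSeq (push end1 end2) (push end2 end1)) CSkip))
  (CMapR 20 two_m 1 vertex btrue (RGet 2 vertex))).

Definition walk_cmd : cmd := CFor 21 (iscalar 22) mix_cmd.

Definition part_cmd : cmd :=
  CSeq (CSumIf 20 two_m 6 (alive vertex) (rconst 1))
  (CSeq (CSumIf 20 two_m 7 (alive vertex) (RGet 1 vertex))
  (CSeq (rset0 8 (RDiv (rscalar 7) (rscalar 6)))
  (CSeq (CSumIf 20 two_m 9 (BAnd (alive vertex) (BRLe (rscalar 8) (RGet 1 vertex)))
           (RSub (RGet 1 vertex) (rscalar 8)))
  (CSeq (rset0 10 (RAdd (rscalar 8)
           (RMul (RDiv (rconst 4) (rconst 3)) (RDiv (rscalar 9) (rscalar 6)))))
  (CSeq (CMapR 20 two_m 2 vertex btrue (rconst 0))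
  (CSeq (CMapR 20 two_m 2 vertex
           (BAnd (alive vertex) (BRLe (rscalar 10) (RGet 1 vertex)))
           (RSub (RGet 1 vertex) (rscalar 10)))
  (CSumIf 20 two_m 11 btrue (rsqr (RGet 2 vertex))))))))).

Definition in_level (a : nat) (x : iexp) : bexp :=
  BAnd (brlt (rconst 0) (RGet 2 x)) (BRLe (rscalar a) (rsqr (RGet 2 x))).

Definition level_cmd : cmd :=
  CSeq (CSumIf 20 two_m 15 (in_level 13 vertex) (rconst 1))
  (CSeq (CSumIf 20 num_edges 14
     (BAnd (BAnd (alive end1) (alive end2)) (bxor (in_level 13 end1) (in_level 13 end2)))
     (rconst 1))
  (CSeq (CIf (BRLe (rsqr (rscalar 14)) (RMul (rscalar 3) (rsqr (rscalar 15))))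
     (rset0 12 (rscalar 13)) CSkip)
  (rset0 13 (RMul (rscalar 13) (RSub (rconst 1) (rscalar 4)))))).

Definition sweep_cmd : cmd :=
  CSeq (rset0 12 (RAdd (rscalar 11) (rconst 1)))
  (CSeq (rset0 13 (rscalar 11)) (CFor 24 (iscalar 12) level_cmd)).

Definition shrink_cmd : cmd :=
  CIf (BRLe (rscalar 5) (rsqr (RSub (ROfNat two_m) (rscalar 6)))) CSkip
    (CMapI 20 two_m 4 vertex (in_level 12 vertex) (IConst 0)).

Definition round_cmd : cmd :=
  CSeq start_cmd (CSeq walk_cmd (CSeq part_cmd (CSeq sweep_cmd (CSeq shrink_cmd
    (CMapI 20 two_m 7 vertex (alive vertex) (IAdd (iscalar 22) (IConst 1))))))).

Definition epoch_cmd : cmd :=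
  CSeq (CMapI 20 two_m 7 vertex btrue (IConst 0)) (CFor 22 (iscalar 12) round_cmd).

Definition epochs_cmd : cmd := CFor 23 (iscalar 15) epoch_cmd.

(** * Verification of the walk commands *)

Section Verify.
Variables (R : realType) (es : seq (nat * nat)) (kap eps bet : R) (T L : nat) (w : seq bool).
Implicit Types (s : store R) (A : nat -> bool) (As : seq (nat -> bool)).

Local Notation hs := (half_edges es).
Local Notation m := (size es).
Local Notation N := (size hs).

Record globals s : Prop := Globals {
  g_m : imem s 0 1 = m;
  g_end1 : forall i, (i < m)%N -> imem s 1 i = (nth (0, 0)%N es i).1;
  g_end2 : forall i, (i < m)%N -> imem s 2 i = (nth (0, 0)%N es i).2;
  g_vertex : forall h, (h < N)%N -> imem s 10 h = nth 0%N hs h;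
  g_two_m : imem s 11 0 = N;
  g_deg : forall v, imem s 6 v = deg es v;
  g_bits : forall i, imem s 5 i = nat_of_bool (nth false w i);
  g_T : imem s 12 0 = T;
  g_L : imem s 15 0 = L;
  g_kap : rmem s 3 0 = kap;
  g_eps : rmem s 4 0 = eps;
  g_bet : rmem s 5 0 = bet
}.

Lemma globals_off I J s s' : same_off I J s s' ->
  all (fun a => a \notin I) [:: 0; 1; 2; 10; 11; 6; 5; 12; 15]%N ->
  all (fun a => a \notin J) [:: 3; 4; 5]%N -> globals s -> globals s'.
Proof.
move=> [hi hr] /and5P [i0 i1 i2 i3 /and5P [i4 i5 i6 i7 /andP [i8 _]]].
move=> /and4P [r0 r1 r2 _] [h1 h2 h3 h4 h5 h6 h7 h8 h9 h10 h11 h12].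
by split; rewrite ?(hi _ i0) ?(hi _ i1) ?(hi _ i2) ?(hi _ i3) ?(hi _ i4) ?(hi _ i5)
  ?(hi _ i6) ?(hi _ i7) ?(hi _ i8) ?(hr _ r0) ?(hr _ r1) ?(hr _ r2).
Qed.

Lemma map_nth_half_edges z : (z \in map (nth 0%N hs) (iota 0 N)) = (z \in hs).
Proof. by have := mkseq_nth 0%N hs; rewrite /mkseq => ->. Qed.

Lemma vsum_nth (g : pred nat) (F : nat -> R) :
  \sum_(0 <= j < N | g (nth 0%N hs j)) F (nth 0%N hs j) = vsum es g F.
Proof. by rewrite /vsum [RHS](big_nth 0%N). Qed.

Lemma alive_eval s x : beval s (alive x) = (imem s 4 (ieval s x) != 0%N).
Proof. by rewrite /= -ltnNge lt0n. Qed.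

Lemma runs_mapR_vertex s a b e (g : pred nat) (F : nat -> R) :
  globals s ->
  (forall s1, same_off [:: 20]%N [:: a] s s1 -> ieval s1 vertex \in hs ->
     beval s1 b = g (ieval s1 vertex) /\
     (g (ieval s1 vertex) -> reval s1 e = F (ieval s1 vertex))) ->
  runs_to s (CMapR 20 two_m a vertex b e) (N * 5 + 3)
    (fun s' => forall z, rmem s' a z = if (z \in hs) && g z then F z else rmem s a z).
Proof.
move=> G h; have HG s1 : same_off [:: 20]%N [:: a] s s1 ->
    imem s1 11 = imem s 11 /\ imem s1 10 = imem s 10.
  by move=> k; rewrite (k.1 11%N isT) (k.1 10%N isT).
apply: runs_post (runs_mapR (v := nth 0%N hs) (g := g) (F := F) _ _).
- by move=> s' H z; rewrite H map_nth_half_edges.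
- by move=> s1 /HG [e11 _]; rewrite /= e11 (g_two_m G).
move=> j s1 jN k ij; have [_ e10] := HG _ k.
have vE : ieval s1 vertex = nth 0%N hs j by rewrite /= e10 ij (g_vertex G).
by have := h s1 k; rewrite vE mem_nth // => /(_ isT) [].
Qed.

Lemma runs_mapI_vertex s a b e (g : pred nat) (F : nat -> nat) :
  (a != 20)%N && (a != 10)%N && (a != 11)%N -> globals s ->
  (forall s1, same_off [:: 20; a]%N [::] s s1 -> ieval s1 vertex \in hs ->
     beval s1 b = g (ieval s1 vertex) /\
     (g (ieval s1 vertex) -> ieval s1 e = F (ieval s1 vertex))) ->
  runs_to s (CMapI 20 two_m a vertex b e) (N * 5 + 3)
    (fun s' => forall z, imem s' a z = if (z \in hs) && g z then F z else imem s a z).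
Proof.
move=> /andP [/andP [a20 a10] a11] G h; have HG s1 : same_off [:: 20; a]%N [::] s s1 ->
    imem s1 11 = imem s 11 /\ imem s1 10 = imem s 10.
  by move=> k; rewrite !k.1 // !inE /= eq_sym.
apply: runs_post (runs_mapI (v := nth 0%N hs) (g := g) (F := F) _ _ _).
- by move=> s' H z; rewrite H map_nth_half_edges.
- by rewrite eq_sym.
- by move=> s1 /HG [e11 _]; rewrite /= e11 (g_two_m G).
move=> j s1 jN k ij; have [_ e10] := HG _ k.
have vE : ieval s1 vertex = nth 0%N hs j by rewrite /= e10 ij (g_vertex G).
by have := h s1 k; rewrite vE mem_nth // => /(_ isT) [].
Qed.

Lemma runs_sum_vertex s x b e (g : pred nat) (F : nat -> R) :
  globals s ->
  (forall s1, same_off [:: 20]%N [:: x] s s1 -> ieval s1 vertex \in hs ->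
     beval s1 b = g (ieval s1 vertex) /\
     (g (ieval s1 vertex) -> reval s1 e = F (ieval s1 vertex))) ->
  runs_to s (CSumIf 20 two_m x b e) (N * 5 + 5) (fun s' => rmem s' x 0 = vsum es g F).
Proof.
move=> G h; have HG s1 : same_off [:: 20]%N [:: x] s s1 ->
    imem s1 11 = imem s 11 /\ imem s1 10 = imem s 10.
  by move=> k; rewrite (k.1 11%N isT) (k.1 10%N isT).
apply: runs_post (runs_sum_if (g := fun j => g (nth 0%N hs j)) (F := fun j => F (nth 0%N hs j)) _ _).
- by move=> s' ->; rewrite vsum_nth.
- by move=> s1 /HG [e11 _]; rewrite /= e11 (g_two_m G).
move=> j s1 jN k ij; have [_ e10] := HG _ k.
have vE : ieval s1 vertex = nth 0%N hs j by rewrite /= e10 ij (g_vertex G).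
by have := h s1 k; rewrite vE mem_nth // => /(_ isT) [].
Qed.

Lemma runs_start s base : globals s -> imem s 25 0 = base -> (base + N <= size w)%N ->
  runs_to s start_cmd (N * 9 + 9) (fun s' => imem s' 25 0 = (base + N)%N /\
    {in hs, forall v, rmem s' 1 v = start_sum R es 0%N (take N (drop base w)) v}).
Proof.
move=> G bE bw; rewrite (_ : (N * 9 + 9 = ((N * 5 + 3) + ((N * (1 + 3) + 3) + 1).+1).+1)%N); last by lia.
apply: runs_seq_keeps (runs_mapR_vertex (g := xpredT) (F := fun=> 0) G _) _ => // s1 z1 k1.
have G1 : globals s1 by apply: globals_off k1 _ _ G.
have b1 : imem s1 25 = imem s 25 by rewrite (k1.1 25%N isT).
pose F h v : R := start R es 0%N h v * sign_of R (nth false (take N (drop base w)) h).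
apply: runs_seq_keeps; first apply: (runs_for (n := N)
   (Inv := fun j s' => {in hs, forall v, rmem s' 1 v = \sum_(0 <= h < j) F h v})) => //.
- by move=> s2 k2; rewrite /= (k2.1 11%N isT) (g_two_m G1).
- by move=> v vh; rewrite /= z1 vh big_geq.
- move=> j s2 jN k2 ij I2; apply: runs_rset => v vh.
  have G2 : globals s2 by apply: globals_off k2 _ _ G1.
  rewrite big_nat_recr //= ij (g_vertex G2 jN) /upd eqxx /=.
  rewrite /F /start eq_sym; case: eqP => [<-|_]; last by rewrite !mul0r addr0 I2.
  rewrite I2 ?mem_nth // (g_deg G2) !(g_bits G2) (k2.1 25%N isT) b1 bE; congr (_ + _).
  rewrite nth_take // nth_drop mulrC mul1r; congr (_ * _).
  by case: (nth _ _ _) => /=; lra.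
move=> s2 I2 k2; apply: runs_iset; rewrite /= /upd !eqxx /=.
rewrite (k2.1 25%N isT) b1 bE (k2.1 11%N isT) (g_two_m G1); split=> // v vh.
have sz : size (take N (drop base w)) = N.
  by rewrite size_takel // size_drop leq_subRL ?(leq_trans _ bw) ?leq_addr.
by rewrite I2 // /start_sum /lin sz.
Qed.

Lemma runs_mix s (x : nat -> R) A : globals s ->
  {in hs, forall v, rmem s 1 v = x v} ->
  {in hs, forall v, (imem s 21 0 < imem s 7 v)%N = A v} ->
  runs_to s mix_cmd (N * 10 + m * 7 + 11) (fun s' => {in hs, forall v, rmem s' 1 v = mix es A x v}).
Proof.
move=> G xE AE.
rewrite (_ : (N * 10 + m * 7 + 11 = ((N * 5 + 3) + ((m * (4 + 3) + 3) + (N * 5 + 3)).+1).+1)%N); last by lia.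
apply: runs_seq_keeps (runs_mapR_vertex (g := xpredT) (F := x) G _) _.
  by move=> s1 k vh; split=> // _; rewrite -xE //= (k.2 1%N isT).
move=> s1 y1 k1; have G1 : globals s1 by apply: globals_off k1 _ _ G.
have x1 v : v \in hs -> rmem s1 1 v = x v by move=> vh; rewrite (k1.2 1%N isT) xE.
pose g i := A (nth (0, 0)%N es i).1 && A (nth (0, 0)%N es i).2.
have hE i : (i < m)%N -> (nth (0, 0)%N es i).1 \in hs /\ (nth (0, 0)%N es i).2 \in hs.
  by move=> im; have /andP := mem_half_edges (mem_nth (0, 0)%N im).
apply: runs_seq_keeps; first apply: (runs_for (n := m)
   (Inv := fun j s' => {in hs, forall v, rmem s' 2 v = x v +
      \sum_(0 <= i < j | g i) gain x v (nth (0, 0)%N es i) / (2 * (deg es v)%:R)})) => //.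
- by move=> s2 k2; rewrite /= (k2.1 0%N isT) (g_m G1).
- by move=> v vh; rewrite /= y1 vh big_geq // addr0.
- move=> j s2 jm k2 ij I2; have G2 : globals s2 by apply: globals_off k2 _ _ G1.
  have [h1 h2] := hE _ jm.
  have x2 v : v \in hs -> rmem s2 1 v = x v by move=> vh; rewrite (k2.2 1%N isT) x1.
  have gE : beval s2 (BAnd (bilt (iscalar 21) (IGet 7 end1)) (bilt (iscalar 21) (IGet 7 end2))) = g j.
    rewrite /= ij (g_end1 G2 jm) (g_end2 G2 jm) -!ltnNge (k2.1 21%N isT) (k2.1 7%N isT).
    by rewrite (k1.1 21%N isT) (k1.1 7%N isT) !AE.
  apply: runs_if; rewrite gE => gj.
    rewrite (_ : 3%N = (1 + 1).+1) //; apply: runs_seq; do 2!apply: runs_rset.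
    move=> v vh; rewrite /= !ij (g_end1 G2 jm) (g_end2 G2 jm) /upd /=.
    rewrite big_mkcond big_nat_recr //= -big_mkcond gj addrA -I2 // !(g_deg G2) !x2 // /gain.
    move: (nth _ _ _).1 (nth _ _ _).2 => a b.
    rewrite (eq_sym a v) (eq_sym b v); case: (v =P b) => [->|_].
      case: (b =P a) => [->|_]; rewrite ?eqxx !mul1r ?mul0r ?add0r //.
      by rewrite !subrr !addr0 !mul0r !addr0.
    by case: (v =P a) => [->|_]; rewrite ?mul1r !mul0r ?addr0 // mul0r addr0.
  apply: runs_skip => // v vh /=.
  by rewrite big_mkcond big_nat_recr //= -big_mkcond (negbTE gj) addr0 I2.
move=> s2 I2 k2; have G2 : globals s2 by apply: globals_off k2 _ _ G1.
apply: runs_post (runs_mapR_vertex (g := xpredT) (F := rmem s2 2) G2 _).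
  move=> s' H v vh; rewrite H vh /= I2 // /mix; congr (_ + _).
  by rewrite mulr_suml [RHS](big_nth (0, 0)%N).
by move=> s3 k3 _; rewrite /= (k3.2 2%N isT).
Qed.

Lemma runs_walk s (x : nat -> R) As : globals s ->
  {in hs, forall v, rmem s 1 v = x v} -> imem s 22 0 = size As ->
  {in hs, forall v i, (i < size As)%N -> (i < imem s 7 v)%N = nth xpred0 As i v} ->
  runs_to s walk_cmd (size As * ((N * 10 + m * 7 + 11) + 3) + 3)
    (fun s' => {in hs, forall v, rmem s' 1 v = walk es x As v}).
Proof.
move=> G xE tE dE.
apply: runs_post (runs_for (n := size As)
   (Inv := fun j s' => {in hs, forall v, rmem s' 1 v = walk es x (take j As) v}) _ _ _ _) => //.
- by move=> s' H v vh; rewrite H // take_size.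
- by move=> s1 k; rewrite /= (k.1 22%N isT).
- by move=> v vh; rewrite /= take0 /= xE.
move=> j s1 jA k ij I1; have G1 : globals s1 by apply: globals_off k _ _ G.
apply: runs_post (runs_mix G1 I1 (A := nth xpred0 As j) _).
  by move=> s' H v vh /=; rewrite H // (take_nth xpred0 jA) walk_rcons.
by move=> v vh; rewrite ij (k.1 7%N isT) dE.
Qed.

End Verify.

Section VerifyRound.
Variables (R : realType) (es : seq (nat * nat)) (kap eps bet : R) (T L : nat) (w : seq bool).
Implicit Types (s : store R) (A : nat -> bool) (As : seq (nat -> bool)) (u : nat -> R).

Local Notation hs := (half_edges es).
Local Notation m := (size es).
Local Notation N := (size hs).
Local Notation globals := (globals es kap eps bet T L w).

(** Isolated vertices count as not alive and so end up on the complementary side of a returned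
    cut. *)
Definition alive_is s A : Prop := forall v, (imem s 4 v != 0%N) = (v \in hs) && A v.

Lemma alive_in s A : alive_is s A -> {in hs, forall v, (imem s 4 v != 0%N) = A v}.
Proof. by move=> h v vh; rewrite h vh. Qed.

Lemma runs_part s A u : globals s -> alive_is s A ->
  {in hs, forall v, rmem s 1 v = u v} ->
  runs_to s part_cmd (N * 30 + 35) (fun s' => [/\ {in hs, forall v, rmem s' 2 v = part es A u v},
    rmem s' 6 0 = volR R es A & rmem s' 11 0 = sqsum es (part es A u)]).
Proof.
move=> G /alive_in aA uE.
rewrite (_ : (N * 30 + 35 = ((N * 5 + 5) + ((N * 5 + 5) + (1 + ((N * 5 + 5) + (1 + ((N * 5 + 3) +
   ((N * 5 + 3) + (N * 5 + 5)).+1).+1).+1).+1).+1).+1).+1)%N); last by lia.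
apply: runs_seq_keeps (runs_sum_vertex (g := A) (F := fun=> 1) G _) _.
  by move=> s1 k vh; rewrite alive_eval (k.1 4%N isT) aA.
move=> s1 W1 k1; have G1 : globals s1 by apply: globals_off k1 _ _ G.
apply: runs_seq_keeps (runs_sum_vertex (g := A) (F := u) G1 _) _.
  move=> s2 k vh; rewrite alive_eval (k.1 4%N isT) (k1.1 4%N isT) aA //.
  by split=> // _; rewrite /= (k.2 1%N isT) (k1.2 1%N isT) uE.
move=> s2 S2 k2; have G2 : globals s2 by apply: globals_off k2 _ _ G1.
apply: runs_seq_keeps (runs_rset (Q := fun s' => rmem s' 8 0 = mean es A u) _) _.
  by rewrite /= /upd !eqxx /= S2 (k2.2 6%N isT) W1.
move=> s3 M3 k3; have G3 : globals s3 by apply: globals_off k3 _ _ G2.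
have a3 : imem s3 4 = imem s 4 by rewrite (k3.1 4%N isT) (k2.1 4%N isT) (k1.1 4%N isT).
have u3 : rmem s3 1 = rmem s 1 by rewrite (k3.2 1%N isT) (k2.2 1%N isT) (k1.2 1%N isT).
apply: runs_seq_keeps (runs_sum_vertex (g := fun v => A v && (mean es A u <= u v))
  (F := fun v => u v - mean es A u) G3 _) _.
  move=> s4 k vh; split; last first.
    by move=> _; rewrite /= (k.2 1%N isT) (k.2 8%N isT) M3 u3 uE.
  by rewrite -[RHS]andbC /= -ltnNge lt0n (k.1 4%N isT) a3 (k.2 1%N isT) (k.2 8%N isT) M3 u3 uE // aA // andbC.
move=> s4 S4 k4; have G4 : globals s4 by apply: globals_off k4 _ _ G3.
apply: runs_seq_keeps (runs_rset (Q := fun s' => rmem s' 10 0 = center es A u) _) _.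
  rewrite /= /upd !eqxx /= S4 (k4.2 8%N isT) M3 (k4.2 6%N isT) (k3.2 6%N isT) (k2.2 6%N isT) W1.
  by [].
move=> s5 C5 k5; have G5 : globals s5 by apply: globals_off k5 _ _ G4.
apply: runs_seq_keeps (runs_mapR_vertex (g := xpredT) (F := fun=> 0) G5 _) _ => //.
move=> s6 z6 k6; have G6 : globals s6 by apply: globals_off k6 _ _ G5.
have a6 : imem s6 4 = imem s 4 by rewrite (k6.1 4%N isT) (k5.1 4%N isT) (k4.1 4%N isT).
have u6 : rmem s6 1 = rmem s 1 by rewrite (k6.2 1%N isT) (k5.2 1%N isT) (k4.2 1%N isT).
have c6 : rmem s6 10 0 = center es A u by rewrite (k6.2 10%N isT).
apply: runs_seq_keeps (runs_mapR_vertex (g := fun v => A v && (center es A u <= u v))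
  (F := fun v => u v - center es A u) G6 _) _.
  move=> s7 k vh; split; last first.
    by move=> _; rewrite /= (k.2 1%N isT) (k.2 10%N isT) c6 u6 uE.
  by rewrite /= -ltnNge lt0n (k.1 4%N isT) a6 (k.2 1%N isT) (k.2 10%N isT) c6 u6 uE // aA.
move=> s7 y7 k7; have G7 : globals s7 by apply: globals_off k7 _ _ G6.
have yE : {in hs, forall v, rmem s7 2 v = part es A u v}.
  by move=> v vh; rewrite y7 z6 vh.
apply: runs_weaken (runs_keeps (runs_sum_vertex (g := xpredT)
   (F := fun v => part es A u v ^+ 2) G7 _)); first by lia.
  move=> s8 [U8 k8]; split.
  - by move=> v vh; rewrite (k8.2 2%N isT) yE.
  - by rewrite (k8.2 6%N isT) (k7.2 6%N isT) (k6.2 6%N isT) (k5.2 6%N isT) (k4.2 6%N isT)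
      (k3.2 6%N isT) (k2.2 6%N isT) W1.
  by rewrite U8.
by move=> s8 k vh; split=> // _; rewrite /= (k.2 2%N isT) yE // expr2.
Qed.

Lemma bxor_eval s b c : beval s (bxor b c) = beval s b (+) beval s c.
Proof. by rewrite /=; case: (beval s b); case: (beval s c). Qed.

Lemma in_level_eval s a x : beval s (in_level a x) =
  above (rmem s 2) (rmem s a 0) (ieval s x).
Proof. by rewrite /= -ltNge /above expr2. Qed.

Lemma runs_level s A y tau : globals s -> alive_is s A ->
  {in hs, forall v, rmem s 2 v = y v} -> rmem s 13 0 = tau ->
  runs_to s level_cmd (N * 5 + m * 5 + 16) (fun s' => rmem s' 13 0 = tau * (1 - eps) /\
    rmem s' 12 0 = if sparse es kap A (above y tau) then tau else rmem s 12 0).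
Proof.
move=> G /alive_in aA yE tE.
rewrite (_ : (N * 5 + m * 5 + 16 = ((N * 5 + 5) + ((m * 5 + 5) + (2 + 1).+1).+1).+1)%N); last by lia.
have ab s1 v : rmem s1 2 = rmem s 2 -> v \in hs -> above (rmem s1 2) tau v = above y tau v.
  by move=> -> vh; rewrite /above yE.
apply: runs_seq_keeps (runs_sum_vertex (g := above y tau) (F := fun=> 1) G _) _.
  move=> s1 k vh; rewrite in_level_eval (k.2 13%N isT) tE ab //.
  by rewrite (k.2 2%N isT).
move=> s1 V1 k1; have G1 : globals s1 by apply: globals_off k1 _ _ G.
apply: runs_seq_keeps; first apply: (runs_sum_if (n := m) (F := fun=> 1)
  (g := fun j => let p := nth (0, 0)%N es j in
     [&& A p.1, A p.2 & above y tau p.1 (+) above y tau p.2])) => //.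
- by move=> s2 k; rewrite /= (k.1 0%N isT) (g_m G1).
- move=> j s2 jm k ij; have G2 : globals s2 by apply: globals_off k _ _ G1.
  have /andP [h1 h2] := mem_half_edges (mem_nth (0, 0)%N jm).
  split=> //.
  rewrite -[beval _ _]/((beval s2 (alive end1) && beval s2 (alive end2)) &&
    beval s2 (bxor (in_level 13 end1) (in_level 13 end2))).
  rewrite bxor_eval !alive_eval !in_level_eval /= !ij (g_end1 G2 jm) (g_end2 G2 jm).
  rewrite (k.1 4%N isT) (k1.1 4%N isT) !aA // (k.2 13%N isT) (k1.2 13%N isT) tE.
  by rewrite !ab ?(k.2 2%N isT) ?(k1.2 2%N isT) // andbA.
move=> s2 C2 k2; have G2 : globals s2 by apply: globals_off k2 _ _ G1.
have CE : rmem s2 14 0 = (cut_in es A (above y tau))%:R.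
  rewrite C2 /cut_in -sum1_count natr_sum [RHS](big_nth (0, 0)%N) //.
have VE : rmem s2 15 0 = volR R es (above y tau) by rewrite (k2.2 15%N isT) V1.
have t2 : rmem s2 13 0 = tau by rewrite (k2.2 13%N isT) (k1.2 13%N isT) tE.
apply: runs_seq_keeps (runs_if (k := 1%N) (Q := fun s' => rmem s' 12 0 =
    if sparse es kap A (above y tau) then tau else rmem s 12 0) _ _) _.
- rewrite /= CE VE (g_kap G2) => sp; apply: runs_rset.
  by rewrite /= /upd !eqxx /= /sparse sp.
- rewrite /= CE VE (g_kap G2) => sp; apply: runs_skip => //.
  by rewrite /sparse (negbTE sp) (k2.2 12%N isT) (k1.2 12%N isT).
move=> s3 B3 k3; apply: runs_rset; rewrite /= /upd !eqxx /=; split=> //.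
by rewrite (k3.2 13%N isT) t2 (k3.2 4%N isT) (g_eps G2).
Qed.

Lemma runs_sweep s A y : globals s -> alive_is s A ->
  {in hs, forall v, rmem s 2 v = y v} -> rmem s 11 0 = sqsum es y ->
  runs_to s sweep_cmd (T * ((N * 5 + m * 5 + 16) + 3) + 7) (fun s' =>
     rmem s' 12 0 = best_upto es kap eps A y T).
Proof.
move=> G aA yE UE.
rewrite (_ : (T * (N * 5 + m * 5 + 16 + 3) + 7 =
  (1 + (1 + (T * (N * 5 + m * 5 + 16 + 3) + 3)).+1).+1)%N); last by lia.
apply: runs_seq_keeps (runs_rset (Q := fun s' => rmem s' 12 0 = sqsum es y + 1) _) _.
  by rewrite /= /upd !eqxx /= UE.
move=> s1 b1 k1; have G1 : globals s1 by apply: globals_off k1 _ _ G.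
apply: runs_seq_keeps (runs_rset (Q := fun s' => rmem s' 13 0 = level es eps y 0) _) _.
  by rewrite /= /upd !eqxx /= /level expr0 mulr1 (k1.2 11%N isT) UE.
move=> s2 t2 k2; have G2 : globals s2 by apply: globals_off k2 _ _ G1.
apply: runs_post (runs_for (n := T) (Inv := fun j s' =>
   rmem s' 13 0 = level es eps y j /\ rmem s' 12 0 = best_upto es kap eps A y j) _ _ _ _).
- by move=> s' [].
- by [].
- by move=> s3 k; rewrite /= (k.1 12%N isT) (g_T G2).
- by split; rewrite /= ?t2 // (k2.2 12%N isT) b1.
move=> j s3 jT k3 ij [t3 b3]; have G3 : globals s3 by apply: globals_off k3 _ _ G2.
apply: runs_post (runs_level (A := A) (y := y) G3 _ _ t3).
- move=> s4 [t4 b4]; split; rewrite /=; first by rewrite t4 /level exprSr mulrA.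
  by rewrite b4 best_uptoS b3.
- by move=> v; rewrite (k3.1 4%N isT) (k2.1 4%N isT) (k1.1 4%N isT) aA.
by move=> v vh; rewrite (k3.2 2%N isT) (k2.2 2%N isT) (k1.2 2%N isT) yE.
Qed.

Lemma runs_shrink s A u : globals s -> alive_is s A ->
  {in hs, forall v, rmem s 2 v = part es A u v} -> rmem s 6 0 = volR R es A ->
  rmem s 12 0 = best_upto es kap eps A (part es A u) T ->
  runs_to s shrink_cmd (N * 5 + 4) (fun s' => alive_is s' (shrink es kap eps bet T A u)).
Proof.
move=> G aA yE WE bE; rewrite (_ : (N * 5 + 4 = (N * 5 + 3).+1)%N); last by lia.
have frE : beval s (BRLe (rscalar 5) (rsqr (RSub (ROfNat two_m) (rscalar 6)))) =
    frozen es bet A.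
  by rewrite /= (g_bet G) (g_two_m G) WE /frozen size_half_edges -mul2n natrM.
apply: runs_if; rewrite frE => fr.
  apply: runs_skip; first by rewrite addn3.
  by rewrite /shrink fr.
apply: runs_post (runs_mapI_vertex (g := removed es kap eps T A u) (F := fun=> 0%N) _ G _) => //.
  move=> s' H v; rewrite H /shrink (negbTE fr); have := aA v.
  by case: (v \in hs) => /=; case: (removed es kap eps T A u v); rewrite /= ?andbF ?andbT.
move=> s1 k vh; split=> //; rewrite in_level_eval (k.2 2%N isT) (k.2 12%N isT) bE.
by rewrite /removed /sweep_set /above yE.
Qed.

(** The sets of an epoch are nested, so the single counter 7[v] encodes membership in all of them.
    The last two clauses keep this encoding extendable: no counter is ahead, and a current vertex
    belonged to every earlier set. *)
Definition link s (st : (nat -> bool) * seq (nat -> bool)) : Prop :=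
  [/\ alive_is s st.1,
      {in hs, forall v i, (i < size st.2)%N -> (i < imem s 7 v)%N = nth xpred0 st.2 i v}
    , {in hs, forall v, imem s 7 v <= size st.2}%N
    & {in hs, forall v, st.1 v -> forall i, (i < size st.2)%N -> nth xpred0 st.2 i v}].

Definition round_cost : nat :=
  N * 9 + 9 + (T * (N * 10 + m * 7 + 14) + 3) + (N * 30 + 35) +
  (T * (N * 5 + m * 5 + 19) + 7) + (N * 5 + 4) + (N * 5 + 3) + 5.

Lemma runs_round s st base : globals s -> link s st ->
  imem s 22 0 = size st.2 -> (size st.2 < T)%N ->
  imem s 25 0 = base -> (base + N <= size w)%N ->
  runs_to s round_cmd round_cost (fun s' =>
    link s' (round es 0%N kap eps bet T st (take N (drop base w))) /\
    imem s' 25 0 = (base + N)%N).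
Proof.
case: st => A As G [/= aA dE dle mon] tE tT bE bw.
pose bits := take N (drop base w); pose u : nat -> R := proj R es 0%N As bits.
apply: (@runs_weaken _ _ _ ((N * 9 + 9) + ((size As * ((N * 10 + m * 7 + 11) + 3) + 3) +
  ((N * 30 + 35) + ((T * ((N * 5 + m * 5 + 16) + 3) + 7) + ((N * 5 + 4) + (N * 5 + 3)).+1).+1).+1).+1).+1 _
  (fun s' => link s' (round es 0%N kap eps bet T (A, As) bits) /\ imem s' 25 0 = (base + N)%N)) => //.
  rewrite /round_cost; have : (size As * (N * 10 + m * 7 + 14) <= T * (N * 10 + m * 7 + 14))%N.
    by rewrite leq_mul2r (ltnW tT) orbT.
  by rewrite -!addnA; lia.
apply: runs_seq_keeps (runs_start G bE bw) _ => s1 [b1 x1] k1.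
have G1 : globals s1 by apply: globals_off k1 _ _ G.
apply: runs_seq_keeps (runs_walk (As := As) G1 x1 _ _) _.
- by rewrite (k1.1 22%N isT) tE.
- by move=> v vh i iA; rewrite (k1.1 7%N isT) dE.
move=> s2 u2 k2; have G2 : globals s2 by apply: globals_off k2 _ _ G1.
apply: runs_seq_keeps (runs_part (A := A) (u := u) G2 _ u2) _.
  by move=> v; rewrite (k2.1 4%N isT) (k1.1 4%N isT) aA.
move=> s3 [y3 W3 U3] k3; have G3 : globals s3 by apply: globals_off k3 _ _ G2.
have a3 : alive_is s3 A.
  by move=> v; rewrite (k3.1 4%N isT) (k2.1 4%N isT) (k1.1 4%N isT) aA.
apply: runs_seq_keeps (runs_sweep G3 a3 y3 U3) _ => s4 b4 k4.
have G4 : globals s4 by apply: globals_off k4 _ _ G3.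
apply: runs_seq_keeps (runs_shrink (A := A) (u := u) G4 _ _ _ b4) _.
- by move=> v; rewrite (k4.1 4%N isT) a3.
- by move=> v vh; rewrite (k4.2 2%N isT) y3.
- by rewrite (k4.2 6%N isT) W3.
move=> s5 a5 k5; have G5 : globals s5 by apply: globals_off k5 _ _ G4.
set A' := shrink _ _ _ _ _ _ _ in a5.
have t5 : imem s5 22 0 = size As.
  by rewrite (k5.1 22%N isT) (k4.1 22%N isT) (k3.1 22%N isT) (k2.1 22%N isT) (k1.1 22%N isT) tE.
have d5 : imem s5 7 = imem s 7.
  by rewrite (k5.1 7%N isT) (k4.1 7%N isT) (k3.1 7%N isT) (k2.1 7%N isT) (k1.1 7%N isT).
apply: runs_post (runs_keeps (runs_mapI_vertex (g := A') (F := fun=> (size As).+1) _ G5 _)) => //.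
  move=> s6 [d6 k6]; split; last first.
    by rewrite (k6.1 25%N isT) (k5.1 25%N isT) (k4.1 25%N isT) (k3.1 25%N isT) (k2.1 25%N isT) b1.
  have sub v : A' v -> A v by exact: shrink_sub.
  split=> /=; rewrite -/u -/A' ?size_rcons.
  - by move=> v; rewrite (k6.1 4%N isT) a5.
  - move=> v vh i; rewrite ltnS leq_eqVlt => /orP [/eqP -> | iA].
      rewrite nth_rcons ltnn eqxx d6 vh d5 /=; case A'v: (A' v); first by rewrite ltnSn.
      by apply/negbTE; rewrite -leqNgt dle.
    rewrite nth_rcons iA d6 vh d5 /=; case A'v: (A' v); last exact: dE.
    by rewrite mon ?sub // ltnS ltnW.
  - move=> v vh; rewrite d6 vh d5 /=; case: (A' v) => //.
    by apply: leq_trans (dle v vh) _.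
  - move=> v vh A'v i; rewrite ltnS nth_rcons leq_eqVlt => /orP [/eqP -> | iA].
      by rewrite ltnn eqxx.
    by rewrite iA mon // sub.
move=> s6 k vh; rewrite alive_eval (k.1 4%N isT) (alive_in a5) //.
by split=> // _; rewrite /= (k.1 22%N isT) t5 addn1.
Qed.

End VerifyRound.

Section RoundsRight.
Variables (R : realType) (V : eqType) (es : seq (V * V)) (x0 : V).
Variables (kap eps bet : R) (T : nat).

Local Notation N := (size (half_edges es)).
Local Notation rounds := (rounds es x0 kap eps bet T).
Local Notation round := (round es x0 kap eps bet T).
Local Notation epochs := (epochs es x0 kap eps bet T).
Local Notation epoch := (epoch es x0 kap eps bet T).

(** The recursion takes off the first block of bits, as averages require; the loop invariants of the
    program append the last block instead. *)
Lemma roundsSr n st w : rounds n.+1 st w = round (rounds n st w) (take N (drop (n * N) w)).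
Proof.
elim: n st w => [|n IH] st w; first by rewrite mul0n drop0.
by rewrite -[LHS]/(rounds n.+1 (round st (take N w)) (drop N w)) IH drop_drop mulSn addnC.
Qed.

Lemma epochsSr n A w :
  epochs n.+1 A w = epoch (epochs n A w) (take (T * N) (drop (n * (T * N)) w)).
Proof.
elim: n A w => [|n IH] A w; first by rewrite mul0n drop0.
by rewrite -[LHS]/(epochs n.+1 (epoch A (take (T * N) w)) (drop (T * N) w))
  IH drop_drop mulSn addnC.
Qed.

End RoundsRight.

Section VerifyEpochs.
Variables (R : realType) (es : seq (nat * nat)) (kap eps bet : R) (T L : nat) (w : seq bool).
Implicit Types (s : store R) (A : nat -> bool).

Local Notation hs := (half_edges es).
Local Notation m := (size es).
Local Notation N := (size hs).
Local Notation globals := (globals es kap eps bet T L w).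

Lemma runs_epoch s A base : globals s -> alive_is es s A -> imem s 25 0 = base ->
  (base + T * N <= size w)%N ->
  runs_to s epoch_cmd (N * 5 + 7 + T * (round_cost es T + 3)) (fun s' =>
    alive_is es s' (epoch es 0%N kap eps bet T A (take (T * N) (drop base w))) /\
    imem s' 25 0 = (base + T * N)%N).
Proof.
move=> G aA bE bw; set wj := take _ _.
rewrite (_ : (N * 5 + 7 + T * (round_cost es T + 3) =
  (N * 5 + 3 + (T * (round_cost es T + 3) + 3)).+1)%N); last by lia.
apply: runs_seq_keeps (runs_mapI_vertex (g := xpredT) (F := fun=> 0%N) _ G _) _ => //.
move=> s1 d1 k1; have G1 : globals s1 by apply: globals_off k1 _ _ G.
pose st j := rounds es 0%N kap eps bet T j (A, [::]) wj.
apply: runs_post (runs_for (n := T) (Inv := fun j s' =>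
   link es s' (st j) /\ imem s' 25 0 = (base + j * N)%N) _ _ _ _).
- by move=> s' [[a _ _ _] b].
- by [].
- by move=> s2 k; rewrite /= (k.1 12%N isT) (g_T G1).
- split; last by rewrite /= /upd /= (k1.1 25%N isT) bE mul0n addn0.
  split=> //= v; rewrite /= /upd /=; first by rewrite (k1.1 4%N isT) aA.
  by move=> vh; rewrite d1 vh.
move=> j s2 jT k2 ij [l2 b2]; have G2 : globals s2 by apply: globals_off k2 _ _ G1.
have sj : size (st j).2 = j by rewrite size_rounds.
have jN : (j * N + N <= T * N)%N by rewrite addnC -mulSn leq_mul2r jT orbT.
have := runs_round G2 l2 _ _ b2 _; rewrite sj => /(_ ij jT).
have -> : take N (drop (base + j * N) w) = take N (drop (j * N) wj).
  have jT' : (j * N <= T * N)%N by rewrite leq_mul2r (ltnW jT) orbT.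
  rewrite /wj -(subnK jT') -take_drop take_takel; last by rewrite leq_subRL.
  by rewrite drop_drop addnC.
move=> H; apply: runs_post (H _); last by rewrite -addnA (leq_trans _ bw) // leq_add2l.
by move=> s' [[a b c d] e]; rewrite /st roundsSr; split; [split | rewrite /= /upd /= e mulSn (addnC N) addnA].
Qed.

Lemma runs_epochs s A : globals s -> alive_is es s A -> imem s 25 0 = 0%N ->
  (L * (T * N) <= size w)%N ->
  runs_to s epochs_cmd (L * (N * 5 + 7 + T * (round_cost es T + 3) + 3) + 3) (fun s' =>
    alive_is es s' (epochs es 0%N kap eps bet T L A w)).
Proof.
move=> G aA bE bw.
apply: runs_post (runs_for (n := L) (Inv := fun j s' =>
   alive_is es s' (epochs es 0%N kap eps bet T j A w) /\
   imem s' 25 0 = (j * (T * N))%N) _ _ _ _).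
- by move=> s' [].
- by [].
- by move=> s2 k; rewrite /= (k.1 15%N isT) (g_L G).
- by [].
move=> j s2 jL k2 ij [a2 b2]; have G2 : globals s2 by apply: globals_off k2 _ _ G.
apply: runs_post (runs_epoch G2 a2 b2 _).
  by move=> s' [a b]; rewrite epochsSr; split=> //; rewrite /= /upd /= b mulSn addnC.
by apply: leq_trans bw; rewrite addnC -mulSn leq_mul2r jL orbT.
Qed.

End VerifyEpochs.

(** Finds the largest T with 12 phi T <= 1 by trial, as reals cannot be rounded. *)
Definition count_steps_cmd : cmd :=
  CWhile (BRLe (RMul (RMul (rconst 12) (rscalar 0)) (ROfNat (IAdd (iscalar 12) (IConst 1))))
    (rconst 1)) (incr 12 (IConst 1)).

(** Doubles a power of 2 until it exceeds the bound. Adding k at each doubling yields k times the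
    logarithm without a multiplication. *)
Definition log_cmd (a k : nat) (bound : iexp) : cmd :=
  CSeq (iset0 14 (IConst 1))
    (CWhile (BILe (iscalar 14) bound)
      (CSeq (incr 14 (iscalar 14)) (incr a (IConst k)))).

Definition half_edges_cmd : cmd :=
  CSeq (CFor 20 num_edges (CSeq (CISet 10 (iscalar 20) end1)
          (CISet 10 (IAdd num_edges (iscalar 20)) end2)))
       (iset0 11 (IAdd num_edges num_edges)).

Definition degrees_cmd : cmd :=
  CFor 20 two_m (CISet 6 vertex (IAdd (IGet 6 vertex) (IConst 1))).

Definition setup_cmd (d : nat) : cmd :=
  CSeq count_steps_cmd
  (CSeq (log_cmd 13 1 num_edges)
  (CSeq (log_cmd 15 d (IGet 0 (IConst 0)))
  (CSeq half_edges_cmd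
  (CSeq degrees_cmd
  (CSeq (CFor 20 (iscalar 15) (incr 16 (iscalar 12)))
  (CFor 20 (iscalar 16) (incr 17 two_m))))))).

(* All random bits are drawn before they are used, so that the positions of the
   flips do not depend on the bits. *)
Definition flip_cmd : cmd :=
  CWhile (bilt (iscalar 18) (iscalar 17))
    (CSeq (CFlip 5 (iscalar 18)) (incr 18 (IConst 1))).

Definition log2S (k : nat) : nat := (trunc_log 2 k).+1.

(** * Setup and random bits *)

Section Setup.
Variables (R : realType) (n : nat) (es : seq (nat * nat)).
Implicit Types (s : store R).

Local Notation hs := (half_edges es).
Local Notation m := (size es).
Local Notation N := (size hs).

Record instance s : Prop := Instance {
  i_n : imem s 0 0 = n;
  i_m : imem s 0 1 = m;
  i_end1 : forall i, (i < m)%N -> imem s 1 i = (nth (0, 0)%N es i).1;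
  i_end2 : forall i, (i < m)%N -> imem s 2 i = (nth (0, 0)%N es i).2 }.

Lemma instance_off I J s s' : same_off I J s s' ->
  all (fun a => a \notin I) [:: 0; 1; 2]%N -> instance s -> instance s'.
Proof.
move=> [hi _] /and4P [i0 i1 i2 _] [h0 h1 h2 h3].
by split; rewrite ?(hi _ i0) ?(hi _ i1) ?(hi _ i2).
Qed.

Lemma runs_count_steps s (T : nat) (phi : R) : rmem s 0 0 = phi -> imem s 12 0 = 0%N ->
  0 < phi -> 12 * phi * T%:R <= 1 -> 1 < 12 * phi * T.+1%:R ->
  runs_to s count_steps_cmd (T * 2).+1 (fun s' => imem s' 12 0 = T).
Proof.
move=> pE t0 p0 T1 T2.
apply: (runs_while (n := T) (Inv := fun j s' => imem s' 12 0 = j)) => //.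
- move=> j s1 jT k jE; split.
    rewrite /= jE (k.2 0%N isT) pE addn1; apply: le_trans T1.
    by rewrite ler_pM2l ?mulr_gt0 // ler_nat.
  by apply: runs_iset; rewrite /= /upd !eqxx /= jE addn1.
by move=> s1 k jE; rewrite /= jE (k.2 0%N isT) pE addn1 -ltNge.
Qed.

Lemma runs_log s a k b x : a != 14%N -> imem s a 0 = 0%N -> (0 < x)%N ->
  (forall s1, same_off [:: 14; a]%N [::] s s1 -> ieval s1 b = x) ->
  runs_to s (log_cmd a k b) (log2S x * 4 + 3) (fun s' => imem s' a 0 = (log2S x * k)%N).
Proof.
move=> a14 a0 x0 bE; have a14' : (14 == a)%N = false by rewrite eq_sym; exact: negbTE.
rewrite (_ : (log2S x * 4 + 3 = (1 + (log2S x * 4).+1).+1)%N); last by lia.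
apply: runs_seq; apply: runs_iset.
have k0 : same_off [:: 14; a]%N [::] s (iset s 14 0 1) by apply: same_off_iset; rewrite mem_head.
apply: runs_post (runs_while (n := log2S x) (k := 3) (Inv := fun j s' =>
   imem s' 14 0 = (2 ^ j)%N /\ imem s' a 0 = (j * k)%N) _ _ _).
- by move=> s' [].
- by rewrite /= /upd /= eqxx (negbTE a14).
- move=> j s1 jl k1 [p1 a1].
  have k2 : same_off [:: 14; a]%N [::] s s1 by apply: same_off_trans k0 k1.
  split.
    rewrite /= p1 (bE _ k2); apply: leq_trans (@trunc_logP 2 x isT x0).
    by rewrite leq_exp2l.
  apply: (runs_seq (k1 := 1) (k2 := 1)); do 2!apply: runs_iset; rewrite /= /upd /= p1 a1.
  by rewrite a14' (negbTE a14) /= ?eqxx /= ?a1 expnS mul2n addnn mulSn addnC.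
move=> s1 k1 [p1 _]; have k2 : same_off [:: 14; a]%N [::] s s1 by apply: same_off_trans k0 k1.
by rewrite /= p1 (bE _ k2) -ltnNge trunc_log_ltn.
Qed.

Lemma runs_half_edges s : instance s ->
  runs_to s half_edges_cmd (m * 6 + 5) (fun s' => imem s' 11 0 = N /\
    forall h, (h < N)%N -> imem s' 10 h = nth 0%N hs h).
Proof.
move=> I0; rewrite (_ : (m * 6 + 5 = ((m * (3 + 3) + 3) + 1).+1)%N); last by lia.
have NE : N = (m + m)%N by rewrite size_half_edges addnn.
apply: runs_seq_keeps; first apply: (runs_for (n := m) (Inv := fun j s' =>
  forall i, (i < j)%N -> imem s' 10 i = nth 0%N hs i /\ imem s' 10 (m + i) = nth 0%N hs (m + i))) => //.
- by move=> s1 k; rewrite /= (k.1 0%N isT) (i_m I0).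
- move=> j s1 jm k ij H; have I1 : instance s1 by apply: instance_off k _ I0.
  apply: (runs_seq (k1 := 1) (k2 := 1)); do 2!apply: runs_iset => /=.
  move=> i; rewrite ltnS => ij'; rewrite /upd /= !ij (i_m I1) (i_end1 I1 jm) (i_end2 I1 jm).
  have im : (i < m)%N by apply: leq_ltn_trans jm.
  have e1 : (i == (m + j)%N) = false by apply/eqP; lia.
  have e2 : ((m + i)%N == j) = false by apply/eqP; lia.
  rewrite e1 e2 eqn_add2l.
  rewrite /half_edges !nth_cat !size_map im ltnNge leq_addr /= addKn.
  rewrite (nth_map (0, 0)%N) // (nth_map (0, 0)%N) //.
  case: (i =P j) => [->//|/eqP ne]; have {}ij' : (i < j)%N by rewrite ltn_neqAle ne.
  have [-> ->] := H i ij'; rewrite /half_edges !nth_cat !size_map im ltnNge leq_addr /= addKn.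
  by rewrite (nth_map (0, 0)%N) // (nth_map (0, 0)%N).
move=> s1 H k1; apply: runs_iset; rewrite /= /upd /= (k1.1 0%N isT) (i_m I0) NE; split=> // h hN.
case: (ltnP h m) => hm; first by have [] := H h hm.
by have [|_] := H (h - m)%N; rewrite ?subnKC //; lia.
Qed.

Lemma runs_degrees s : imem s 11 0 = N -> (forall v, imem s 6 v = 0%N) ->
  (forall h, (h < N)%N -> imem s 10 h = nth 0%N hs h) ->
  runs_to s degrees_cmd (N * 4 + 3) (fun s' => forall v, imem s' 6 v = deg es v).
Proof.
move=> nE d0 hE.
apply: runs_post (runs_for (n := N) (k := 1) (Inv := fun j s' =>
  forall v, imem s' 6 v = count_mem v (take j hs)) _ _ _ _) => //.
- by move=> s' H v; rewrite H take_size.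
- by move=> s1 k; rewrite /= (k.1 11%N isT).
- by move=> v; rewrite take0 /= /upd /= d0.
move=> j s1 jN k ij H; apply: runs_iset => v; rewrite /= /upd /=.
rewrite (k.1 10%N isT) ij hE // (take_nth 0%N jN) -cats1 count_cat /= addn0 -!H.
by rewrite eq_sym; case: eqP => [->|_]; rewrite ?addn0.
Qed.

Lemma runs_product s a b i (x y : nat) : a != i -> imem s a 0 = 0%N ->
  (forall s1, same_off [:: i; a] [::] s s1 -> ieval s1 b = x) ->
  forall c, (forall s1, same_off [:: i; a] [::] s s1 -> ieval s1 c = y) ->
  runs_to s (CFor i b (incr a c)) (x * 4 + 3) (fun s' => imem s' a 0 = (x * y)%N).
Proof.
move=> ai a0 bE c cE; have E s1 : keeps (CFor i b (incr a c)) s s1 -> same_off [:: i; a] [::] s s1.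
  by move=> h; apply: same_off_sub h => z //=; rewrite !inE; case: (z == i); case: (z == a).
apply: (runs_for (n := x) (k := 1) (Inv := fun j s' => imem s' a 0 = (j * y)%N)).
- by rewrite /= inE eq_sym.
- by move=> s1 /E /bE.
- by rewrite /= /upd (negbTE ai).
move=> j s1 jx /E k ij H; apply: runs_iset.
by rewrite /= /upd eqxx (negbTE ai) /= H (cE _ k) mulSn addnC eqxx.
Qed.

Lemma runs_setup s d (phi : R) (T : nat) : instance s -> rmem s 0 0 = phi ->
  (forall a i, (2 < a)%N -> imem s a i = 0%N) ->
  0 < phi -> 12 * phi * T%:R <= 1 -> 1 < 12 * phi * T.+1%:R -> (0 < n)%N -> (0 < m)%N ->
  let l := log2S m in let ln := log2S n in let L := (ln * d)%N in
  runs_to s (setup_cmd d) (T * 2 + l * 4 + ln * 4 + m * 6 + N * 4 + L * 4 + L * T * 4 + 30)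
   (fun s' => [/\ instance s', imem s' 12 0 = T, imem s' 13 0 = l & imem s' 15 0 = L] /\
     [/\ imem s' 11 0 = N, forall h, (h < N)%N -> imem s' 10 h = nth 0%N hs h,
         forall v, imem s' 6 v = deg es v & imem s' 17 0 = (L * T * N)%N]).
Proof.
move=> I0 pE z0 p0 T1 T2 n0 m0 l lg L.
rewrite (_ : (T * 2 + l * 4 + lg * 4 + m * 6 + N * 4 + L * 4 + L * T * 4 + 30 =
  ((T * 2).+1 + ((l * 4 + 3) + ((lg * 4 + 3) + ((m * 6 + 5) + ((N * 4 + 3) + ((L * 4 + 3)
    + (L * T * 4 + 6)).+1).+1).+1).+1).+1).+1)%N); last by lia.
apply: runs_seq_keeps (runs_count_steps pE _ p0 T1 T2) _ => [|s1 t1 k1]; first exact: z0.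
have I1 : instance s1 by apply: instance_off k1 _ I0.
apply: runs_seq_keeps (runs_log 1 (a := 13) (x := m) _ _ _ _) _ => //.
- by rewrite (k1.1 13%N isT) z0.
- by move=> s' k; rewrite /= (k.1 0%N isT) (i_m I1).
move=> s2 l2 k2; have I2 : instance s2 by apply: instance_off k2 _ I1.
apply: runs_seq_keeps (runs_log d (a := 15) (x := n) _ _ _ _) _ => //.
- by rewrite (k2.1 15%N isT) (k1.1 15%N isT) z0.
- by move=> s' k; rewrite /= (k.1 0%N isT) (i_n I2).
move=> s3 l3 k3; have I3 : instance s3 by apply: instance_off k3 _ I2.
apply: runs_seq_keeps (runs_half_edges I3) _ => s4 [n4 h4] k4.
have I4 : instance s4 by apply: instance_off k4 _ I3.
apply: runs_seq_keeps (runs_degrees n4 _ h4) _.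
  by move=> v; rewrite (k4.1 6%N isT) (k3.1 6%N isT) (k2.1 6%N isT) (k1.1 6%N isT) z0.
move=> s5 d5 k5; have I5 : instance s5 by apply: instance_off k5 _ I4.
have t5 : imem s5 12 0 = T.
  by rewrite (k5.1 12%N isT) (k4.1 12%N isT) (k3.1 12%N isT) (k2.1 12%N isT).
have L5 : imem s5 15 0 = L by rewrite (k5.1 15%N isT) (k4.1 15%N isT).
have l5 : imem s5 13 0 = l.
  by rewrite (k5.1 13%N isT) (k4.1 13%N isT) (k3.1 13%N isT) l2 muln1.
apply: runs_seq_keeps (runs_product (a := 16) (x := L) (y := T) _ _ _ _) _ => //.
- by rewrite (k5.1 16%N isT) (k4.1 16%N isT) (k3.1 16%N isT) (k2.1 16%N isT) (k1.1 16%N isT) z0.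
- by move=> s' k; rewrite /= (k.1 15%N isT).
- by move=> s' k; rewrite /= (k.1 12%N isT).
move=> s6 r6 k6; have I6 : instance s6 by apply: instance_off k6 _ I5.
have n6 : imem s6 11 0 = N by rewrite (k6.1 11%N isT) (k5.1 11%N isT).
have h6 : forall h, (h < N)%N -> imem s6 10 h = nth 0%N hs h.
  by move=> h hN; rewrite (k6.1 10%N isT) (k5.1 10%N isT) h4.
apply: runs_weaken (runs_keeps (runs_product (a := 17) (x := L * T) (y := N) _ _ _ _)); rewrite ?leq_add2l //.
- move=> s7 [N7 k7]; have I7 : instance s7 by apply: instance_off k7 _ I6.
  split; split=> //.
  + by rewrite (k7.1 12%N isT) (k6.1 12%N isT).
  + by rewrite (k7.1 13%N isT) (k6.1 13%N isT).
  + by rewrite (k7.1 15%N isT) (k6.1 15%N isT).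
  + by rewrite (k7.1 11%N isT).
  + by move=> h hN; rewrite (k7.1 10%N isT) h6.
  + by move=> v; rewrite (k7.1 6%N isT) (k6.1 6%N isT).
- by rewrite (k6.1 17%N isT) (k5.1 17%N isT) (k4.1 17%N isT) (k3.1 17%N isT) (k2.1 17%N isT)
    (k1.1 17%N isT) z0.
- by move=> s' k; rewrite /= (k.1 16%N isT).
by move=> s' k; rewrite /= (k.1 11%N isT).
Qed.

(* An iteration of flip_cmd takes 4 steps, and CFlip is the third one. *)
Fixpoint picks k (w : seq bool) : seq bool :=
  if k is k'.+1 then nth false w 2 :: picks k' (drop 4 w) else [::].

Lemma size_picks k w : size (picks k w) = k.
Proof. by elim: k w => //= k IH w; rewrite IH. Qed.

Lemma avg_picks k r (F : seq bool -> R) :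
  avg (k * 4 + r) (fun w => F (picks k w)) = avg k F.
Proof.
elim: k F => [|k IH] F; first by rewrite mul0n /= avg_const.
have E b : avg (0 + (k * 4 + r)) (fun w => F (b :: picks k (drop 0 w))) =
    avg k (fun w => F (b :: w)).
  by rewrite add0n -(IH (fun w => F (b :: w))); apply: eq_avg => w _; rewrite drop0.
by rewrite mulSn -addnA /= !E; lra.
Qed.

(** The final store depends on the bits, so it is described for each bit string, but the number of
    steps does not: 4 per bit and 1 for the failing test. *)
Lemma executes_flips k s : (imem s 18 0 + k = imem s 17 0)%N ->
  forall K w, size w = (k * 4 + 1)%N -> exists s',
    [/\ steps (flip_cmd :: K, s) w = (K, s'), same_off [:: 5; 18]%N [::] s s' &
      forall i, imem s' 5 i =
        if (imem s 18 0 <= i < imem s 17 0)%N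
        then nat_of_bool (nth false (picks k w) (i - imem s 18 0)) else imem s 5 i].
Proof.
elim: k s => [|k IH] s kE K w sw.
  case: w sw => [|b []] // _; exists s; split=> //.
    by rewrite /steps /= -kE addn0 leqnn.
  by move=> i; rewrite -kE addn0; case: leqP => //= ->.
case: w sw => [|b1 [|b2 [|b3 [|b4 w]]]] // sw.
pose s1 := iset (iset s 5 (imem s 18 0) b3) 18 0 (imem s 18 0).+1.
have e1 : (imem s1 18 0 + k = imem s1 17 0)%N by rewrite /s1 /= /upd /= -kE addSnnS.
have e2 : size w = (k * 4 + 1)%N by move: sw; rewrite /=; lia.
have [s' [h1 h2 h3]] := IH s1 e1 K w e2.
exists s'; split.
- rewrite -h1 /steps /=; have -> : (imem s 17 0 <= imem s 18 0)%N = false.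
    by rewrite -kE; apply/negbTE; rewrite -ltnNge addnS ltnS leq_addr.
  by rewrite /= /s1 /iset /= {3}/upd /= addn1.
- apply: same_off_trans h2; apply: (@same_off_trans _ _ _ _ (iset s 5 (imem s 18 0) b3)).
    by apply: same_off_iset.
  by apply: same_off_iset.
move=> i; rewrite h3 /s1 /= /upd /= !drop0.
case: (ltngtP (imem s 18 0) i) => hi /=.
- have -> : (i - imem s 18 0 = (i - (imem s 18 0).+1).+1)%N by lia.
  by [].
- by [].
by rewrite -hi subnn -kE addnS ltnS leq_addr.
Qed.

End Setup.

Definition ell_real : rexp := ROfNat (iscalar 13).
Definition cube_cmd : rexp := RMul (RMul ell_real ell_real) ell_real.
(** A product, so that no large unary numeral occurs. *)
Definition kap_const_cmd : rexp :=
  RMul (RMul (RMul (RMul (rconst 100) (rconst 100)) (rconst 100)) (rconst 100)) (rconst 100).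
Definition steps_real : rexp := ROfNat (iscalar 12).
Definition edges_real : rexp := ROfNat num_edges.

Definition mark_cmd : cmd :=
  CFor 20 two_m (CIf (alive vertex) CSkip
    (CSeq (CISet 4 vertex (IConst 1)) (incr 26 (IConst 1)))).

Definition count_alive_cmd : cmd := CFor 20 two_m (CIf (alive vertex) (incr 28 (IConst 1)) CSkip).

(** No cut is reported only if all half-edges are still alive and no vertex is isolated: an isolated
    vertex gives a cut of conductance 0, which rules out a certificate. *)
Definition main_cmd : cmd :=
  CSeq (rset0 3 (RDiv (RMul kap_const_cmd cube_cmd) steps_real))
  (CSeq (rset0 4 (RDiv (RMul (rconst 6) ell_real) steps_real))
  (CSeq (rset0 5 (RDiv (rsqr edges_real) (RMul cube_cmd steps_real)))
  (CSeq mark_cmd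
  (CSeq epochs_cmd
  (CSeq count_alive_cmd
  (CIf (BAnd (BILe two_m (iscalar 28)) (BILe (IGet 0 (IConst 0)) (iscalar 26))) CSkip
    (iset0 3 (IConst 1)))))))).

(** Vertices are added while the volume is below m / 2; a degree is at most m, so the final volume
    stays below 3 m / 2. *)
Definition greedy_cmd : cmd :=
  CSeq (CFor 20 two_m
    (CIf (BAnd (bilt (IAdd (iscalar 28) (iscalar 28)) num_edges) (BNot (alive vertex)))
      (CSeq (CISet 4 vertex (IConst 1)) (incr 28 (IGet 6 vertex))) CSkip))
  (iset0 3 (IConst 1)).

(** The test says kap <= 1. It also protects the divisions by T, which is 0 when phi > 1/12. *)
Definition finish_cmd : cmd :=
  CIf (BRLe (RMul kap_const_cmd cube_cmd) steps_real) main_cmd greedy_cmd.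

Definition program (d : nat) : cmd := CSeq (setup_cmd d) (CSeq flip_cmd finish_cmd).

(** * Verification of the whole program *)

Section VerifyProgram.
Variables (R : realType) (n : nat) (es : seq (nat * nat)).
Implicit Types (s : store R).

Local Notation hs := (half_edges es).
Local Notation m := (size es).
Local Notation N := (size hs).

Definition kap_const : R := 100 * 100 * 100 * 100 * 100.
Definition cube (l : nat) : R := l%:R * l%:R * l%:R.
Definition kap_of (l T : nat) : R := kap_const * cube l / T%:R.
Definition eps_of (l T : nat) : R := 6 * l%:R / T%:R.
Definition bet_of (l T : nat) : R := m%:R * m%:R / (cube l * T%:R).

Record ready T l L w s : Prop := Ready {
  r_instance : instance n es s;
  r_vertex : forall h, (h < N)%N -> imem s 10 h = nth 0%N hs h;
  r_two_m : imem s 11 0 = N;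
  r_deg : forall v, imem s 6 v = deg es v;
  r_bits : forall i, imem s 5 i = nat_of_bool (nth false w i);
  r_T : imem s 12 0 = T;
  r_l : imem s 13 0 = l;
  r_L : imem s 15 0 = L;
  r_zero : forall a i, a \in [:: 3; 4; 25; 26; 28]%N -> imem s a i = 0%N }.

Lemma ready_globals T l L w s s' kap eps bet : ready T l L w s ->
  (forall a, a \in [:: 0; 1; 2; 10; 11; 6; 5; 12; 15]%N -> imem s' a = imem s a) ->
  rmem s' 3 0 = kap -> rmem s' 4 0 = eps -> rmem s' 5 0 = bet ->
  globals es kap eps bet T L w s'.
Proof.
move=> [[i1 i2 i3 i4] h1 h2 h3 h4 h5 h6 h7 _] H k e b.
by split=> //; rewrite ?H.
Qed.

Lemma size_undup_rcons (x : nat) (r : seq nat) :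
  size (undup (rcons r x)) = ((x \notin r) + size (undup r))%N.
Proof.
have -> : size (undup (rcons r x)) = size (undup (x :: r)).
  by apply/perm_size/perm_undup => z; rewrite mem_rcons.
by rewrite /=; case: (x \in r).
Qed.

Lemma runs_mark s T L w kap eps bet : globals es kap eps bet T L w s ->
  (forall v, imem s 4 v = 0%N) -> imem s 26 0 = 0%N ->
  runs_to s mark_cmd (N * 7 + 3) (fun s' => (forall v, (imem s' 4 v != 0%N) = (v \in hs)) /\
    imem s' 26 0 = size (undup hs)).
Proof.
move=> G z4 z26.
apply: runs_post (runs_for (n := N) (k := 4) (Inv := fun j s' =>
  (forall v, (imem s' 4 v != 0%N) = (v \in take j hs)) /\
  imem s' 26 0 = size (undup (take j hs))) _ _ _ _) => //.
- by move=> s'; rewrite take_size.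
- by move=> s1 k; rewrite /= (k.1 11%N isT) (g_two_m G).
- by rewrite take0; split=> [v|]; rewrite /= /upd /= ?z4.
move=> j s1 jN k ij [a1 c1].
have vE : ieval s1 vertex = nth 0%N hs j by rewrite /= (k.1 10%N isT) ij (g_vertex G).
have mE v : (v \in take j.+1 hs) = (v == nth 0%N hs j) || (v \in take j hs).
  by rewrite (take_nth 0%N jN) mem_rcons inE.
apply: runs_if; rewrite alive_eval vE a1 => vj.
  apply: runs_skip => //; split=> [v|].
    by rewrite /= /upd /= a1 mE; case: eqP => // ->; rewrite vj.
  by rewrite /= /upd /= c1 (take_nth 0%N jN) size_undup_rcons vj.
apply: (runs_seq (k1 := 1) (k2 := 1)); do 2!apply: runs_iset; split=> [v|].
  move: vE; rewrite /= /upd /= => ->; rewrite mE.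
  by case: (v =P nth 0%N hs j) => //= _; rewrite a1.
by rewrite /= /upd /= c1 (take_nth 0%N jN) size_undup_rcons vj add1n addn1.
Qed.

Lemma count_take_nth (a : pred nat) j : (j < N)%N ->
  count a (take j.+1 hs) = (count a (take j hs) + a (nth 0%N hs j))%N.
Proof. by move=> jN; rewrite (take_nth 0%N jN) -cats1 count_cat /= addn0. Qed.

Lemma runs_count_alive s T L w kap eps bet A : globals es kap eps bet T L w s ->
  alive_is es s A -> imem s 28 0 = 0%N ->
  runs_to s count_alive_cmd (N * 5 + 3) (fun s' => imem s' 28 0 = count A hs).
Proof.
move=> G aA z28.
apply: runs_post (runs_for (n := N) (k := 2) (Inv := fun j s' =>
  imem s' 28 0 = count A (take j hs)) _ _ _ _) => //.
- by move=> s'; rewrite take_size.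
- by move=> s1 k; rewrite /= (k.1 11%N isT) (g_two_m G).
- by rewrite take0.
move=> j s1 jN k ij c1.
have vE : ieval s1 vertex = nth 0%N hs j by rewrite /= (k.1 10%N isT) ij (g_vertex G).
apply: runs_if; rewrite alive_eval vE (k.1 4%N isT) aA mem_nth //= => vj.
  by apply: runs_iset; rewrite /= /upd /= c1 count_take_nth // vj.
by apply: runs_skip => //; rewrite /= /upd /= c1 count_take_nth // (negbTE vj) addn0.
Qed.

Definition main_post T l L w s : Prop :=
  let A := epochs es 0%N (kap_of l T) (eps_of l T) (bet_of l T) T L (@all_v nat) w in
  alive_is es s A /\
  imem s 3 0 = nat_of_bool (~~ ((N <= count A hs)%N && (n <= size (undup hs))%N)).

Definition main_cost T L : nat :=
  N * 12 + 19 + (L * (N * 5 + 7 + T * (round_cost es T + 3) + 3) + 3).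

Lemma runs_main s T l L w : ready T l L w s -> (L * (T * N) <= size w)%N ->
  runs_to s main_cmd (main_cost T L) (main_post T l L w).
Proof.
move=> rd sw.
rewrite (_ : main_cost T L = ((1 + (1 + (1 + ((N * 7 + 3) + ((L * (N * 5 + 7 + T * (round_cost es T + 3) + 3) + 3)
  + ((N * 5 + 3) + 4).+1).+1).+1).+1).+1).+1)%N); last by rewrite /main_cost; lia.
apply: runs_seq_keeps (runs_rset (Q := fun s' => rmem s' 3 0 = kap_of l T) _) _.
  by rewrite /= /upd !eqxx /= (r_l rd) (r_T rd).
move=> s1 e1 k1.
apply: runs_seq_keeps (runs_rset (Q := fun s' => rmem s' 4 0 = eps_of l T) _) _.
  by rewrite /= /upd !eqxx /= (k1.1 13%N isT) (k1.1 12%N isT) (r_l rd) (r_T rd).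
move=> s2 e2 k2.
apply: runs_seq_keeps (runs_rset (Q := fun s' => rmem s' 5 0 = bet_of l T) _) _.
  rewrite /= /upd !eqxx /= (k2.1 0%N isT) (k2.1 13%N isT) (k2.1 12%N isT).
  by rewrite (k1.1 0%N isT) (k1.1 13%N isT) (k1.1 12%N isT) (i_m (r_instance rd)) (r_l rd) (r_T rd).
move=> s3 e3 k3.
have im a : imem s3 a = imem s a by rewrite (k3.1 a isT) (k2.1 a isT) (k1.1 a isT).
have G3 : globals es (kap_of l T) (eps_of l T) (bet_of l T) T L w s3.
  apply: ready_globals rd _ _ _ _ => //.
  - by rewrite (k3.2 3%N isT) (k2.2 3%N isT).
  - by rewrite (k3.2 4%N isT).
apply: runs_seq_keeps (runs_mark G3 _ _) _.
- by move=> v; rewrite im (r_zero rd).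
- by rewrite im (r_zero rd).
move=> s4 [a4 c4] k4; have G4 : globals es (kap_of l T) (eps_of l T) (bet_of l T) T L w s4.
  by apply: globals_off k4 _ _ G3.
have aa : alive_is es s4 (@all_v nat) by move=> v; rewrite a4 andbT.
apply: runs_seq_keeps (runs_epochs G4 aa _ sw) _.
  by rewrite (k4.1 25%N isT) im (r_zero rd).
move=> s5 a5 k5; have G5 : globals es (kap_of l T) (eps_of l T) (bet_of l T) T L w s5.
  by apply: globals_off k5 _ _ G4.
apply: runs_seq_keeps (runs_count_alive G5 a5 _) _.
  by rewrite (k5.1 28%N isT) (k4.1 28%N isT) im (r_zero rd).
move=> s6 c6 k6.
have a6 := k6.1 4%N isT.
have n6 : imem s6 11 0 = N by rewrite (k6.1 11%N isT) (g_two_m G5).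
have u6 : imem s6 26 0 = size (undup hs) by rewrite (k6.1 26%N isT) (k5.1 26%N isT).
have i6 : imem s6 0 0 = n.
  by rewrite (k6.1 0%N isT) (k5.1 0%N isT) (k4.1 0%N isT) im (i_n (r_instance rd)).
apply: runs_if; rewrite /= n6 u6 i6 c6 => b.
  apply: runs_skip => //; split; first by move=> v; rewrite a6 a5.
  by rewrite b (k6.1 3%N isT) (k5.1 3%N isT) (k4.1 3%N isT) im (r_zero rd).
apply: runs_weaken (runs_iset (Q := main_post T l L w) _) => //.
split; first by move=> v; rewrite /= /upd /= a6 a5.
by rewrite /= /upd /= b.
Qed.

Definition greedy_post s : Prop := imem s 3 0 = 1%N /\
  exists A, alive_is es s A /\ (m <= 2 * count A hs < 3 * m)%N.

Lemma count_setU1 (A : nat -> bool) v : ~~ A v ->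
  count (fun z => (z == v) || A z) hs = (deg es v + count A hs)%N.
Proof.
move=> nA; have := count_predUI (pred1 v) A hs.
rewrite (eq_count (a2 := pred0) (a1 := predI _ _)); last first.
  by move=> z /=; case: eqP => // ->; exact: negbTE.
by rewrite count_pred0 addn0 => <-; apply: eq_count.
Qed.

Lemma runs_greedy s T l L w : ready T l L w s -> (0 < m)%N -> (forall v, deg es v <= m)%N ->
  runs_to s greedy_cmd (N * 7 + 5) greedy_post.
Proof.
move=> rd m0 dm; rewrite (_ : (N * 7 + 5 = ((N * (4 + 3) + 3) + 1).+1)%N); last by lia.
pose al s' v := imem s' 4 v != 0%N.
(* The last clause gives the lower bound: if the final volume were below m / 2, every vertex seen
   would be alive, and the volume would be 2 m. *)
apply: runs_seq_keeps; first apply: (runs_for (n := N) (Inv := fun j s' =>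
  [/\ forall v, al s' v -> v \in hs, imem s' 28 0 = count (al s') hs,
      (2 * count (al s') hs < 3 * m)%N &
      (2 * count (al s') hs < m)%N -> {in take j hs, forall v, al s' v}])) => //.
- by move=> s1 k; rewrite /= (k.1 11%N isT) (r_two_m rd).
- have z v : al (iset s 20 0 0) v = false by rewrite /al /= /upd /= (r_zero rd).
  have cz : count (al (iset s 20 0 0)) hs = 0%N by rewrite (eq_count z) count_pred0.
  split=> [v||| _ v]; rewrite ?z ?cz //; first by rewrite /= /upd /= (r_zero rd).
    by rewrite muln_gt0.
  by rewrite take0.
- move=> j s1 jN k ij [sub c1 lt3 all1].
  have vE : ieval s1 vertex = nth 0%N hs j by rewrite /= (k.1 10%N isT) ij (r_vertex rd).
  have mE : imem s1 0 1 = m by rewrite (k.1 0%N isT) (i_m (r_instance rd)).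
  set v0 := nth 0%N hs j in vE.
  have v0h : v0 \in hs by rewrite mem_nth.
  have gE : beval s1 (BAnd (bilt (IAdd (iscalar 28) (iscalar 28)) num_edges) (BNot (alive vertex)))
      = (2 * count (al s1) hs < m)%N && ~~ al s1 v0.
    rewrite -[LHS]/(beval s1 (bilt (IAdd (iscalar 28) (iscalar 28)) num_edges) &&
      ~~ beval s1 (alive vertex)) alive_eval vE.
    by rewrite /= mE c1 -ltnNge addnn mul2n.
  apply: runs_if; rewrite gE.
    move=> /andP [lt1 nal].
    have alE x : al (iset (iset (iset s1 4 (ieval s1 vertex) 1) 28 0
        (ieval (iset s1 4 (ieval s1 vertex) 1) (IAdd (iscalar 28) (IGet 6 vertex)))) 20 0 j.+1) x =
        (x == v0) || al s1 x.
      by rewrite vE /al /= /upd /=; case: (x =P v0).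
    apply: (runs_seq (k1 := 1) (k2 := 1)); do 2!apply: runs_iset.
    have cE := count_setU1 nal.
    split.
    + by move=> v; rewrite alE => /orP [/eqP ->|/sub].
    + rewrite (eq_count alE) cE /= /upd /= c1 (k.1 6%N isT) (r_deg rd) addnC.
      by move: vE => /= ->.
    + by rewrite (eq_count alE) cE; have := dm v0; lia.
    + rewrite (eq_count alE) cE => lt v; rewrite (take_nth 0%N jN) mem_rcons inE alE => /orP [->//|vt].
      by rewrite (all1 lt1 v vt) orbT.
  move=> h; apply: runs_skip => //; split=> //.
  move=> lt v; rewrite (take_nth 0%N jN) mem_rcons inE => /orP [/eqP ->|vt].
    by move: h; rewrite lt /= negbK.
  exact: all1.
move=> s1 [sub c1 lt3 all1] k; apply: runs_iset; split; first by rewrite /= /upd /=.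
exists (al s1); split.
  move=> v; rewrite /= /upd /= -/(al s1 v); case alv: (al s1 v); last by rewrite andbF.
  by rewrite sub.
rewrite lt3 andbT leqNgt; apply/negP => lt.
have := all1 lt; rewrite take_size => H.
have /eqP : count (al s1) hs == N by rewrite -all_count; apply/allP.
by move=> cE; move: lt; rewrite cE size_half_edges ltnNge -mul2n mulnA leq_pmull.
Qed.

Lemma picks_cat k u w : (k * 4 <= size u)%N -> picks k (u ++ w) = picks k u.
Proof.
elim: k u => [//|k IH] [|a [|b [|c [|d u]]]] //= su.
by rewrite !drop0 IH //; move: su; rewrite mulSn.
Qed.

Lemma steps_halted s w : steps ([::], s) w = ([::], s).
Proof. by elim: w. Qed.

Definition finish_cost T L : nat := (main_cost T L).+1.

Definition final T l L w s : Prop :=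
  if kap_const * cube l <= T%:R then main_post T l L w s else greedy_post s.

Lemma runs_finish s T l L w : ready T l L w s -> (0 < m)%N -> (forall v, deg es v <= m)%N ->
  (L * (T * N) <= size w)%N -> runs_to s finish_cmd (finish_cost T L) (final T l L w).
Proof.
move=> rd m0 dm sw; apply: runs_if => /=; rewrite (r_l rd) (r_T rd) => h.
  by apply: runs_post (runs_main rd sw) => s'; rewrite /final /kap_const /cube h.
apply: runs_weaken (runs_greedy rd m0 dm); first by rewrite /main_cost; lia.
by move=> s'; rewrite /final /kap_const /cube (negbTE h).
Qed.

(** The flips occupy fixed positions after [k0] deterministic steps, whatever the bits are, so the
    picked bits are uniform and independent. *)
Lemma program_run d s (phi : R) (T : nat) :
  instance n es s -> rmem s 0 0 = phi -> (forall a i, (2 < a)%N -> imem s a i = 0%N) ->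
  0 < phi -> 12 * phi * T%:R <= 1 -> 1 < 12 * phi * T.+1%:R ->
  (0 < n)%N -> (0 < m)%N -> (forall v, deg es v <= m)%N ->
  let l := log2S m in let lg := log2S n in let L := (lg * d)%N in let B := (L * T * N)%N in
  exists k0 r, [/\ (k0 <= T * 2 + l * 4 + lg * 4 + m * 6 + N * 4 + L * 4 + L * T * 4 + 32)%N,
    (r <= finish_cost T L + 1)%N &
    forall w, size w = (k0 + (B * 4 + r))%N -> exists s',
      run (program d) s w = ([::], s') /\ final T l L (picks B (drop k0 w)) s'].
Proof.
move=> I0 pE z0 p0 T1 T2 n0 m0 dm l lg L B.
have [k1 [s1 [hk e1 [[[I1 t1 l1 L1] [n1 h1 d1 N1]] kp]]]] :=
  runs_keeps (runs_setup d I0 pE z0 p0 T1 T2 n0 m0).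
(* Two sequencing steps surround the setup; after the flips come the failing test and an upper bound
   on the rest, a halted machine idling. *)
exists k1.+2, (1 + finish_cost T L)%N; split; [by lia | by lia |] => w.
move=> /steps_split [a [c [-> sa]]].
rewrite addnA => /steps_split [w2 [w3 [-> sw2 sw3]]].
have run_a : steps ([:: program d], s) a = ([:: flip_cmd; finish_cmd], s1).
  case: a sa => [//|b a] /= [sa].
  have [a1 [a2 [-> sa1 sa2]]] := @steps_split k1 1 a (etrans sa (esym (addn1 _))).
  rewrite -[steps _ _]/(steps ([:: setup_cmd d; CSeq flip_cmd finish_cmd], s) (a1 ++ a2)).
  by rewrite steps_cat e1 //; case: a2 sa2 => [|b2 []].
have z1 i : imem s1 18 i = 0%N by rewrite (kp.1 18%N isT) z0.
have [|s2 [h2 k2 b2]] := @executes_flips R B s1 _ [:: finish_cmd] w2 sw2.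
  by rewrite z1 N1.
rewrite drop_size_cat //.
rewrite picks_cat ?sw2 ?leq_addr //.
have rd : ready T l L (picks B w2) s2.
  split.
  - by apply: instance_off k2 _ I1.
  - by move=> h hN; rewrite (k2.1 10%N isT) h1.
  - by rewrite (k2.1 11%N isT).
  - by move=> v; rewrite (k2.1 6%N isT).
  - move=> i; rewrite b2 z1 N1 subn0 leq0n /=; case: ltnP => // iB.
    by rewrite nth_default ?size_picks // (kp.1 5%N isT) z0.
  - by rewrite (k2.1 12%N isT).
  - by rewrite (k2.1 13%N isT).
  - by rewrite (k2.1 15%N isT).
  - move=> x i; rewrite !inE => xE.
    have [xa xb] : x \notin [:: 5; 18]%N /\ x \notin imods (setup_cmd d).
      by move: xE; case/or4P => [|||/orP []] /eqP ->.
    rewrite (k2.1 _ xa) (kp.1 _ xb) z0 //.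
    by move: xE; case/or4P => [|||/orP []] /eqP ->.
have sB : (L * (T * N) <= size (picks B w2))%N by rewrite size_picks mulnA.
have [k3 [s3 [hk3 e3 q3]]] := runs_finish rd m0 dm sB.
exists s3; split=> //.
rewrite -[run _ _ _]/(steps ([:: program d], s) (a ++ (w2 ++ w3))) steps_cat run_a.
rewrite steps_cat h2 -(cat_take_drop k3 w3) steps_cat e3 ?steps_halted //.
by rewrite size_takel // sw3.
Qed.

End VerifyProgram.

(** * Half-edges of a simple graph *)

Section Bridge.
Variables (n : nat) (e : rel 'I_n) (es0 : seq ('I_n * 'I_n)).
Hypotheses (irr : irreflexive e) (sym : symmetric e) (el : edge_list e es0).

Definition nat_edges : seq (nat * nat) := [seq (val p.1, val p.2) | p <- es0].

Local Notation es := nat_edges.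
Local Notation hs := (half_edges es).
Local Notation hs0 := (half_edges es0).

Lemma half_edges_nat : hs = [seq val v | v <- hs0].
Proof. by rewrite /half_edges /nat_edges /unzip1 /unzip2 map_cat -!map_comp. Qed.

Lemma size_nat_edges : size es = #|edges e|.
Proof. by rewrite size_map cardE -(perm_size el) size_map. Qed.

Lemma card_edges (P : pred {set 'I_n}) :
  #|[set f in edges e | P f]| = count (fun p => P [set p.1; p.2]) es0.
Proof.
rewrite -(count_map (fun p => [set p.1; p.2]) P) (permP el) -sum1_count -sum1_card.
by rewrite big_enum_cond; apply: eq_bigl => f; rewrite !inE.
Qed.

Lemma edge_neq p : p \in es0 -> p.1 != p.2.
Proof.
move=> pe; have : [set p.1; p.2] \in enum (edges e).
  by rewrite -(perm_mem el); apply: map_f.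
rewrite mem_enum inE => /existsP [x /existsP [y /andP [exy /eqP E]]].
have xy : x != y by apply: contraTneq exy => ->; rewrite irr.
by have := cards2 p.1 p.2; rewrite E cards2 xy; case: (_ != _).
Qed.

(** Neighbours of v correspond to the edges containing v, and without loops each of these has
    exactly one half-edge at v. *)
Lemma degree_deg v : degree e v = deg es (val v).
Proof.
have -> : deg es (val v) = count_mem v hs0.
  rewrite /deg half_edges_nat count_map; apply: eq_count => u /=.
  by rewrite (inj_eq val_inj).
rewrite /degree -(@card_in_imset _ _ (fun u => [set v; u])); last first.
  move=> u1 u2; rewrite !inE => e1 e2 /setP E.
  have := E u1; rewrite !inE eqxx orbT => /esym /orP [/eqP h|/eqP //].
  by rewrite h irr in e1.
have -> : [set [set v; u] | u in [set u | e v u]] = [set f in edges e | v \in f].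
  apply/setP => f; rewrite !inE; apply/imsetP/andP.
    move=> [u]; rewrite inE => evu ->; split; last by rewrite !inE eqxx.
    by apply/existsP; exists v; apply/existsP; exists u; rewrite evu eqxx.
  move=> [/existsP [x /existsP [y /andP [exy /eqP ->]]]]; rewrite !inE.
  move=> /orP [] /eqP ->; first by exists y; rewrite ?inE.
  by exists x; rewrite ?inE 1?sym // setUC.
rewrite card_edges /half_edges count_cat !count_map.
have : all (fun p => p.1 != p.2) es0 by apply/allP => p /edge_neq.
elim: (es0) => //= p r IH /andP [ne /IH ->]; rewrite !inE !(eq_sym v) addnACA.
congr (_ + _)%N; move: ne.
by case: (p.1 =P v) => [->|_]; case: (p.2 =P v) => [->|_] //; rewrite eqxx.
Qed.

Lemma vol_count (S : {set 'I_n}) (A : nat -> bool) :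
  (forall v : 'I_n, val v \in hs -> A v = (v \in S)) -> vol e S = count A hs.
Proof.
move=> AS; have -> : count A hs = count (mem S) hs0.
  rewrite half_edges_nat count_map; apply: eq_in_count => v vh /=; apply: AS.
  by rewrite half_edges_nat map_f.
rewrite /vol; under eq_bigr => v _ do rewrite degree_deg.
have degE v : deg es (val v) = count_mem v hs0.
  rewrite /deg half_edges_nat count_map; apply: eq_count => u /=.
  by rewrite (inj_eq val_inj).
under eq_bigr => v _ do rewrite degE.
elim: hs0 => [|u r IH]; first by rewrite big1.
rewrite /= big_split /= IH; congr (_ + _)%N.
case uS: (u \in S); last first.
  by rewrite big1 // => v vS; case: eqP => // uv; rewrite uv vS in uS.
rewrite (bigD1 u) //= eqxx big1 // => v /andP [_ vu].
by rewrite eq_sym (negbTE vu).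
Qed.

Lemma border_boundary (S : {set 'I_n}) (A : nat -> bool) :
  (forall v : 'I_n, val v \in hs -> A v = (v \in S)) ->
  #|edges_between e S (~: S)| = boundary es A.
Proof.
move=> AS; rewrite /edges_between card_edges /boundary count_map.
apply: eq_in_count => p pe /=.
have /andP [h1 h2] := mem_half_edges pe.
rewrite !AS ?half_edges_nat ?map_f //.
apply/existsP/idP.
  move=> [x /existsP [y /and3P [xS]]]; rewrite inE => yS /eqP E.
  have : x \in [set p.1; p.2] by rewrite E !inE eqxx.
  have : y \in [set p.1; p.2] by rewrite E !inE eqxx orbT.
  rewrite !inE => /orP [] /eqP yE /orP [] /eqP xE; move: xS yS; rewrite xE yE.
  - by move=> ->.
  - by move=> -> /negbTE ->.
  - by move=> -> /negbTE ->.
  - by move=> ->.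
case: (boolP (p.1 \in S)) => s1; case: (boolP (p.2 \in S)) => s2 //= _.
  by exists p.1; apply/existsP; exists p.2; rewrite inE s1 s2 eqxx.
by exists p.2; apply/existsP; exists p.1; rewrite inE s1 s2 setUC eqxx.
Qed.

Lemma deg_le v : (deg es v <= size es)%N.
Proof.
rewrite /deg half_edges_nat count_map /half_edges count_cat !count_map size_map.
have : all (fun p => p.1 != p.2) es0 by apply/allP => p /edge_neq.
elim: (es0) => //= p r IH /andP [ne /IH]; rewrite addnACA -add1n; apply: leq_add.
case: eqP => [e1|_]; case: eqP => [e2|_] //.
by case/eqP: ne; apply: val_inj; rewrite /= e1 e2.
Qed.

Lemma half_edge_ord v : v \in hs -> exists u : 'I_n, val u = v.
Proof. by rewrite half_edges_nat => /mapP [u _ ->]; exists u. Qed.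

End Bridge.

(** * Parameters *)

Section Estimates.
Variable R : realType.

Lemma expR1_ge2 : 2 <= expR 1 :> R.
Proof. by have := expR_ge1Dx (1 : R); lra. Qed.

Lemma expR_natr (k : nat) : expR k%:R = expR 1 ^+ k :> R.
Proof. by rewrite -[k%:R]mul1r expRM_natr. Qed.

Lemma pow2_le_expR (k : nat) : (2 ^ k)%:R <= expR k%:R :> R.
Proof. by rewrite natrX expR_natr lerXn2r ?nnegrE ?expR_ge0 ?expR1_ge2. Qed.

Lemma ln2_ge : 2^-1 <= ln 2 :> R.
Proof.
rewrite -ler_expR lnK ?posrE //.
have h : 1 - 2^-1 <= expR (- 2^-1) :> R by have := expR_ge1Dx (- 2^-1 : R); lra.
have := ler_wpM2l (expR_ge0 (2^-1 : R)) h.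
by rewrite expRxMexpNx_1; lra.
Qed.

Lemma exp1B_le (x : R) (k : nat) : x <= 1 -> (1 - x) ^+ k <= expR (- (x * k%:R)).
Proof.
move=> x1; rewrite -mulNr expRM_natr; apply: lerXn2r; rewrite ?nnegrE ?expR_ge0 ?subr_ge0 //.
by have := expR_ge1Dx (- x).
Qed.

Lemma log2S_lt k : (k < 2 ^ log2S k)%N.
Proof. exact: trunc_log_ltn. Qed.

Lemma log2S_ge k : (0 < k)%N -> (2 ^ (log2S k).-1 <= k)%N.
Proof. by move=> k0; exact: trunc_logP. Qed.

Lemma log2S_le k : (0 < k)%N -> (log2S k <= k)%N.
Proof.
move=> k0; have h := log2S_ge k0; have := ltn_expl (log2S k).-1 (isT : 1 < 2)%N.
by move=> h1; have := leq_trans h1 h.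
Qed.

Lemma ln_le_log2S k : (0 < k)%N -> ln k%:R <= (log2S k)%:R :> R.
Proof.
move=> k0; rewrite -ler_expR lnK ?posrE ?ltr0n //.
by apply: le_trans (pow2_le_expR _); rewrite ler_nat ltnW // log2S_lt.
Qed.

Lemma ln_ge2V k : (1 < k)%N -> 2^-1 <= ln k%:R :> R.
Proof.
move=> k1; apply: le_trans ln2_ge _.
by rewrite ler_ln ?posrE ?ltr0n ?ler_nat // (ltn_trans _ k1).
Qed.

(** For l = [log2S k], 2^(l-1) <= k and ln 2 >= 1/2 give l - 1 <= 2 ln k, and 1 <= 2 ln k since k >=
    2. *)
Lemma log2S_le_ln k : (1 < k)%N -> (log2S k)%:R <= 4 * ln k%:R :> R.
Proof.
move=> k1; have k0 : (0 < k)%N by apply: ltn_trans k1.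
have h : ln (2 ^ (log2S k).-1)%:R <= ln k%:R :> R.
  by rewrite ler_ln ?posrE ?ltr0n ?expn_gt0 // ler_nat log2S_ge.
move: h; rewrite natrX lnXn ?ltr0n // => h.
have := ln_ge2V k1; have -> : (log2S k)%:R = (log2S k).-1%:R + 1 :> R by rewrite natr1.
have : (log2S k).-1%:R * 2^-1 <= ln 2 *+ (log2S k).-1 :> R.
  by rewrite -[X in _ <= X]mulr_natl ler_wpM2l // ln2_ge.
by lra.
Qed.

Section Regime.
Variables (m l T : nat).
Hypotheses (m1 : (1 < m)%N) (lE : l = log2S m) (hT : kap_const R * cube R l <= T%:R).

Local Notation kap := (kap_of R l T).
Local Notation eps := (eps_of R l T).

Let l1 : 1 <= l%:R :> R.
Proof. by rewrite ler1n lE. Qed.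

Let cube_ge : l%:R <= cube R l.
Proof.
rewrite /cube -[X in X <= _]mulr1 -mulrA ler_wpM2l //.
by rewrite -[X in X <= _]mulr1 ler_pM.
Qed.

Lemma T_gt0 : 0 < T%:R :> R.
Proof. by apply: lt_le_trans hT; rewrite /kap_const !mulr_gt0 // (lt_le_trans ltr01). Qed.

Lemma kap_gt0 : 0 < kap.
Proof.
by rewrite /kap_of /kap_const !mulr_gt0 ?invr_gt0 ?T_gt0 // (lt_le_trans ltr01 l1).
Qed.

Lemma kap_le1 : kap <= 1.
Proof. by rewrite /kap_of ler_pdivrMr ?T_gt0 // mul1r. Qed.

Lemma eps_ge0 : 0 <= eps.
Proof. by rewrite /eps_of divr_ge0 ?mulr_ge0. Qed.

Lemma eps_kap : eps * 8 <= Num.sqrt kap.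
Proof.
rewrite -(ger0_norm (mulr_ge0 eps_ge0 _)) // -sqrtr_sqr ler_sqrt ?kap_gt0 //; last exact: ltW kap_gt0.
rewrite /eps_of /kap_of; set t := T%:R; have t0 : 0 < t := T_gt0.
have -> : (6 * l%:R / t * 8) ^+ 2 = (2304 * l%:R * l%:R / t) / t.
  by rewrite /t; field; rewrite gt_eqF.
rewrite ler_pM2r ?invr_gt0 // ler_pdivrMr //.
have h1 : 2304 * l%:R * l%:R <= kap_const R * cube R l :> R.
  rewrite /kap_const /cube; have : l%:R * l%:R * 1 <= l%:R * l%:R * l%:R :> R.
    by rewrite ler_wpM2l ?mulr_ge0.
  have : 0 <= l%:R * l%:R :> R by rewrite mulr_ge0.
  by lra.
apply: le_trans h1 _; rewrite -[X in X <= _]mulr1; apply: ler_wpM2l.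
  by rewrite /kap_const /cube !mulr_ge0.
apply: le_trans hT; rewrite /kap_const; have := le_trans l1 cube_ge; lra.
Qed.

Lemma m_le_expR : m%:R <= expR l%:R :> R.
Proof. by apply: le_trans (pow2_le_expR _); rewrite ler_nat lE ltnW // log2S_lt. Qed.

Let eps_le1 : eps <= 1.
Proof.
have := eps_kap; have : Num.sqrt kap <= 1 by rewrite -sqrtr1 ler_sqrt // kap_le1.
by have := eps_ge0; lra.
Qed.

(** This fixes the constant 6 in eps: eps T = 6 l must cover the exponent 5 + l of a bound on 32
    m. *)
Lemma eps_T : (1 - eps) ^+ T * (32 * m%:R) <= 1.
Proof.
have h1 := exp1B_le T eps_le1.
have e1 : eps * T%:R = 6 * l%:R by rewrite /eps_of divfK // gt_eqF // T_gt0.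
have h2 : 32 * m%:R <= expR (5 + l%:R) :> R.
  rewrite expRD; apply: ler_pM => //; last exact: m_le_expR.
  by apply: le_trans (pow2_le_expR 5); rewrite ler_nat.
have s0 : 0 <= (1 - eps) ^+ T by rewrite exprn_ge0 // subr_ge0.
apply: le_trans (ler_pM s0 _ h1 h2) _; first by rewrite mulr_ge0.
by rewrite e1 -expRD -[X in _ <= X]expR0 ler_expR; move: l1; lra.
Qed.

(** Of order log m, so that [tail] at this value is far below 1 / m^2. *)
Definition cutoff : R := 100 * l%:R.
Definition rate : R := kap / (1280 * cutoff ^+ 2).

Lemma cutoff_gt0 : 0 < cutoff.
Proof. by rewrite mulr_gt0 // (lt_le_trans ltr01 l1). Qed.

(** The third power of the logarithm in kap is chosen for this: two powers are spent on the square
    of the cutoff, and the remaining one makes an epoch shrink the potential polynomially in m. *)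
Lemma rate_mul_T : rate * T%:R = 3125 / 4 * l%:R.
Proof.
rewrite /rate /kap_of /cutoff /kap_const /cube; field.
by rewrite !gt_eqF ?T_gt0 // (lt_le_trans ltr01 l1).
Qed.

Lemma rate_le1 : rate <= 1.
Proof.
rewrite /rate ler_pdivrMr ?mul1r; last by rewrite mulr_gt0 ?exprn_gt0 ?cutoff_gt0.
apply: le_trans kap_le1 _; rewrite /cutoff exprMn.
have : 1 <= l%:R ^+ 2 :> R by rewrite exprn_ege1.
by lra.
Qed.

Lemma rate_T : (1 - rate) ^+ T * (128 * m%:R ^+ 2) <= 1.
Proof.
have h1 := exp1B_le T rate_le1.
have h2 : 128 * m%:R ^+ 2 <= expR (7 + (l%:R + l%:R)) :> R.
  rewrite (expRD 7) (expRD l%:R) expr2; apply: ler_pM; rewrite ?mulr_ge0 //.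
    by apply: le_trans (pow2_le_expR 7); rewrite ler_nat.
  by apply: ler_pM => //; exact: m_le_expR.
have s0 : 0 <= (1 - rate) ^+ T by rewrite exprn_ge0 // subr_ge0 rate_le1.
apply: le_trans (ler_pM s0 _ h1 h2) _; first by rewrite mulr_ge0 // exprn_ge0.
by rewrite rate_mul_T -expRD -[X in _ <= X]expR0 ler_expR; move: l1; lra.
Qed.

(** The rate uses half of gap^2 / 640; the other half absorbs the tail. The tail is compared with (1
    / (2 m))^2 and not with kap, which may be much smaller. *)
Lemma rate_expansion (V : eqType) (es : seq (V * V)) : size es = m ->
  rate * cutoff ^+ 2 <= gap es kap ^+ 2 / 640 - 2 * tail cutoff.
Proof.
move=> sz.
have -> : rate * cutoff ^+ 2 = kap / 1280.
  by rewrite /rate; field; rewrite gt_eqF // cutoff_gt0.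
set c := gap es kap.
have c1 : kap <= c ^+ 2.
  rewrite -(sqr_sqrtr (ltW kap_gt0)) ler_sqr ?nnegrE ?sqrtr_ge0 //; last first.
    by rewrite /c /gap le_max sqrtr_ge0.
  by rewrite /c /gap le_max lexx.
have mm0 : 0 < m%:R :> R by rewrite ltr0n (ltn_trans _ m1).
have c2 : (2 * m%:R)^-1 ^+ 2 <= c ^+ 2.
  rewrite ler_sqr ?nnegrE ?invr_ge0 ?mulr_ge0 //; last by rewrite /c /gap le_max sqrtr_ge0.
  by rewrite /c /gap le_max sz lexx orbT.
have tl : tail cutoff * (10240 * m%:R ^+ 2) <= 1.
  rewrite /tail /cutoff.
  have h2 : 32 * (10240 * m%:R ^+ 2) <= expR (19 + (l%:R + l%:R)) :> R.
    rewrite mulrA (expRD 19) (expRD l%:R) expr2; apply: ler_pM; rewrite ?mulr_ge0 //.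
      have := pow2_le_expR 19; rewrite natrX; apply: le_trans; lra.
    by apply: ler_pM => //; exact: m_le_expR.
  have := ler_wpM2l (expR_ge0 (2 - 100 * l%:R / 2 : R)) h2; rewrite -expRD => h3.
  have h4 : expR (2 - 100 * l%:R / 2 + (19 + (l%:R + l%:R))) <= 1 :> R.
    by rewrite -[X in _ <= X]expR0 ler_expR; move: l1; lra.
  by move: h3 h4; lra.
have : tail cutoff <= c ^+ 2 / 2560.
  have q : (2 * m%:R)^-1 ^+ 2 = (4 * m%:R ^+ 2)^-1 :> R by field; rewrite gt_eqF.
  apply: (@le_trans _ _ ((4 * m%:R ^+ 2)^-1 / 2560)); last by rewrite -q ler_pM2r ?invr_gt0.
  rewrite -invfM -[X in _ <= X]mul1r ler_pdivlMr ?mulr_gt0 ?exprn_gt0 //.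
  by move: tl; lra.
by lra.
Qed.

End Regime.
End Estimates.

(** * Correctness *)

Section ProbabilityAverage.
Variable R : realType.

Lemma sum_tuple_avg T (F : seq bool -> R) :
  \sum_(w : T.-tuple bool) F w = 2 ^+ T * avg T F.
Proof.
elim: T F => [|T IH] F.
  rewrite expr0 mul1r (big_pred1 [tuple]) // => w.
  exact/esym/eqP/tuple0.
pose h (p : bool * T.-tuple bool) : T.+1.-tuple bool := [tuple of p.1 :: p.2].
pose g (w : T.+1.-tuple bool) := (thead w, [tuple of behead w]).
have hg : {on [pred w | true], bijective h}.
  exists g => [[b w] _|w _]; rewrite /h /g /=; last by rewrite -tuple_eta.
  by congr pair; apply: val_inj.
rewrite (reindex h) //= -(pair_big predT predT (fun b (w : T.-tuple bool) => F (b :: w))) /=.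
rewrite big_bool /= (IH (fun w => F (true :: w))) (IH (fun w => F (false :: w))) exprS; lra.
Qed.

Lemma prob_avg T (Q : seq bool -> Prop) :
  prob R (fun w : T.-tuple bool => Q w) = avg T (fun w => (`[< Q w >])%:R).
Proof.
rewrite /prob card_tuple card_bool natrX.
have -> : #|[set w : T.-tuple bool | `[< Q w >]]|%:R = \sum_(w : T.-tuple bool) (`[< Q w >])%:R :> R.
  rewrite -sum1_card natr_sum big_mkcond; apply: eq_bigr => w _.
  by rewrite inE; case: `[< _ >].
by rewrite (sum_tuple_avg T (fun w => (`[< Q w >])%:R)) mulrAC divff ?mul1r // expf_neq0 // pnatr_eq0.
Qed.

End ProbabilityAverage.

Lemma boundary_le (V : eqType) (es : seq (V * V)) (A : V -> bool) :
  (boundary es A <= count A (half_edges es))%N.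
Proof.
rewrite /boundary /half_edges count_cat !count_map.
elim: es => //= p r IH; rewrite addnACA; apply: leq_add IH.
by case: (A p.1); case: (A p.2).
Qed.

Lemma boundary_predC (V : eqType) (es : seq (V * V)) (A : V -> bool) :
  boundary es (predC A) = boundary es A.
Proof. by apply: eq_count => p /=; case: (A p.1); case: (A p.2). Qed.

(** * Outcomes satisfy the specification *)

Section Validity.
Variables (R : realType) (n : nat) (e : rel 'I_n) (es0 : seq ('I_n * 'I_n)) (phi : R).
Hypotheses (sym : symmetric e) (irr : irreflexive e) (el : edge_list e es0).
Hypotheses (m1 : (2 <= #|edges e|)%N) (phi0 : 0 < phi) (phi1 : phi <= 1).
Variable T : nat.
Hypotheses (T1 : 12 * phi * T%:R <= 1) (T2 : 1 < 12 * phi * T.+1%:R).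

Local Notation es := (nat_edges es0).
Local Notation hs := (half_edges es).
Local Notation m := #|edges e|.
Local Notation l := (log2S m).
Local Notation M := (m%:R : R).
Local Notation lnm := (ln M).
Local Notation q := (lnm `^ (3 / 2)).
Local Notation sp := (Num.sqrt phi).

(** Its square 10^16 must exceed 64 * 10^10 * 64 * 24: see [sqrt_kap_le]. *)
Definition cut_const : R := 100 * 100 * 100 * 100.
(** With q >= 1/4 it keeps the required volume below m / 4; its square is also below 12 / 64, as
    freezing requires. *)
Definition balance_const : R := 16^-1.

Let sz : size es = m. Proof. exact: size_nat_edges. Qed.
Let M1 : 2 <= M. Proof. by rewrite ler_nat. Qed.
Let x1 : 2^-1 <= lnm. Proof. exact: ln_ge2V. Qed.
Let xl : lnm <= l%:R. Proof. by apply: ln_le_log2S; rewrite (ltn_trans _ m1). Qed.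
Let lx : l%:R <= 4 * lnm. Proof. exact: log2S_le_ln. Qed.

Let q_ge0 : 0 <= q. Proof. exact: powR_ge0. Qed.

Let qq : q ^+ 2 = lnm ^+ 3.
Proof.
have x0 : 0 <= lnm by move: x1; lra.
rewrite -powR_mulrn ?powR_ge0 // -powRrM -powR_mulrn //; congr (_ `^ _); by field.
Qed.

Let q_ge : 4^-1 <= q.
Proof.
have : 4^-1 ^+ 2 <= q ^+ 2.
  rewrite qq; apply: le_trans (_ : 2^-1 ^+ 3 <= _); first by lra.
  by rewrite lerXn2r ?nnegrE ?invr_ge0 //; move: x1; lra.
by rewrite ler_sqr ?nnegrE ?invr_ge0.
Qed.

Let q_gt0 : 0 < q. Proof. by apply: lt_le_trans q_ge; rewrite invr_gt0. Qed.

Let sp0 : 0 < sp. Proof. by rewrite sqrtr_gt0. Qed.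
Let sp1 : sp <= 1. Proof. by rewrite -sqrtr1 ler_sqrt. Qed.
Let sp2 : sp ^+ 2 = phi. Proof. by rewrite sqr_sqrtr // ltW. Qed.

Let cube_le : cube R l <= 64 * q ^+ 2.
Proof.
rewrite qq /cube; have -> : 64 * lnm ^+ 3 = (4 * lnm) * (4 * lnm) * (4 * lnm) by ring.
by rewrite !ler_pM // ?mulr_ge0.
Qed.

Let cube_ge : q ^+ 2 <= cube R l.
Proof.
have x0 : 0 <= lnm by move: x1; lra.
rewrite qq /cube; have -> : lnm ^+ 3 = lnm * lnm * lnm by ring.
by rewrite !ler_pM // ?mulr_ge0.
Qed.

Let balance_le : balance_const * (M * sp / q) <= M / 4.
Proof.
have M0 : 0 < M by move: M1; lra.
rewrite /balance_const mulrA ler_pdivrMr //.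
have h1 : M * sp <= M * 1 by rewrite ler_pM2l.
have h2 : M * 4^-1 <= M * q by rewrite ler_pM2l.
by lra.
Qed.

Lemma valid_cut_side (S : {set 'I_n}) (A : nat -> bool) :
  (forall v : 'I_n, val v \in hs -> A v = (v \in S)) ->
  [/\ (vol e S)%:R = volR R es A, (vol e (~: S))%:R = 2 * M - volR R es A &
      (border e S)%:R = (boundary es A)%:R :> R].
Proof.
move=> AS.
have E1 := vol_count irr sym el AS; have E2 : vol e (~: S) = count (predC A) hs.
  by apply: (vol_count irr sym el) => v vh; rewrite in_setC /= AS.
rewrite E1 E2 volR_natE.
rewrite /border (border_boundary el AS); split=> //.
have := count_predC A hs; rewrite size_half_edges sz -mul2n => /(congr1 (fun k => k%:R : R)).
by rewrite natrD natrM; lra.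
Qed.

Lemma conductance_le (S : {set 'I_n}) (b : R) : 0 <= b ->
  (border e S)%:R <= b * (vol e S)%:R -> (border e S)%:R <= b * (vol e (~: S))%:R ->
  conductance e R S <= b.
Proof.
move=> b0 h1 h2; rewrite /conductance.
have h : (border e S)%:R <= b * (minn (vol e S) (vol e (~: S)))%:R by case: leqP.
(* A side of volume 0 has conductance 0 by the convention on division. *)
move: (minn _ _) h => [|k] h; first by rewrite invr0 mulr0.
by rewrite ler_pdivrMr ?ltr0n.
Qed.

Lemma vol_gt0_neq0 (S : {set 'I_n}) : 0 < (vol e S)%:R :> R -> S != set0.
Proof.
by move=> h; apply: contraTneq h => ->; rewrite /vol big_set0 ltxx.
Qed.

Lemma set_alive (s : store R) A : alive_is es s A ->
  forall v : 'I_n, val v \in hs -> A v = (v \in [set u : 'I_n | imem s 4 u != 0%N]).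
Proof. by move=> aA v vh; rewrite inE (alive_in aA). Qed.

Lemma valid_greedy (s : store R) : T%:R < kap_const R * cube R l -> greedy_post es s ->
  valid_outcome e phi cut_const balance_const (output n s).
Proof.
move=> big [flag [A [aA /andP [c1 c2]]]]; rewrite /output flag /=.
set S := [set v | _]; have [vS vC bE] := valid_cut_side (set_alive aA).
rewrite -/S in vS vC bE.
have W1 : M <= 2 * volR R es A by rewrite volR_natE -natrM ler_nat -sz.
have W2 : 2 * volR R es A < 3 * M by rewrite volR_natE -!natrM ltr_nat -sz.
have M0 : 0 < M by move: M1; lra.
have b1 : (boundary es A)%:R <= volR R es A by rewrite volR_natE ler_nat boundary_le.
have b2 : (boundary es A)%:R <= 2 * M - volR R es A.
  rewrite -vC (vol_count irr sym el (A := predC A)); last first.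
    by move=> v vh; rewrite in_setC /= (set_alive aA vh).
  by rewrite ler_nat -(boundary_predC es A) boundary_le.
have cut1 : 1 <= cut_const * (sp * q).
  have T1' : T.+1%:R <= 2 * (kap_const R * cube R l).
    rewrite -natr1; have : 1 <= kap_const R * cube R l.
      have : 4^-1 ^+ 2 <= q ^+ 2 by rewrite ler_sqr ?nnegrE ?invr_ge0.
      by rewrite /kap_const; move: cube_ge; lra.
    by move: big; lra.
  have h1 : 1 < 12 * phi * (2 * (kap_const R * cube R l)).
    by apply: lt_le_trans T2 _; rewrite ler_pM2l // mulr_gt0.
  have h2 : 12 * phi * (2 * (kap_const R * cube R l)) <= (cut_const * (sp * q)) ^+ 2.
    rewrite !exprMn sp2.
    have := ler_wpM2l (ltW phi0) cube_le; rewrite /kap_const /cut_const => h.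
    have : 0 <= phi * q ^+ 2 by rewrite mulr_ge0 ?sqr_ge0 // ltW.
    by move: h; lra.
  have h3 : 1 ^+ 2 <= (cut_const * (sp * q)) ^+ 2 by rewrite expr1n ltW // (lt_le_trans h1).
  by move: h3; rewrite ler_sqr ?nnegrE // /cut_const !mulr_ge0 // ltW.
have bal := balance_le.
split.
- rewrite /is_cut; apply/andP; split; apply: vol_gt0_neq0; rewrite ?vS ?vC; lra.
- apply: le_trans (conductance_le ler01 _ _) cut1; rewrite mul1r bE ?vS ?vC //.
- by left; rewrite vS vC; split; lra.
Qed.

Definition set_pred (X : {set 'I_n}) (k : nat) : bool := [exists v in X, val v == k].

Lemma set_predE (X : {set 'I_n}) (v : 'I_n) : set_pred X (val v) = (v \in X).
Proof.
apply/existsP/idP => [[u /andP [uX /eqP E]]|vX]; last by exists v; rewrite vX eqxx.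
by rewrite -(val_inj E).
Qed.

Lemma expanding_border (A : nat -> bool) (S X : {set 'I_n}) :
  (forall v : 'I_n, val v \in hs -> A v = (v \in S)) -> expanding R es T A ->
  X \subset S -> (vol e X)%:R <= (vol e S)%:R / 2 :> R ->
  6 * phi * (vol e X)%:R <= #|edges_between e X (~: X)|%:R.
Proof.
move=> AS eA XS X2.
have XE : forall v : 'I_n, val v \in hs -> set_pred X v = (v \in X) by move=> v _; exact: set_predE.
have [vS _ _] := valid_cut_side AS; have [vX _ _] := valid_cut_side XE.
rewrite (border_boundary el XE) vX.
have h : volR R es (set_pred X) <= 2 * T%:R * (boundary es (set_pred X))%:R.
  apply: eA; last by rewrite -vX -vS; lra.
  move=> k kh /existsP [v /andP [vX' /eqP E]]; rewrite -E AS ?E //.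
  exact: (subsetP XS).
have := ler_wpM2l (ltW phi0) h.
have := ler_wpM2r (ler0n R (boundary es (set_pred X))) T1.
by lra.
Qed.

Lemma vol_gt0_edge (X : {set 'I_n}) : (forall v : 'I_n, val v \in hs) -> X != set0 ->
  0 < (vol e X)%:R :> R.
Proof.
move=> all_hs /set0Pn [v vX]; rewrite ltr0n /vol (bigD1 v) //=.
by rewrite (degree_deg irr sym el) addn_gt0 deg_gt0.
Qed.

(** The side of smaller volume has at most half of the total, so near expansion of everything bounds
    its conductance. Without isolated vertices its volume is positive and the quotient is a genuine
    one. *)
Lemma valid_certificate (A : nat -> bool) : expanding R es T A ->
  {in hs, forall v, A v} -> (forall v : 'I_n, val v \in hs) -> phi <= graph_conductance e R.
Proof.
move=> eA allA all_hs; apply: le_bigmin => // S /andP [S0 C0].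
have AT : forall v : 'I_n, val v \in hs -> A v = (v \in [set: 'I_n]).
  by move=> v vh; rewrite inE allA.
have half (X : {set 'I_n}) : X != set0 -> ~: X != set0 -> (vol e X <= vol e (~: X))%N ->
    phi <= conductance e R X.
  move=> X0 CX0 h; rewrite /conductance (minn_idPl h) ler_pdivlMr ?vol_gt0_edge //.
  have [vT _ _] := valid_cut_side AT.
  have XE : forall v : 'I_n, val v \in hs -> set_pred X v = (v \in X) by move=> v _; exact: set_predE.
  have [vX vC _] := valid_cut_side XE.
  have WT : volR R es A = 2 * M.
    rewrite volR_natE -sz -natrM; congr (_%:R); rewrite mul2n -size_half_edges.
    by apply/eqP; rewrite -all_count; apply/allP.
  have := expanding_border AT eA (subsetT X) _; rewrite -/(border e X) => H.
  have : 6 * phi * (vol e X)%:R <= (border e X)%:R.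
    by apply: H; rewrite vT WT; move: h; rewrite -(ler_nat R) vC vX; lra.
  have : 0 <= phi * (vol e X)%:R by rewrite mulr_ge0 // ltW.
  by lra.
case: (leqP (vol e S) (vol e (~: S))) => h; first exact: half.
have := half (~: S) C0; rewrite setCK => /(_ S0 (ltnW h)).
rewrite /conductance setCK minnC; congr (_ <= _ / _).
have XE : forall v : 'I_n, val v \in hs -> set_pred S v = (v \in S) by move=> v _; exact: set_predE.
rewrite /border (border_boundary el XE) (border_boundary (A := predC (set_pred S)) el) ?boundary_predC //.
by move=> v vh; rewrite in_setC /= XE.
Qed.

Let sub_iota : {subset undup hs <= iota 0 n}.
Proof.
move=> v; rewrite mem_undup mem_iota /= add0n => /half_edge_ord [u <-]; exact: ltn_ord.
Qed.

Lemma covered : (n <= size (undup hs))%N -> forall v : 'I_n, val v \in hs.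
Proof.
move=> h v; rewrite -(mem_undup hs).
have [|_ ->] := uniq_min_size (undup_uniq hs) sub_iota; first by rewrite size_iota.
by rewrite mem_iota add0n ltn_ord.
Qed.

Lemma uncovered : (size (undup hs) < n)%N -> exists v : 'I_n, val v \notin hs.
Proof.
move=> h; apply/existsP; apply: contraLR h => /existsPn all_hs; rewrite -leqNgt.
rewrite -[X in (X <= _)%N](size_iota 0); apply: uniq_leq_size (iota_uniq _ _) _ => v.
rewrite mem_iota add0n mem_undup => vn.
by have := all_hs (Ordinal vn); rewrite negbK.
Qed.

Section MainRegime.
Hypothesis hT : kap_const R * cube R l <= T%:R.
Local Notation kap := (kap_of R l T).
Local Notation eps := (eps_of R l T).
Local Notation bet := (bet_of R es l T).

Let lE : l = log2S m := erefl.

Let cube1 : 1 <= cube R l.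
Proof.
have l1 : 1 <= l%:R :> R by rewrite ler1n.
by rewrite /cube !mulr_ege1.
Qed.

Let T1r : 1 <= T%:R :> R.
Proof. by rewrite ler1n -(ltr0n R) (T_gt0 lE hT). Qed.

Let cT0 : 0 < cube R l * T%:R.
Proof. by rewrite mulr_gt0 ?(lt_le_trans ltr01). Qed.

Lemma bet_le : bet <= M ^+ 2.
Proof.
rewrite /bet_of sz ler_pdivrMr // -expr2 ler_peMr ?sqr_ge0 //.
by apply: le_trans (ler_pM ler01 ler01 cube1 T1r); rewrite mul1r.
Qed.

Lemma bet_gt0 : 0 < bet.
Proof. by rewrite /bet_of sz divr_gt0 // mulr_gt0 //; move: M1; lra. Qed.

Let invT_le : T%:R^-1 <= 24 * phi.
Proof.
rewrite -[X in X <= _]mul1r ler_pdivrMr ?(lt_le_trans ltr01) //.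
have := ler_wpM2l (ltW phi0) T1r.
by move: T2; rewrite -natr1; lra.
Qed.

Let invT_ge : 12 * phi <= T%:R^-1.
Proof. by rewrite -[X in _ <= X]mul1r ler_pdivlMr ?(lt_le_trans ltr01). Qed.

(** The factor 8 serves the bound by vol A: the removed volume is at most 2 m, and m <= 4 vol A. *)
Lemma sqrt_kap_le : 8 * Num.sqrt kap <= cut_const * (sp * q).
Proof.
have c0 : 0 <= cut_const * (sp * q) by rewrite /cut_const !mulr_ge0 // ltW.
have h : 64 * kap <= (cut_const * (sp * q)) ^+ 2.
  rewrite !exprMn sp2 /kap_of /cut_const.
  have h1 : kap_const R * cube R l * T%:R^-1 <= kap_const R * (64 * q ^+ 2) * (24 * phi).
    apply: ler_pM => //; rewrite ?invr_ge0 ?mulr_ge0 // /kap_const ?mulr_ge0 ?(le_trans ler01) //.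
    by rewrite ler_pM2l // !mulr_gt0.
  have : 0 <= phi * q ^+ 2 by rewrite mulr_ge0 ?sqr_ge0 // ltW.
  by move: h1; rewrite /kap_const; lra.
have k0 : 0 <= kap by exact: ltW (kap_gt0 lE hT).
have -> : 8 * Num.sqrt kap = Num.sqrt (64 * kap).
  rewrite (@sqrtrM R 64 kap) //; congr (_ * _); rewrite (_ : 64 = 8 ^+ 2); last by ring.
  by rewrite sqrtr_sqr ger0_norm.
by rewrite -[X in _ <= X]ger0_norm // -sqrtr_sqr ler_sqrt // sqr_ge0.
Qed.

Lemma valid_main (L : nat) (w : seq bool) (s : store R) :
  main_post n es T l L w s ->
  ~~ bad es bet T (epochs es 0%N kap eps bet T L (@all_v nat) w) ->
  valid_outcome e phi cut_const balance_const (output n s).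
Proof.
set A := epochs _ _ _ _ _ _ _ _ _ => -[aA flag] nbad; rewrite -/A in aA flag.
have M0 : 0 < M by move: M1; lra.
have [bA mA] : balanced_inv es kap A.
  apply: balanced_inv_epochs; rewrite ?eps_ge0 ?(kap_gt0 lE hT) //.
  - have := eps_kap lE hT; have : Num.sqrt kap <= 1 by rewrite -sqrtr1 ler_sqrt // (kap_le1 lE hT).
    by have := eps_ge0 R l T; lra.
  - by rewrite sz; exact: bet_le.
  rewrite /balanced_inv volR_all sz subrr mulr0; split; last by lra.
  by rewrite (_ : boundary _ _ = 0%N) //; apply/eqP; rewrite -leqn0 leqNgt -has_count; apply/hasPn.
rewrite sz in bA mA.
rewrite /output flag; set S := [set v | _].
have AS : forall v : 'I_n, val v \in hs -> A v = (v \in S) := set_alive aA.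
case: ifP => [|/negbT].
  rewrite eqb0 negbK => /andP [cA nu].
  have allA : {in hs, forall v, A v}.
    apply/allP; rewrite all_count eqn_leq cA andbT; exact: count_size.
  have hs_all : forall v : 'I_n, val v \in hs.
    exact: covered.
  apply: (valid_certificate _ allA hs_all).
  (* Nothing was removed and the freezing threshold is positive, so A is not frozen; not being bad
     then means expanding. *)
  apply/asboolP; apply: contraNT nbad => ne; rewrite /bad ne andbT.
  have W2 : volR R es A = 2 * M.
    rewrite volR_natE -sz -natrM; congr (_%:R); rewrite mul2n -size_half_edges.
    by apply/eqP; rewrite -all_count; apply/allP => v; exact: allA.
  by rewrite /frozen sz W2 subrr mulr0 -ltNge bet_gt0.
rewrite eqb0 negbK => nflag.
have [vS vC bE] := valid_cut_side AS.
set W := volR R es A in bA mA vS vC.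
have C0 : 0 <= 2 * M - W by rewrite -vC.
have sk0 := sqrtr_ge0 kap.
split.
- rewrite /is_cut vol_gt0_neq0 ?vS /=; last by lra.
  (* The complement is nonempty because volume was removed or because some vertex is isolated. *)
  move: nflag; rewrite negb_and -!ltnNge => /orP [cA|nu].
    apply: vol_gt0_neq0; rewrite vC /W volR_natE -sz -natrM subr_gt0 ltr_nat.
    by rewrite mul2n -size_half_edges.
  apply/set0Pn.
  have [v vh] := uncovered nu.
  exists v; rewrite !inE aA; by rewrite negb_and vh.
- apply: le_trans (sqrt_kap_le); apply: conductance_le; rewrite ?mulr_ge0 // bE ?vS ?vC.
    by apply: le_trans bA _; nra.
  by apply: le_trans bA _; nra.
have e2 : (sp / q) ^+ 2 = phi / q ^+ 2 by rewrite exprMn sp2 exprVn.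
have sqE b : (b * (M * sp / q)) ^+ 2 = b ^+ 2 * (M ^+ 2 * (phi / q ^+ 2)).
  by rewrite -e2; move: (q^-1) => i; ring.
have q20 : 0 < q ^+ 2 by rewrite exprn_gt0.
have cT : (cube R l * T%:R)^-1 = (cube R l)^-1 * T%:R^-1 by rewrite invfM.
have c0 : 0 < cube R l by apply: lt_le_trans cube1.
(* Frozen means that the removed volume is at least sqrt bet, which gives balance. Otherwise it is
   below sqrt bet and, A not being bad, A expands. *)
case: (boolP (frozen es bet A)) => fr; [left|right].
  rewrite vS vC; split; first by apply: le_trans balance_le _; move: mA; lra.
  rewrite -ler_sqr ?nnegrE // ?mulr_ge0 ?invr_ge0 // ?(ltW sp0) ?(ltW M0) //.
  move: fr; rewrite /frozen sz -expr2; apply: le_trans.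
  rewrite /bet_of sz cT sqE /balance_const.
  have h1 : (64 * q ^+ 2)^-1 <= (cube R l)^-1 by rewrite lef_pV2 ?posrE ?mulr_gt0.
  have h2 : (64 * q ^+ 2)^-1 * (12 * phi) <= (cube R l)^-1 * T%:R^-1.
    by apply: ler_pM => //; rewrite ?invr_ge0 ?mulr_ge0 // ltW.
  have h3 := ler_wpM2l (sqr_ge0 M) h2.
  have h4 : 0 <= M ^+ 2 * (phi / q ^+ 2) by rewrite mulr_ge0 ?sqr_ge0 // divr_ge0 // ltW.
  by move: h3; rewrite invfM -expr2; lra.
split; last first.
  move=> X XS X2; apply: (expanding_border AS) => //.
  by move: nbad; rewrite /bad fr /= negbK => /asboolP.
rewrite vC -ler_sqr ?nnegrE // ?mulr_ge0 ?invr_ge0 // ?(ltW sp0) ?(ltW M0) //.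
have fr2 : (2 * M - W) ^+ 2 <= bet.
  by move: fr; rewrite /frozen sz -ltNge -expr2 => /ltW.
apply: le_trans fr2 _.
rewrite /bet_of sz cT sqE /cut_const.
have h1 : (cube R l)^-1 <= (q ^+ 2)^-1 by rewrite lef_pV2 ?posrE.
have h2 : (cube R l)^-1 * T%:R^-1 <= (q ^+ 2)^-1 * (24 * phi).
  by apply: ler_pM => //; rewrite invr_ge0 // ltW.
have h3 := ler_wpM2l (sqr_ge0 M) h2.
have h4 : 0 <= M ^+ 2 * (phi / q ^+ 2) by rewrite mulr_ge0 ?sqr_ge0 // divr_ge0 // ltW.
by move: h3; rewrite -expr2; lra.
Qed.

End MainRegime.

End Validity.

(** Every term is a product of factors bounded by (d + 1) lg, m, T + 1 and T + 1. Here T + 1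
    replaces T because T may be 0. *)
Lemma program_cost (d T l lg m N k0 r : nat) :
  (0 < lg)%N -> (0 < m)%N -> (l <= m)%N -> N = m.*2 -> forall es : seq (nat * nat),
  size es = m -> size (half_edges es) = N ->
  (k0 <= T * 2 + l * 4 + lg * 4 + m * 6 + N * 4 + lg * d * 4 + lg * d * T * 4 + 32)%N ->
  (r <= finish_cost es T (lg * d) + 1)%N ->
  (k0 + (lg * d * T * N * 4 + r) <= 1000 * (d.+1 * lg * m * T.+1 * T.+1))%N.
Proof.
move=> lg0 m0 lm NE es sz sN hk hr.
set L := (lg * d)%N in hk hr *; set X := (d.+1 * lg * m * T.+1 * T.+1)%N.
have H a b c f : (a <= d.+1 * lg)%N -> (b <= m)%N -> (c <= T.+1)%N -> (f <= T.+1)%N ->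
    (a * b * c * f <= X)%N by move=> *; rewrite /X !leq_mul.
have L1 : (L <= d.+1 * lg)%N by rewrite /L mulnC leq_mul2r leqnSn orbT.
have o1 : (1 <= d.+1 * lg)%N by rewrite muln_gt0.
have lg1 : (lg <= d.+1 * lg)%N by rewrite leq_pmull.
have t1 := H 1%N 1%N T 1%N o1 m0 (leqnSn _) isT.
have t2 := H 1%N l 1%N 1%N o1 lm isT isT.
have t3 := H lg 1%N 1%N 1%N lg1 m0 isT isT.
have t4 := H 1%N m 1%N 1%N o1 (leqnn _) isT isT.
have t5 := H L 1%N 1%N 1%N L1 m0 isT isT.
have t6 := H L 1%N T 1%N L1 m0 (leqnSn _) isT.
have t7 := H 1%N 1%N 1%N 1%N o1 m0 isT isT.
have t8 := H L m T 1%N L1 (leqnn _) (leqnSn _) isT.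
have t9 := H L m T T L1 (leqnn _) (leqnSn _) (leqnSn _).
have t10 := H L 1%N T T L1 m0 (leqnSn _) (leqnSn _).
have t11 := H L m 1%N 1%N L1 (leqnn _) isT isT.
move: hk hr; rewrite /finish_cost /main_cost /round_cost sN sz NE -!addnn.
lia.
Qed.

Theorem theorem4p2 (R : realType) (d : nat) :
  exists (P : cmd) (K C c : R),
    [/\ 0 < K, 0 < C, 0 < c &
      forall (n : nat) (e : rel 'I_n) (es : seq ('I_n * 'I_n)) (phi : R),
        symmetric e -> irreflexive e -> edge_list e es ->
        (2 <= #|edges e|)%N -> 0 < phi -> phi <= 1 ->
        exists T : nat,
          [/\ T%:R <= K * (#|edges e|%:R * ln n%:R / phi ^+ 2),
              forall w : T.-tuple bool, halted (run P (input es phi) w)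
            & 1 - n%:R ^- d <=
              prob R (fun w : T.-tuple bool =>
                valid_outcome e phi C c
                  (output n (run P (input es phi) w).2))]].
Proof.
(* 16000 = 1000 * 4 * 2 * 2, from [program_cost], lg <= 4 ln n, and T + 1 <= 2 / phi twice. *)
exists (program d), (16000 * d.+1%:R), (cut_const R), (balance_const R).
split; rewrite ?mulr_gt0 ?invr_gt0 //.
move=> n e es0 phi sym irr el m1 phi0 phi1.
set m := #|edges e| in m1 *; pose es := nat_edges es0; pose s0 := input es0 phi.
have m0 : (0 < m)%N by apply: ltn_trans m1.
have sz : size es = m by exact: (size_nat_edges el).
have n1 : (1 < n)%N.
  have : (0 < size es0)%N by move: m0; rewrite -sz size_map.
  case: (es0) el => [//|[u v] r] el _.
  have uv := edge_neq irr el (mem_head _ _).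
  have := ltn_ord u; have := ltn_ord v; move: uv; rewrite -(inj_eq val_inj) /=.
  by lia.
have n0 : (0 < n)%N by apply: ltn_trans n1.
pose T := Num.Def.trunc (12 * phi)^-1.
have p12 : 0 < 12 * phi by rewrite mulr_gt0.
have ip : 0 < (12 * phi)^-1 by rewrite invr_gt0.
have /andP [hT1 hT2] := truncn_itv (ltW ip).
have T1 : 12 * phi * T%:R <= 1 by rewrite mulrC -ler_pdivlMr // mul1r.
have T2 : 1 < 12 * phi * T.+1%:R by rewrite mulrC -ltr_pdivrMr // mul1r.
have I0 : instance n es s0.
  split=> //=; first by rewrite size_map.
    move=> i im; rewrite -(nth_map _ 0%N fst) // /es /nat_edges -map_comp.
    by congr (nth _ _ _); apply: eq_map.
  move=> i im; rewrite -(nth_map _ 0%N snd) // /es /nat_edges -map_comp.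
  by congr (nth _ _ _); apply: eq_map.
have z0 a i : (2 < a)%N -> imem s0 a i = 0%N by move: a => [|[|[|a]]].
have es_gt0 : (0 < size es)%N by rewrite sz.
have degm : forall v, (deg es v <= size es)%N by exact: (deg_le irr el).
have [k0 [r [hk hr run]]] := program_run d I0 (erefl _) z0 phi0 T1 T2 n0 es_gt0 degm.
move: hk hr run; rewrite sz; set l := log2S m; set lg := log2S n; set L := (lg * d)%N.
set B := (L * T * size (half_edges es))%N => hk hr run.
set T0 := (k0 + (B * 4 + r))%N in run.
have runT (w : T0.-tuple bool) := run w (size_tuple w).
exists T0; split.
- have hc : (T0 <= 1000 * (d.+1 * lg * m * T.+1 * T.+1))%N.
    by apply: (program_cost (l := l) _ _ _ _ sz) hk hr => //; rewrite ?size_half_edges ?sz ?log2S_le.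
  apply: (@le_trans _ _ (1000 * (d.+1 * lg * m * T.+1 * T.+1))%:R); first by rewrite ler_nat.
  have t2 : T.+1%:R <= 2 / phi.
    rewrite ler_pdivlMr // -natr1; lra.
  have lgl : lg%:R <= 4 * ln n%:R :> R by exact: log2S_le_ln.
  rewrite !natrM.
  have x0 : 0 <= ln n%:R :> R by have := ln_ge2V R n1; lra.
  have -> : 16000 * d.+1%:R * (m%:R * ln n%:R / phi ^+ 2) =
      1000 * (d.+1%:R * (4 * ln n%:R) * m%:R * (2 / phi) * (2 / phi)) :> R.
    by field; rewrite gt_eqF.
  by rewrite ler_pM2l // !ler_pM ?mulr_ge0 // ler_pM2l.
- by move=> w; have [s' [-> _]] := runT w.
rewrite (@prob_avg R T0 (fun w => valid_outcome e phi (cut_const R) (balance_const R)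
                  (output n (Defs.run (program d) (input es0 phi) w).2))).
(* The greedy case succeeds for all bits, so its probability is 1. *)
case: (lerP (kap_const R * cube R l) T%:R) => hT; last first.
  apply: (@le_trans _ _ (avg T0 (fun=> 1))).
    by rewrite avg_const lerBlDr lerDl invr_ge0 exprn_ge0.
  apply: le_avg => w sw; have [s' [E fin]] := run w sw.
  rewrite -/s0 E /=; case: asboolP => // nv; case: nv.
  move: fin; rewrite /final leNgt hT /=.
  exact: (valid_greedy sym irr el m1 phi0 phi1 T2 hT).
pose A w := epochs es 0%N (kap_of R l T) (eps_of R l T) (bet_of R es l T) T L (@all_v nat) w.
pose bd w := bad es (bet_of R es l T) T (A w).
apply: (@le_trans _ _ (avg T0 (fun w => 1 + (-1) * (bd (picks B (drop k0 w)))%:R))); last first.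
  apply: le_avg => w sw; have [s' [E fin]] := run w sw.
  rewrite -/s0 E /=; case: asboolP => [_|nv]; first by case: (bd _) => /=; lra.
  case bw: (bd _) => /=; first by lra.
  case: nv; move: fin; rewrite /final hT => fin.
  by apply: (valid_main sym irr el m1 phi0 phi1 T1 T2 hT fin); rewrite -/(A _) -/(bd _) bw.
(* The failure event depends on the picked bits only, so the bits of the setup and the ignored ones
   average out. *)
rewrite avgD avg_const avgZ mulN1r lerD2l lerN2 /T0 avg_cat.
have -> : avg k0 (fun w => avg (B * 4 + r) (fun w' => (bd (picks B (drop k0 (w ++ w'))))%:R)) =
   avg B (fun w => (bd w)%:R) :> R.
  rewrite -[RHS](avg_const k0); apply: eq_avg => w sw.
  rewrite -(avg_picks B r (fun w => (bd w)%:R)); apply: eq_avg => w' _.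
  by rewrite drop_size_cat.
have lE : l = log2S m by [].
rewrite /B -mulnA.
have hm : (1 < m)%N := m1.
have dT := rate_T lE hT; have eT := eps_T lE hT; have dc := rate_expansion hm lE hT sz.
have bl := bet_le el hT.
rewrite -sz in eT dT.
have := @avg_bad_epochs R nat es 0%N _ _ (bet_of R es l T) T (eps_ge0 R l T) (kap_gt0 lE hT) (kap_le1 lE hT)
  es_gt0 (eps_kap lE hT) eT.
rewrite sz => /(_ bl (cutoff R l) (rate R l T) (cutoff_gt0 R lE) dc (rate_le1 lE hT)).
rewrite -{1}sz => /(_ dT L (@all_v nat)) H; apply: le_trans H _.
apply: (@le_trans _ _ (2^-1 ^+ L)).
  by rewrite ler_piMr ?exprn_ge0 ?invr_ge0 //; case: (bad _ _ _ _).
(* L = lg d and n < 2^lg, hence n^d <= 2^L. *)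
rewrite exprVn lef_pV2 ?posrE ?exprn_gt0 ?ltr0n //.
rewrite -!natrX ler_nat /L expnM; have [->|d0] := posnP d; first by rewrite !expn0.
by rewrite leq_exp2r // ltnW // log2S_lt.
Qed.
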